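(* Let $k_{\max}>k^\star$ be an integer such that the prior $\Pi$ puts mass 1 on $\bigcup_{k\le k_{\max}}\Theta_k$. Assume that conditions (A1), (A2), (O1)($k_{\max}$), (O2)($k_{\max}$) and (O3), all written out in the context, are satisfied with $$D_2(k^\star)<\min_{k^\star<k\le k_{\max}}D_1(k).$$ Let $n_0$, $\delta_0$, $C_1$, $s>0$ and $\delta_{k,n}$ ($k^\star<k\le k_{\max}$, $n\geq 2$) be as defined in the context. Assume in addition that for every $k\in\{k^\star+1,\dots,k_{\max}\}$, for all integers $n\ge n_0$ such that $\delta_{k,n}<\delta_0$ and for every positive integer $j\le\lfloor\delta_0/\delta_{k,n}\rfloor$, $$\mathcal E\Big(\mathcal F_n^k\cap\big[S_k(2(j+1)\delta_{k,n})\setminus S_k(2j\delta_{k,n})\big],\frac{j\delta_{k,n}}4\Big)\le\frac{s}{1+s}\cdot\frac{nj\delta_{k,n}}{64(C_1+2)\log^2(j\delta_{k,n})}.$$ Then there exists $c_3'>0$ such that, for all $n\ge n_0$, $$P^{\star n}\{\widehat k_n^{\mathrm G}>k^\star\}\le c_3'\,\frac{(\log n)^{3\max_kD_1(k)/2+\beta_2}}{n^{\min_k[D_1(k)-D_2(k^\star)]/2}},$$ where in the max and the min the index $k$ ranges between $k^\star+1$ and $k_{\max}$.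
   Context: Model. $Z_1,\dots,Z_n$ are i.i.d. random variables with values in a measured space $(\mathcal Z,\mathcal F,\mu)$; $Z^n=(Z_1,\dots,Z_n)$. $(\Theta_k)_{k\ge1}$ is an increasing family of nested finite-dimensional parameter sets, $d$ is the Euclidean distance on each, $\Theta_\infty=\bigcup_{k\ge1}\Theta_k$, $\Theta_0=\varnothing$. For $\theta\in\Theta_\infty$, $f_\theta$ is the density with respect to $\mu$ of a probability measure $P_\theta$, and $\ell_\theta=\log f_\theta$. The common law of the $Z_i$ is $P^\star=P_{\theta^\star}$, with density $f^\star=f_{\theta^\star}$, $\ell^\star=\log f^\star$, where $\theta^\star\in\Theta_{k^\star}\setminus\Theta_{k^\star-1}$; the integer $k^\star$ is the order of $P^\star$, i.e. the unique $k$ such that $P^\star\in\{P_\theta:\theta\in\Theta_k\setminus\Theta_{k-1}\}$. $P^{\star n}$ is the $n$-fold product of $P^\star$. Standing assumptions: for every $k\ge1$, $(\Theta_k,d)$ is compact and $\theta\mapsto\ell_\theta(z)$ is continuous from $\Theta_k$ to $\mathbb R$ for every $z\in\mathcal Z$. Prior and estimator. $\Pi$ is a prior on $\Theta_\infty$ of the form $d\Pi(\theta)=\pi(k)\pi_k(\theta)\,d\theta$ for $\theta\in\Theta_k$, $k\ge1$ ($\pi$ is a probability on the orders, $\pi_k$ a probability density on $\Theta_k$; $\pi_k$ also denotes the associated probability measure). $\Pi(k|Z^n)$ is the posterior probability of $k$, and $\widehat k_n^{\mathrm G}=\arg\max_{k\ge1}\Pi(k|Z^n)$. Notation. $\lambda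 f$ denotes $\int f\,d\lambda$; $a\vee b=\max(a,b)$; $\lfloor a\rfloor$ is the largest integer strictly smaller than $a$. $L^1_+(\mu)$ is the set of nonnegative functions in $L^1(\mu)$; for $f\in L_+^1(\mu)$, $P_f$ is the measure with derivative $f$ with respect to $\mu$; $V(f,f')=P_f(\log f-\log f')^2$ (possibly $\infty$). $H(\theta)=P^\star(\ell^\star-\ell_\theta)$ is the Kullback–Leibler divergence ($\infty$ if $P^\star\not\ll P_\theta$). For $k\ge1$, $\delta>0$, $t\in\Theta_k$: $l_{t,\delta}=\inf\{f_{\theta'}:\theta'\in\Theta_k,d(t,\theta')<\delta\}$, $u_{t,\delta}=\sup\{f_{\theta'}:\theta'\in\Theta_k,d(t,\theta')<\delta\}$ (pointwise), $H_k^\star=\inf\{H(\theta'):\theta'\in\Theta_k\}$ (equal to $0$ for $k\ge k^\star$ and positive otherwise), $S_k(\delta)=\{\theta'\in\Theta_k:H(\theta')\le H_k^\star+\delta/2\}$. For $\alpha>0$, $q(\theta,\alpha)=P^\star\big[(\ell^\star-\ell_\theta)^2e^{\alpha(\ell^\star-\ell_\theta)}\big]+V(f^\star,f_\theta)\in[0,\infty]$. $\ell_n(\theta)=\sum_{i=1}^n\ell_\theta(Z_i)$, $\ell_n^\star=\sum_{i=1}^n\ell^\star(Z_i)$, $\mathbb B_n(k)=\pi(k)\int_{\Theta_k}e^{\ell_n(\theta)-\ell_n^\star}\,d\pi_k(\theta)$. Bracketing entropy. For functions $l\le u$, the bracket $[l,u]$ is the set of functions $f$ with $l\le f\le u$.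 It is a $\delta$-bracket if $l,u\in L_+^1(\mu)$, $\mu(u-l)\le\delta$, $P^\star(\log u-\log l)^2\le\delta^2$, $P_{u-l}(\log u-\log f^\star)^2\le\delta\log^2\delta$ and $P_l(\log u-\log l)^2\le\delta\log^2\delta$. For a class $\mathcal C$ of functions, $\mathcal E(\mathcal C,\delta)$ is the logarithm of the minimum number of $\delta$-brackets needed to cover $\mathcal C$; for a set of parameters $T$, $\mathcal E(T,\delta)$ means $\mathcal E(\{f_\theta:\theta\in T\},\delta)$. Conditions. (A1) For each $k\ge1$ there exist $\alpha,\bar\delta>0$, $M\ge1$ such that, for all $\delta\in(0,\bar\delta]$, $\sup\{q(\theta,\alpha):\theta\in S_k(\delta)\}\le M$. (A2) For every $k\ge1$ and $\theta\in\Theta_k$ there exists $\eta_\theta>0$ such that $V(u_{\theta,\eta_\theta},f^\star)+V(f^\star,l_{\theta,\eta_\theta})+V(f^\star,u_{\theta,\eta_\theta})+V(u_{\theta,\eta_\theta},f_\theta)<\infty$. (O1)($K$), for an integer $K>k^\star$: there exist $C_2,D_1(k)>0$ ($k=k^\star+1,\dots,K$) such that, for every sequence $\{\delta_n\}$ decreasing to $0$, all $n\ge1$ and all $k\in\{k^\star+1,\dots,K\}$, $\pi_k\{\theta\in\Theta_k:H(\theta)\le\delta_n\}\le C_2\delta_n^{D_1(k)/2}$. (O2)($K$): there exists $C_3>0$ such that, for each $k\in\{k^\star+1,\dots,K\}$, there exists a sequence $\{\mathcal F_n^k\}$, $\mathcal F_n^k\subset\Theta_k$, such that, for all $n\ge1$,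 $\pi_k\{(\mathcal F_n^k)^c\}\le C_3n^{-D_1(k)/2}$. (O3) There exist $\beta_1,L,D_2(k^\star)>0$ and $\beta_2\ge0$ such that, for all $n\ge1$, $$P^{\star n}\{\mathbb B_n(k^\star)<(\beta_1(\log n)^{\beta_2}n^{D_2(k^\star)/2})^{-1}\}\le L\frac{(\log n)^{3D_1(k^\star+1)/2+\beta_2}}{n^{[D_1(k^\star+1)-D_2(k^\star)]/2}}.$$ Constants. $C_1=5(1+\log^2M)/(2\alpha^2)$ with $\alpha,M$ the constants of (A1) (for the index $k$ under consideration). $n_0$ is the smallest integer $n$ such that $4\max_{m\ge n}\{m^{-1}\log[\beta_1(\log m)^{\beta_2}m^{D_2(k^\star)/2}]\}\le e^{-2}/2$, and $\delta_0=4\max_{m\ge n_0}\{m^{-1}\log[\beta_1(\log m)^{\beta_2}m^{D_2(k^\star)/2}]\}$. Given any $s>0$, for $k\in\{k^\star+1,\dots,k_{\max}\}$ and $n\ge2$, $\delta_{k,n}=\delta_{k,1}n^{-1}\log^3n$, where $\delta_{k,1}$ is any number with $$\delta_{k,1}\ge128(1+s)(C_1+2)[D_1(k)-D_2(k^\star)]\ \vee\ 128C_1D_1(k)\ \vee\ (\log n_0)^{-3}.$$ *)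

(* Defs.v *)
From HB Require Import structures.
From mathcomp Require Import all_boot all_order all_algebra.
From mathcomp Require Import all_classical all_reals all_analysis.

Set Implicit Arguments.
Unset Strict Implicit.
Unset Printing Implicit Defensive.

Import Order.TTheory GRing.Theory Num.Theory.
Import numFieldNormedType.Exports.

Local Open Scope classical_set_scope.
Local Open Scope ring_scope.

Section tuple_cons.
Context d (S : measurableType d) (n : nat).

Definition tuple_cons (p : S * n.-tuple S) : n.+1.-tuple S :=
  [tuple of p.1 :: p.2].

Lemma measurable_tuple_cons : measurable_fun setT tuple_cons.
Proof. exact: measurable_cons. Qed.

HB.instance Definition _ :=
  isMeasurableFun.Build _ _ _ _ tuple_cons measurable_tuple_cons.

Definition tuple_uncons (t : n.+1.-tuple S) : S * n.-tuple S :=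
  (thead t, [tuple of behead t]).

Lemma tuple_consK : cancel tuple_cons tuple_uncons.
Proof.
move=> [x t]; rewrite /tuple_uncons; congr (_, _) => //.
exact/val_inj.
Qed.

Lemma measurable_tuple_uncons : measurable_fun setT tuple_uncons.
Proof.
apply: measurable_fun_pair; last exact: measurable_behead.
exact: measurable_tnth.
Qed.

End tuple_cons.

Section product_step.
Context d (S : measurableType d) (R : realType) (n : nat).
Variables (m : {sigma_finite_measure set S -> \bar R})
          (mn : {sigma_finite_measure set (n.-tuple S) -> \bar R}).

Definition product_step : set (n.+1.-tuple S) -> \bar R :=
  pushforward (m \x mn)%E (@tuple_cons d S n).

Let product_step0 : product_step set0 = 0%E.
Proof. by rewrite /product_step /pushforward preimage_set0 measure0. Qed.

Let product_step_ge0 A : (0 <= product_step A)%E.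
Proof. exact: measure_ge0. Qed.

Let product_step_sigma_additive : semi_sigma_additive product_step.
Proof. exact: measure_semi_sigma_additive. Qed.

HB.instance Definition _ := isMeasure.Build _ _ _ product_step
  product_step0 product_step_ge0 product_step_sigma_additive.

Let product_step_sigma_finite : sigma_finite setT product_step.
Proof.
have /sigma_finiteP[F [FT ndF Foo]] := sigma_finiteT m.
have /sigma_finiteP[G [GT ndG Goo]] := sigma_finiteT mn.
exists (fun i => @tuple_uncons d S n @^-1` (F i `*` G i)).
  apply/esym; rewrite -subTset => t _.
  have [i _ Fi] : (\bigcup_i F i) (tuple_uncons t).1 by rewrite -FT.
  have [j _ Gj] : (\bigcup_i G i) (tuple_uncons t).2 by rewrite -GT.
  exists (maxn i j) => //; split.
  - by move: Fi; exact/subsetPset/ndF/leq_maxl.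
  - by move: Gj; exact/subsetPset/ndG/leq_maxr.
move=> i; have [mF Fy] := Foo i; have [mG Gy] := Goo i; split.
  rewrite -[X in measurable X]setTI.
  by apply: measurable_tuple_uncons => //; exact: measurableX.
rewrite /product_step /pushforward.
have -> : @tuple_cons d S n @^-1` (@tuple_uncons d S n @^-1` (F i `*` G i)) =
          F i `*` G i.
  by rewrite -comp_preimage (_ : _ \o _ = id) //; apply/funext => p;
    exact: tuple_consK.
by rewrite product_measure1E// lte_mul_pinfty// ge0_fin_numE.
Qed.

HB.instance Definition _ :=
  Measure_isSigmaFinite.Build _ _ _ product_step product_step_sigma_finite.

End product_step.

Fixpoint tuple_measure d (S : measurableType d) (R : realType)
    (m : {sigma_finite_measure set S -> \bar R}) (n : nat) :
    {sigma_finite_measure set (n.-tuple S) -> \bar R} :=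
  match n with
  | 0 => @dirac _ (0.-tuple S) [tuple] R
  | n'.+1 => product_step m (tuple_measure m n')
  end.

Lemma tuple_measure_rectangle d (S : measurableType d) (R : realType)
    (m : {sigma_finite_measure set S -> \bar R}) n (A : 'I_n -> set S) :
  (forall i, measurable (A i)) ->
  tuple_measure m n [set t | forall i, A i (tnth t i)] =
  (\prod_(i < n) m (A i))%E.
Proof.
elim: n A => [|n IH] A mA.
  by rewrite big_ord0 /= diracE mem_set //= => -[].
rewrite big_ord_recl -IH; last by move=> i; exact: mA.
rewrite /= /product_step /pushforward -product_measure1E //; last first.
  have -> : [set t : n.-tuple S | forall i, A (lift ord0 i) (tnth t i)] =
            \bigcap_(i in setT) (@tnth n S ^~ i @^-1` A (lift ord0 i)).
    by apply/seteqP; split=> t /= h i; [move=> _; exact: h|exact: (h i I)].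
  apply: fin_bigcap_measurable; first exact: finite_finset.
  move=> i _; rewrite -[X in measurable X]setTI.
  exact: measurable_tnth.
congr (product_measure1 _ _ _); apply/seteqP; split=> -[x t] /= h.
  split; first by have := h ord0; rewrite tnth0.
  by move=> i; have := h (lift ord0 i); rewrite tnthS.
move=> i; have [h0 h1] := h.
by case: (unliftP ord0 i) => [j|] ->; rewrite ?tnthS ?tnth0.
Qed.

Definition euclid_dist (R : realType) n (x y : n.-tuple R) : R :=
  Num.sqrt (\sum_i (tnth x i - tnth y i) ^+ 2).

Section model.
Context {R : realType} {d : measure_display} {Z : measurableType d}.
Context (mu : {measure set Z -> \bar R}).
Context {dT : measure_display} (T : measurableType dT).

(* [T] carries all the parameters; [Theta k] is identified with a subset of
   R^(dim k) through the coordinate map [coord k], which is only meaningful on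
   [Theta k]. The coordinates of one parameter in [Theta k] and in
   [Theta k.+1] need not be related.
   [law t] and [dens t] are only meaningful for [t] in some [Theta k]. *)
Record model := Model {
  Theta : nat -> set T;
  dim : nat -> nat;
  coord : forall k, T -> (dim k).-tuple R;
  dens : T -> Z -> R;
  law : T -> probability Z R;
  kstar : nat;
  theta_star : T;
  Theta0 : Theta 0 = set0;
  Theta_nested : forall k, (1 <= k)%N -> Theta k `<=` Theta k.+1;
  Theta_measurable : forall k, measurable (Theta k);
  coord_measurable : forall k, measurable_fun (Theta k) (coord k);
  coord_inj : forall k, {in Theta k &, injective (coord k)};
  (* The library topology of row vectors is the Euclidean one. *)
  Theta_compact : forall k, (1 <= k)%N ->
    compact [set (\row_i tnth (coord k t) i : 'rV[R]_(dim k)) | t in Theta k];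
  dens_measurable : forall k t, Theta k t -> measurable_fun setT (dens t);
  (* [ln (dens t z)] is a real number. *)
  dens_gt0 : forall k t z, Theta k t -> 0 < dens t z;
  law_dens : forall k t A, Theta k t -> measurable A ->
    law t A = (\int[mu]_(z in A) (dens t z)%:E)%E;
  loglik_continuous : forall k t z (e : R), (1 <= k)%N -> Theta k t -> 0 < e ->
    exists2 h : R, 0 < h &
      forall t', Theta k t' ->
        euclid_dist (coord k t) (coord k t') < h ->
        `|ln (dens t' z) - ln (dens t z)| < e;
  theta_starP : (Theta kstar `\` Theta kstar.-1) theta_star;
  kstar_unique : forall k t, (1 <= k)%N -> (Theta k `\` Theta k.-1) t ->
    (forall A, measurable A -> law t A = law theta_star A) -> k = kstar
}.

(* [prior_order k] and [prior_dens k] are only meaningful for [1 <= k]. *)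
Record prior (M : model) := Prior {
  prior_order : nat -> R;
  prior_dens : forall k, (dim M k).-tuple R -> R;
  prior_param : nat -> probability T R;
  prior_order_ge0 : forall k, 0 <= prior_order k;
  prior_order_sum1 : (\sum_(1 <= k <oo) (prior_order k)%:E = 1)%E;
  prior_dens_ge0 : forall k (x : (dim M k).-tuple R), 0 <= prior_dens x;
  prior_dens_measurable : forall k, (1 <= k)%N ->
    measurable_fun (coord M k @` Theta M k) (@prior_dens k);
  prior_param_Theta : forall k, (1 <= k)%N ->
    prior_param k (Theta M k) = 1%E;
  prior_param_dens : forall k (B : set ((dim M k).-tuple R)),
    (1 <= k)%N -> measurable B ->
    prior_param k (Theta M k `&` coord M k @^-1` B) =
    (\int[tuple_measure (@lebesgue_measure R) (dim M k)]_(x in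
       coord M k @` Theta M k `&` B) (prior_dens x)%:E)%E
}.

End model.

Section definitions.
Context {R : realType} {d : measure_display} {Z : measurableType d}.
Context {mu : {measure set Z -> \bar R}}.
Context {dT : measure_display} {T : measurableType dT}.
Context (M : model mu T).

Definition dist k (t t' : T) : R :=
  euclid_dist (coord M k t) (coord M k t').

Definition loglik (t : T) (z : Z) : R := ln (dens M t z).

Definition dens_star : Z -> R := dens M (theta_star M).
Definition loglik_star : Z -> R := loglik (theta_star M).
Definition law_star : probability Z R := law M (theta_star M).

(* Extended-real logarithm, so that log 0 = -oo. *)
Definition elog (f : Z -> R) (z : Z) : \bar R := lne (f z)%:E.

(* The integral of [g] with respect to the measure of derivative [f]. *)
Definition dint (f : Z -> R) (g : Z -> \bar R) : \bar R :=
  (\int[mu]_z ((f z)%:E * g z))%E.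

Definition V (f f' : Z -> R) : \bar R :=
  dint f (fun z => (elog f z - elog f' z) ^+ 2)%E.

Definition KL (t : T) : \bar R :=
  if `[< law_star `<< law M t >]
  then (\int[law_star]_z (loglik_star z - loglik t z)%:E)%E else +oo%E.

Definition KL_inf k : \bar R := ereal_inf [set KL t | t in Theta M k].

Definition S_set k (delta : R) : set T :=
  [set t | Theta M k t /\ (KL t <= KL_inf k + (delta / 2)%:E)%E].

Definition lower_env k (t : T) (delta : R) (z : Z) : R :=
  inf [set dens M t' z | t' in [set t' | Theta M k t' /\ dist k t t' < delta]].

Definition upper_env k (t : T) (delta : R) (z : Z) : R :=
  sup [set dens M t' z | t' in [set t' | Theta M k t' /\ dist k t t' < delta]].

Definition q (t : T) (alpha : R) : \bar R :=
  (\int[law_star]_z ((loglik_star z - loglik t z) ^+ 2 *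
                     expR (alpha * (loglik_star z - loglik t z)))%:E
   + V dens_star (dens M t))%E.

Definition L1_nonneg (f : Z -> R) :=
  (forall z, 0 <= f z) /\ mu.-integrable setT (EFin \o f).

Definition bracket (l u : Z -> R) : set (Z -> R) :=
  [set f | forall z, l z <= f z <= u z].

Definition is_bracket (delta : R) (l u : Z -> R) :=
  [/\ forall z, l z <= u z, L1_nonneg l & L1_nonneg u] /\
  [/\ (\int[mu]_z (u z - l z)%:E <= delta%:E)%E,
      (\int[law_star]_z (elog u z - elog l z) ^+ 2 <= (delta ^+ 2)%:E)%E,
      (dint (fun z => u z - l z)%R
         (fun z => (elog u z - elog dens_star z) ^+ 2)
       <= (delta * ln delta ^+ 2)%:E)%E &
      (dint l (fun z => (elog u z - elog l z) ^+ 2)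
       <= (delta * ln delta ^+ 2)%:E)%E].

(* +oo when no finite family of brackets covers [C] *)
Definition bracketing_number (C : set (Z -> R)) (delta : R) : \bar R :=
  ereal_inf [set N%:R%:E | N in [set N : nat |
    exists l u : 'I_N -> Z -> R,
      (forall i, is_bracket delta (l i) (u i)) /\
      (forall f, C f -> exists i, bracket (l i) (u i) f)]].

(* -oo for the empty class *)
Definition entropy (A : set T) (delta : R) : \bar R :=
  lne (bracketing_number [set dens M t | t in A] delta).

Definition loglik_n n (t : T) (z : n.-tuple Z) : R :=
  \sum_i loglik t (tnth z i).

Definition loglik_star_n n (z : n.-tuple Z) : R := \sum_i loglik_star (tnth z i).

Definition law_star_n n : set (n.-tuple Z) -> \bar R :=
  tuple_measure law_star n.

Section bayes.
Context (Q : prior M).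

(* A measure on pairs (order, parameter): since the Theta k are nested, the
   order is not a function of the parameter alone. *)
Definition prior_measure (B : set (nat * T)) : \bar R :=
  (\sum_(1 <= k <oo) (prior_order Q k)%:E *
     prior_param Q k [set t | Theta M k t /\ B (k, t)])%E.

Definition order_weight n k (z : n.-tuple Z) : \bar R :=
  ((prior_order Q k)%:E *
   \int[prior_param Q k]_(t in Theta M k) (expR (loglik_n t z))%:E)%E.

Definition posterior n (z : n.-tuple Z) k : \bar R :=
  (order_weight k z / \sum_(1 <= j <oo) order_weight j z)%E.

(* Any measurable selection of a maximizer of the posterior over the orders *)
Definition is_order_estimator (khat : forall n, n.-tuple Z -> nat) :=
  forall n, (1 <= n)%N ->
    measurable_fun setT (khat n) /\
    forall z, (1 <= khat n z)%N /\
      forall k, (1 <= k)%N -> (posterior z k <= posterior z (khat n z))%E.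

Definition bayes_B n k (z : n.-tuple Z) : \bar R :=
  ((prior_order Q k)%:E *
   \int[prior_param Q k]_(t in Theta M k)
      (expR (loglik_n t z - loglik_star_n z))%:E)%E.

Definition condA1 (alpha Mc : nat -> R) :=
  forall k, (1 <= k)%N ->
    [/\ 0 < alpha k, 1 <= Mc k &
      exists2 dbar : R, 0 < dbar & forall delta, 0 < delta <= dbar ->
        (ereal_sup [set q t (alpha k) | t in S_set k delta] <= (Mc k)%:E)%E].

Definition condA2 :=
  forall k t, (1 <= k)%N -> Theta M k t -> exists2 eta : R, 0 < eta &
    (V (upper_env k t eta) dens_star + V dens_star (lower_env k t eta)
     + V dens_star (upper_env k t eta) + V (upper_env k t eta) (dens M t)
     < +oo)%E.

Definition condO1 (K : nat) (D1 : nat -> R) :=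
  (forall k, (kstar M < k <= K)%N -> 0 < D1 k) /\
  exists2 C2 : R, 0 < C2 &
    forall delta : nat -> R, decreasing_seq delta -> delta @ \oo --> (0 : R) ->
      forall n k, (1 <= n)%N -> (kstar M < k <= K)%N ->
        (prior_param Q k [set t | Theta M k t /\ KL t <= (delta n)%:E]
         <= (C2 * delta n `^ (D1 k / 2))%:E)%E.

Definition condO2 (K : nat) (D1 : nat -> R) (F : nat -> nat -> set T) :=
  (forall k n, (kstar M < k <= K)%N -> (1 <= n)%N ->
     measurable (F k n) /\ F k n `<=` Theta M k) /\
  exists2 C3 : R, 0 < C3 &
    forall k n, (kstar M < k <= K)%N -> (1 <= n)%N ->
      (prior_param Q k (Theta M k `\` F k n)
       <= (C3 * n%:R `^ (- (D1 k / 2)))%:E)%E.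

(* At n = 1 with beta2 > 0 the threshold below is 0^-1 = 0, hence the
   inequality is trivial there. *)
Definition condO3 (D1 : nat -> R) (D2 beta1 beta2 : R) :=
  [/\ 0 < beta1, 0 <= beta2, 0 < D2 &
    exists2 L : R, 0 < L & forall n, (1 <= n)%N ->
      (law_star_n [set z : n.-tuple Z | bayes_B (kstar M) z <
          ((beta1 * ln n%:R `^ beta2 * n%:R `^ (D2 / 2))^-1)%:E]
       <= (L * (ln n%:R `^ (3 * D1 (kstar M).+1 / 2 + beta2) /
                n%:R `^ ((D1 (kstar M).+1 - D2) / 2)))%:E)%E].

End bayes.
End definitions.

Arguments dint {R d Z} mu f g.
Arguments V {R d Z} mu f f'.
Arguments L1_nonneg {R d Z} mu f.

Section constants.
Context {R : realType}.

Definition C1 (alpha Mc : R) : R :=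
  5 * (1 + ln Mc ^+ 2) / (2 * alpha ^+ 2).

(* The supremum is attained: the terms tend to 0 and are eventually positive.
   The only logarithm of 0 occurs at m = 1 for beta2 > 0, where the value 0
   given by the library does not affect the supremum. *)
Definition rate_max (beta1 beta2 D2 : R) (n : nat) : R :=
  4 * sup [set m%:R^-1 * ln (beta1 * ln m%:R `^ beta2 * m%:R `^ (D2 / 2))
          | m in [set m : nat | (n <= m)%N]].

Definition is_n0 (beta1 beta2 D2 : R) (n0 : nat) :=
  [/\ (1 <= n0)%N, rate_max beta1 beta2 D2 n0 <= expR (- 2) / 2 &
    forall n, (1 <= n)%N -> rate_max beta1 beta2 D2 n <= expR (- 2) / 2 ->
      (n0 <= n)%N].

Definition delta_n (delta1 : R) (n : nat) : R :=
  delta1 * n%:R^-1 * ln n%:R ^+ 3.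

(* The inverse is the extended-real one: no delta1 is admissible if n0 = 1. *)
Definition admissible_delta1 (s C1k D1k D2 : R) (n0 : nat) (delta1 : R) :=
  [/\ 128 * (1 + s) * (C1k + 2) * (D1k - D2) <= delta1,
      128 * C1k * D1k <= delta1 &
      (((ln n0%:R ^+ 3)%:E)^-1 <= delta1%:E)%E].

(* The largest integer strictly smaller than x *)
Definition strict_floor (x : R) : int := Num.ceil x - 1.

Definition max_over (k0 k1 : nat) (a : nat -> R) : R :=
  \big[Num.max/a k0.+1]_(k0.+1 <= k < k1.+1) a k.

Definition min_over (k0 k1 : nat) (a : nat -> R) : R :=
  \big[Num.min/a k0.+1]_(k0.+1 <= k < k1.+1) a k.

End constants.

(* Main.v *)
(** Write B(k) for the marginal likelihood ratio of order k. If the estimator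
    exceeds kstar, then B(kstar) <= B(k) for some larger k of positive prior
    mass, so that either B(kstar) is below the threshold of (O3) or B(k) is
    above it. The integral defining B(k) splits into three parts. Off the sieve
    and on {H <= delta_{k,n}}, Markov's inequality and Fubini's theorem bound
    it through the prior masses of (O2) and (O1), as the likelihood ratio has
    expectation one. On the shells {j delta < H <= (j+1) delta} with H small,
    (A1) bounds the second moment of the log-likelihood ratio by H log^2 H, and
    Chernoff's bound for the upper ends of the entropy brackets makes the
    likelihood ratio at most exp(-n delta/8) off an event of probability of
    order n^{-2 (D1(k) - D2)}. On {H > c}, compactness of Theta_k and (A2) yield a
    finite cover by balls on which the Hellinger affinity of the upper envelope
    with the true density is less than one, so that everything is exponentially
    small. Small n are absorbed into the constant. *)

(* Log-likelihood ratios are signed, and their integrability is awkward. As [expR a] has mean 1, the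
   divergence is the mean of [kl_fun a >= 0], and linear terms cross an inequality before it is
   integrated, so that only nonnegative functions are integrated. Uniformity in the parameter comes
   from explicit measurable events, defined by a bracket end or an envelope, off which the bound
   holds for every parameter concerned; no supremum of likelihood ratios over a shell has to be
   measurable. The cube of the logarithm: at divergence of order [eps] the Chernoff parameter is of
   order [1 / ((C1 + 2) ln^2 eps)], because the second moment carries a squared logarithm. The
   exponent obtained is [2 W] with [W = n eps / (64 (C1 + 2) ln^2 eps)], and the entropy consumes at
   most [W]. For [eps = j delta_{k,n}] one has [|ln eps| <= ln n], so two logarithms pay for
   [ln^2 eps] and the third leaves [W >= 2 j (D1(k) - D2) ln n], a power of [n] summable over the
   shells. The final rate is set by [{H <= delta_{k,n}}], of prior mass of order
   [delta_{k,n}^(D1(k)/2)], times the inverse threshold of (O3). *)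
Require Import Defs.
From mathcomp Require Import all_boot all_order all_algebra.
From mathcomp Require Import all_classical all_reals all_analysis.
From mathcomp Require Import measurable_realfun ring lra.

Set Implicit Arguments.
Unset Strict Implicit.
Unset Printing Implicit Defensive.

Import Order.TTheory GRing.Theory Num.Theory.
Import numFieldNormedType.Exports.
Import Defs.

Local Open Scope classical_set_scope.
Local Open Scope ring_scope.

(** * Exponential inequalities *)

Section exponential_inequalities.
Context {R : realType}.
Implicit Types a w x y A lam : R.

(* If [expR a] is a likelihood ratio of mean 1, then [kl_fun a] is nonnegative
   and its mean is that of [- a], the Kullback-Leibler divergence. *)
Definition kl_fun a : R := expR a - 1 - a.

Lemma kl_fun_ge0 a : 0 <= kl_fun a.
Proof. by have := expR_ge1Dx a; rewrite /kl_fun; lra. Qed.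

Lemma expR_half2 x : expR x = expR (x / 2) ^+ 2.
Proof. by rewrite expr2 -expRD -splitr. Qed.

Lemma expR_le_1Dmul x : expR x <= 1 + x * expR x.
Proof.
have e0 := expR_gt0 x; have := expR_ge1Dx (- x); rewrite expRN => h.
have : expR x * (1 - x) <= 1.
  by rewrite -[leRHS](@mulfV _ (expR x)) ?gt_eqF// ler_pM2l.
by rewrite mulrBr mulr1 [expR x * x]mulrC; lra.
Qed.

(** For [a >= -2], squaring [1 + a / 2 <= expR (a / 2)] gives [a ^+ 2 / 4 <= kl_fun a]. For
    [a < -2], [kl_fun a] still dominates [- a / 2], and the other factor [- a] of the square is at
    most [A]. *)
Lemma sqr_le_kl_fun A a : 0 <= A -> - A <= a -> a ^+ 2 <= (4 + 2 * A) * kl_fun a.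
Proof.
move=> A0 Aa; have g0 := kl_fun_ge0 a.
have h := expR_ge1Dx (a / 2).
have [a2|a2] := leP (-2) a.
  have : a ^+ 2 / 4 <= kl_fun a.
    rewrite /kl_fun expR_half2.
    have : (1 + a / 2) ^+ 2 <= expR (a / 2) ^+ 2.
      by rewrite ler_sqr ?nnegrE ?expR_ge0//; lra.
    set e := expR _ ^+ 2; lra.
  nra.
have : - a / 2 <= kl_fun a by rewrite /kl_fun; have := expR_gt0 a; lra.
nra.
Qed.

(** On the positive side [kl_fun a] dominates [(expR (a / 2) - 1) ^+ 2], hence
    [(expR (a / 4) * (a / 4)) ^+ 2]: it grows fast enough to pay for the exponential weight. *)
Lemma sqr_expR_half_le_kl_fun a : 0 <= a -> a ^+ 2 * expR (a / 2) <= 16 * kl_fun a.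
Proof.
move=> a0.
have h1 : (expR (a / 2) - 1) ^+ 2 <= kl_fun a.
  rewrite /kl_fun [expR a]expR_half2.
  have := expR_ge1Dx (a / 2); nra.
have -> : expR (a / 2) = expR (a / 4) ^+ 2.
  by rewrite expR_half2; congr (expR _ ^+ 2); field.
have h2 : expR (a / 4) * (a / 4) <= expR (a / 2) - 1.
  rewrite [expR (a / 2)]expR_half2 (_ : a / 2 / 2 = a / 4); last by field.
  have := expR_ge1Dx (a / 4); nra.
have h3 : (expR (a / 4) * (a / 4)) ^+ 2 <= kl_fun a.
  apply: le_trans h1; rewrite ler_sqr ?nnegrE//.
    by rewrite mulr_ge0 ?expR_ge0//; lra.
  by rewrite (le_trans _ h2)// mulr_ge0 ?expR_ge0//; lra.
rewrite exprMn in h3.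
set e := expR _ ^+ 2 in h3 *; nra.
Qed.

Lemma expR_le_quadratic x m : expR x <= m -> 1 <= m -> expR x <= 1 + x + x ^+ 2 * m.
Proof.
move=> xm m1; have h := expR_le_1Dmul x; have h' := expR_ge1Dx x.
have h2 : expR x - 1 - x <= x * (expR x - 1) by lra.
have [x0|x0] := leP 0 x.
  have : expR x - 1 <= x * m.
    by apply: (@le_trans _ _ (x * expR x)); [lra|exact: ler_wpM2l].
  nra.
have : - x * (1 - expR x) <= x ^+ 2 by rewrite expr2; nra.
nra.
Qed.

Lemma expR_half_ub : expR (1 / 2) <= 2 :> R.
Proof.
have := expR_le_1Dmul (1 / 2 : R); lra.
Qed.

(* Dominates [y ^+ 2 * expR (lam * y)] at [y = a + w], 0 <= lam <= 1/4: the
   third term is for [w <= a], the last one for [w > 1] and [w > a]. *)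
Definition dev_fun a w : R :=
  2 * a ^+ 2 + 10 * w ^+ 2 + 64 * kl_fun a + 32 * (expR (a + w) - expR a).

Lemma dev_fun_bound lam a w : 0 <= lam <= 1 / 4 -> 0 <= w ->
  (a + w) ^+ 2 <= dev_fun a w /\
  (a + w) ^+ 2 * expR (lam * (a + w)) <= dev_fun a w.
Proof.
move=> /andP[l0 l4] w0; set y := a + w.
have g0 := kl_fun_ge0 a.
have ea : expR a <= expR y by rewrite ler_expR /y; lra.
have y2 : y ^+ 2 <= 2 * a ^+ 2 + 2 * w ^+ 2.
  have := sqr_ge0 (a - w); rewrite /y; nra.
have a20 := sqr_ge0 a; have w20 := sqr_ge0 w.
have yQ : y ^+ 2 <= dev_fun a w by rewrite /dev_fun -/y; lra.
split=> //.
have [yneg|ypos] := leP y 0.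
  apply: le_trans yQ; rewrite -[leRHS]mulr1 ler_wpM2l ?sqr_ge0//.
  by rewrite -expR0 ler_expR; nra.
have [wa|aw] := leP w a.
  have a0 : 0 <= a by lra.
  have := sqr_expR_half_le_kl_fun a0.
  have : expR (lam * y) <= expR (a / 2) by rewrite ler_expR /y in ypos *; nra.
  have : y ^+ 2 <= 4 * a ^+ 2.
    by rewrite (_ : 4 * _ = (2 * a) ^+ 2) ?ler_sqr ?nnegrE /y; [lra|lra|lra|ring].
  move=> h1 h2 h3.
  have : y ^+ 2 * expR (lam * y) <= 4 * a ^+ 2 * expR (a / 2).
    by rewrite ler_pM ?sqr_ge0 ?expR_ge0.
  by rewrite /dev_fun -/y; nra.
have yw : y <= 2 * w by rewrite /y; lra.
have [w1|w1] := leP w 1.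
  have : expR (lam * y) <= 2.
    by apply: le_trans expR_half_ub; rewrite ler_expR; nra.
  have : y ^+ 2 <= 4 * w ^+ 2.
    by rewrite (_ : 4 * _ = (2 * w) ^+ 2) ?ler_sqr ?nnegrE; [lra|lra|lra|ring].
  move=> h1 h2.
  have : y ^+ 2 * expR (lam * y) <= 4 * w ^+ 2 * 2.
    by rewrite ler_pM ?sqr_ge0 ?expR_ge0.
  by rewrite /dev_fun -/y; nra.
(* Since [expR w >= 2], the width [expR y - expR a] is at least half of [expR y]; together with
   [y ^+ 2 * expR (y / 4) <= 16 * expR y] this gives the factor 32 of [dev_fun]. *)
have : expR a <= expR y / 2.
  have h := expR_ge1Dx w; have := expR_gt0 a.
  rewrite /y expRD; nra.
have h1 : expR (lam * y) <= expR (y / 4) by rewrite ler_expR; nra.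
have h2 : y ^+ 2 <= 16 * expR (y / 4) ^+ 2.
  have := expR_ge1Dx (y / 4).
  rewrite (_ : 16 * _ = (4 * expR (y / 4)) ^+ 2); last by ring.
  by move=> ?; rewrite ler_sqr ?nnegrE; lra.
have h3 : expR (y / 4) ^+ 2 * expR (y / 4) <= expR y.
  by rewrite expr2 -!expRD ler_expR; lra.
have : y ^+ 2 * expR (lam * y) <= 16 * expR (y / 4) ^+ 2 * expR (y / 4).
  by rewrite ler_pM ?sqr_ge0 ?expR_ge0.
by rewrite /dev_fun -/y; nra.
Qed.

(** A second-order expansion whose coefficient does not depend on [lam]. [expR_le_quadratic] is used
    with [m = 1] for a nonpositive exponent and with [m] equal to the exponential otherwise, which
    is why [dev_fun_bound] treats the square both bare and weighted. *)
Lemma expR_lam_bound lam a w : 0 <= lam <= 1 / 4 -> 0 <= w ->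
  expR (lam * (a + w)) <= 1 + lam * (a + w) + lam ^+ 2 * dev_fun a w.
Proof.
move=> l w0; have [h1 h2] := dev_fun_bound a l w0.
have l0 : 0 <= lam by case/andP: l.
set x := lam * (a + w).
have [x0|x0] := leP x 0.
  have e1 : expR x <= 1 by rewrite -expR0 ler_expR.
  have := expR_le_quadratic e1 (lexx 1).
  rewrite mulr1 => /le_trans; apply; rewrite lerD2l /x exprMn.
  by rewrite ler_wpM2l ?sqr_ge0.
have e1 : 1 <= expR x by rewrite -expR0 ler_expR ltW.
have := expR_le_quadratic (lexx _) e1.
move=> /le_trans; apply; rewrite lerD2l /x exprMn -mulrA.
by rewrite ler_wpM2l ?sqr_ge0.
Qed.

Lemma C1_ge0 alpha Mc : 0 <= C1 alpha Mc :> R.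
Proof.
have h : 0 <= 1 + ln Mc ^+ 2 by rewrite addr_ge0 ?sqr_ge0.
by rewrite /C1 divr_ge0// mulr_ge0// sqr_ge0.
Qed.

End exponential_inequalities.

Section bracket_mgf.
Context d (Z : measurableType d) (R : realType) (P : probability Z R).

Lemma ge0_integral_affine (c : R) (f g : Z -> R) : 0 <= c ->
  (forall z, 0 <= f z) -> (forall z, 0 <= g z) ->
  measurable_fun setT f -> measurable_fun setT g ->
  (\int[P]_z (c * f z + g z)%:E = c%:E * \int[P]_z (f z)%:E + \int[P]_z (g z)%:E)%E.
Proof.
move=> c0 f0 g0 mf mg.
under eq_integral do rewrite EFinD EFinM.
rewrite ge0_integralD//; [|by move=> z _; rewrite mule_ge0 ?lee_fin| | |].
- rewrite ge0_integralZl_EFin//; first by move=> z _; rewrite lee_fin.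
  exact/measurable_EFinP.
- by apply: measurable_funeM; exact/measurable_EFinP.
- by move=> z _; rewrite lee_fin.
- exact/measurable_EFinP.
Qed.

(* Here [a = ln (f / fs)] and [b = ln (u / fs)], [fs] being the true density.
   The second moment of [a] is split at [- A] with
   [A = (ln Mc - ln eps) / alpha]: above, it is at most a multiple of
   [(1 + A) * kl_fun a]; below, the exponential moment makes it at most [eps]. *)
Lemma bracket_mgf (a b : Z -> R) (alpha Mc eps H : R) :
  measurable_fun setT a -> measurable_fun setT b -> (forall z, a z <= b z) ->
  0 < alpha -> 1 <= Mc -> 0 < eps -> 6 <= - ln eps -> eps <= H <= 2 * eps ->
  (\int[P]_z (expR (a z))%:E = 1)%E ->
  (\int[P]_z (kl_fun (a z))%:E = H%:E)%E ->
  (\int[P]_z (a z ^+ 2 * expR (- alpha * a z))%:E <= Mc%:E)%E ->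
  (\int[P]_z ((b z - a z) ^+ 2)%:E <= (eps ^+ 2 / 16)%:E)%E ->
  (\int[P]_z (expR (b z) - expR (a z))%:E <= (eps / 4)%:E)%E ->
  forall CL, CL = (C1 alpha Mc + 2) * ln eps ^+ 2 ->
  (\int[P]_z (expR ((8 * CL)^-1 * b z))%:E <= (expR (- (3 / 64 * (eps / CL))))%:E)%E.
Proof.
move=> ma mb ab al0 Mc1 e0 L6 /andP[He He2] Ea Eg Eh Ew Ed CL CLdef.
set lam := (8 * CL)^-1.
set L := - ln eps in L6; set l := ln Mc.
have l0 : 0 <= l by exact: ln_ge0.
have C10 := C1_ge0 alpha Mc.
have CLE : CL = (C1 alpha Mc + 2) * L ^+ 2 by rewrite CLdef /L sqrrN.
have L36 : 36 <= L ^+ 2 by nra.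
have CL72 : 72 <= CL.
  have : 0 <= C1 alpha Mc * L ^+ 2 by exact: mulr_ge0 C10 (sqr_ge0 _).
  by rewrite CLE mulrDl; lra.
have CL0 : 0 < CL by lra.
have lam0 : 0 < lam by rewrite invr_gt0; lra.
have lamCL : lam * CL = 1 / 8 by rewrite /lam; field; rewrite gt_eqF.
have lam14 : lam <= 1 / 4 by nra.
have lamE : lam = (8 * CL)^-1 by [].
clearbody lam.
pose A := (l + L) / alpha.
have A0 : 0 <= A by rewrite divr_ge0 ?ltW//; lra.
(* [8 A + 155] bounds the total coefficient of [lam^2 eps] at the end of the proof. As
   [lam CL = 1/8], these terms cost at most [3/8 lam eps], half of the linear gain [3/4 lam eps].
   The form of [C1] is what results from bounding the two parts of [8 A] by squares; the remaining
   constant fits into [6 L^2 >= 216]. *)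
have ACL : 8 * A + 155 <= 3 * CL.
  pose ia := alpha^-1.
  have ia0 : 0 < ia by rewrite invr_gt0.
  have C1E : C1 alpha Mc = 5 / 2 * (1 + l ^+ 2) * ia ^+ 2.
    by rewrite /C1 -/l /ia; field; rewrite gt_eqF.
  have AE : A = l * ia + L * ia by rewrite /A mulrDl.
  have h1 : 8 * (L * ia) <= 5 * (L * ia) ^+ 2 + 16 / 5.
    have := sqr_ge0 (5 * (L * ia) - 4); nra.
  have h2 : 8 * (l * ia) <= 5 * (l * ia) ^+ 2 + 16 / 5.
    have := sqr_ge0 (5 * (l * ia) - 4); nra.
  have h3 : 5 * (l * ia) ^+ 2 <= 5 * (l * ia) ^+ 2 * L ^+ 2.
    by rewrite ler_peMr ?mulr_ge0 ?sqr_ge0//; lra.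
  have h4 : 5 * (L * ia) ^+ 2 + 5 * (l * ia) ^+ 2 * L ^+ 2 = 2 * C1 alpha Mc * L ^+ 2.
    by rewrite C1E; field.
  have h5 : 0 <= C1 alpha Mc * L ^+ 2 by rewrite mulr_ge0 ?sqr_ge0.
  rewrite CLE AE mulrDl; lra.
pose K := expR (- alpha * A).
have KMc : K * Mc = eps.
  have -> : K = expR (- l + ln eps).
    by rewrite /K /A /L; congr expR; field; rewrite gt_eqF.
  by rewrite expRD expRN !lnK ?posrE//; [field; rewrite gt_eqF//; lra|lra].
have K0 : 0 <= K by exact: expR_ge0.
have ak z : a z ^+ 2 <= (4 + 2 * A) * kl_fun (a z) + K * (a z ^+ 2 * expR (- alpha * a z)).
  have g0 := kl_fun_ge0 (a z).
  have h0 : 0 <= a z ^+ 2 * expR (- alpha * a z) by rewrite mulr_ge0 ?sqr_ge0 ?expR_ge0.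
  have [Aa|aA] := leP (- A) (a z).
    by apply: (le_trans (sqr_le_kl_fun A0 Aa)); rewrite lerDl mulr_ge0.
  rewrite -[leLHS]add0r lerD ?mulr_ge0//; first lra.
  rewrite mulrCA ler_peMr ?sqr_ge0// /K -expRD -expR0 ler_expR; nra.
(* The linear term [lam w] is split by [w <= 2 w^2 / eps + eps / 8], which gives the first part of
   [c2] and the last part of [c0]. Inserting the bound on [a^2] into [2 a^2 + 64 kl_fun a] gives
   [72 + 4 A] in [c3] and [2 K] in [c4]. *)
pose c2 := 2 * lam / eps + 10 * lam ^+ 2.
pose c3 := lam ^+ 2 * (72 + 4 * A).
pose c4 := 2 * lam ^+ 2 * K.
pose c5 := 32 * lam ^+ 2.
pose c0 := 1 - lam + lam * eps / 8.
pose w z := b z - a z.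
have lam20 := sqr_ge0 lam.
have lam0' := ltW lam0; have e0' := ltW e0.
have c20 : 0 <= c2 by rewrite /c2 addr_ge0 ?divr_ge0 ?mulr_ge0.
have c30 : 0 <= c3 by rewrite /c3 mulr_ge0//; lra.
have c40 : 0 <= c4 by rewrite /c4 ?mulr_ge0.
have c50 : 0 <= c5 by rewrite /c5 mulr_ge0.
have c00 : 0 <= c0 by rewrite /c0; nra.
have w0 z : 0 <= w z by rewrite /w subr_ge0.
(* The signed term [lam * a] is rewritten as [lam * (expR a - 1 - kl_fun a)] and the part with
   [kl_fun] is moved to the left. Both sides are then sums of nonnegative functions, and the mean
   [H] on the left produces the gain. *)
have pt z : lam * kl_fun (a z) + expR (lam * b z) <=
    lam * expR (a z) + (c2 * w z ^+ 2 + (c3 * kl_fun (a z) +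
      (c4 * (a z ^+ 2 * expR (- alpha * a z)) + (c5 * (expR (b z) - expR (a z)) + c0)))).
  have lb : 0 <= lam <= 1 / 4 by rewrite ltW//=.
  have := expR_lam_bound (a z) lb (w0 z).
  rewrite /dev_fun (_ : a z + w z = b z); last by rewrite /w; ring.
  move=> h1; have h2 := ak z.
  have h3 : w z <= 2 * w z ^+ 2 / eps + eps / 8.
    move: (w z) => x; rewrite -(ler_pM2r e0) mulrDl divfK ?gt_eqF//.
    have := sqr_ge0 (4 * x - eps); nra.
  have h4 : lam ^+ 2 * a z ^+ 2 <= lam ^+ 2 * ((4 + 2 * A) * kl_fun (a z) + K * (a z ^+ 2 * expR (- alpha * a z))).
    by rewrite ler_wpM2l.
  have h5 : lam * w z <= lam * (2 * w z ^+ 2 / eps + eps / 8).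
    by rewrite ler_wpM2l// ltW.
  have h6 : b z = a z + w z by rewrite /w; ring.
  have h7 : lam * kl_fun (a z) = lam * expR (a z) - lam - lam * a z by rewrite /kl_fun; ring.
  rewrite h7.
  have h8 : lam * b z = lam * a z + lam * w z by rewrite h6; ring.
  apply: (le_trans (lerD (lexx _) h1)); rewrite {1}h8.
  rewrite /c2 /c3 /c4 /c5 /c0.
  move: h4 h5; set h := a z ^+ 2 * expR _; set g := kl_fun _; set dd := expR (b z) - _.
  set ie := eps^-1; set a2 := a z ^+ 2; set w2 := w z ^+ 2 => h4 h5; clear - h4 h5; lra.
have mw : measurable_fun setT (fun z => w z ^+ 2).
  by apply: measurable_funX; exact: measurable_funB.
have me (c : R) (f : Z -> R) : measurable_fun setT f -> measurable_fun setT (fun z => expR (c * f z)).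
  by move=> mf; apply: measurableT_comp => //; exact: measurable_funM.
have mea : measurable_fun setT (fun z => expR (a z)) by exact: measurableT_comp.
have meb : measurable_fun setT (fun z => expR (b z)) by exact: measurableT_comp.
have mg : measurable_fun setT (fun z => kl_fun (a z)).
  by apply: measurable_funB => //; exact: measurable_funB.
have mh : measurable_fun setT (fun z => a z ^+ 2 * expR (- alpha * a z)).
  by apply: measurable_funM; [exact: measurable_funX|exact: me].
have md : measurable_fun setT (fun z => expR (b z) - expR (a z)) by exact: measurable_funB.
have h0 z : 0 <= a z ^+ 2 * expR (- alpha * a z) by rewrite mulr_ge0 ?sqr_ge0 ?expR_ge0.
have d0 z : 0 <= expR (b z) - expR (a z) by rewrite subr_ge0 ler_expR.
have f5p z : 0 <= c5 * (expR (b z) - expR (a z)) + c0 by rewrite addr_ge0 ?mulr_ge0.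
have f4p z : 0 <= c4 * (a z ^+ 2 * expR (- alpha * a z)) + (c5 * (expR (b z) - expR (a z)) + c0).
  by rewrite addr_ge0// mulr_ge0.
have f3p z : 0 <= c3 * kl_fun (a z) +
    (c4 * (a z ^+ 2 * expR (- alpha * a z)) + (c5 * (expR (b z) - expR (a z)) + c0)).
  by rewrite addr_ge0// mulr_ge0// kl_fun_ge0.
have f2p z : 0 <= c2 * w z ^+ 2 + (c3 * kl_fun (a z) +
    (c4 * (a z ^+ 2 * expR (- alpha * a z)) + (c5 * (expR (b z) - expR (a z)) + c0))).
  by rewrite addr_ge0// mulr_ge0// sqr_ge0.
have mf5 : measurable_fun setT (fun z => c5 * (expR (b z) - expR (a z)) + c0).
  by apply: measurable_funD => //; exact: measurable_funM.
have mf4 : measurable_fun setT (fun z => c4 * (a z ^+ 2 * expR (- alpha * a z)) +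
    (c5 * (expR (b z) - expR (a z)) + c0)).
  by apply: measurable_funD => //; exact: measurable_funM.
have mf3 : measurable_fun setT (fun z => c3 * kl_fun (a z) +
    (c4 * (a z ^+ 2 * expR (- alpha * a z)) + (c5 * (expR (b z) - expR (a z)) + c0))).
  by apply: measurable_funD => //; exact: measurable_funM.
have mf2 : measurable_fun setT (fun z => c2 * w z ^+ 2 + (c3 * kl_fun (a z) +
    (c4 * (a z ^+ 2 * expR (- alpha * a z)) + (c5 * (expR (b z) - expR (a z)) + c0)))).
  by apply: measurable_funD => //; exact: measurable_funM.
have : (\int[P]_z (lam * kl_fun (a z) + expR (lam * b z))%:E <=
   \int[P]_z (lam * expR (a z) + (c2 * w z ^+ 2 + (c3 * kl_fun (a z) +
      (c4 * (a z ^+ 2 * expR (- alpha * a z)) + (c5 * (expR (b z) - expR (a z)) + c0)))))%:E)%E.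
  apply: ge0_le_integral => //.
  - by move=> z _; rewrite lee_fin addr_ge0 ?expR_ge0// mulr_ge0 ?kl_fun_ge0 ?ltW.
  - apply/measurable_EFinP/measurable_funD; last exact: me.
    exact: measurable_funM.
  - apply/measurable_EFinP/measurable_funD => //; exact: measurable_funM.
  - by move=> z _; rewrite lee_fin.
rewrite !ge0_integral_affine ?(ltW lam0)//; do ?[exact: me|by move=> z; exact: kl_fun_ge0
  |by move=> z; exact: expR_ge0|by move=> z; exact: sqr_ge0].
rewrite Ea Eg integral_cst//= probability_setT mule1 mule1 => main.
have {}main : (lam%:E * H%:E + \int[P]_z (expR (lam * b z))%:E <=
   lam%:E + (c2%:E * (eps ^+ 2 / 16)%:E + (c3%:E * H%:E + (c4%:E * Mc%:E +
     (c5%:E * (eps / 4)%:E + c0%:E)))))%E.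
  apply: (le_trans main); rewrite leeD2l//.
  by rewrite leeD ?lee_wpmul2l ?lee_fin// leeD2l// leeD ?lee_wpmul2l ?lee_fin// leeD2r// lee_wpmul2l ?lee_fin.
rewrite -!EFinM -!EFinD addeC -leeBrDr// -EFinB in main.
apply: (le_trans main); rewrite lee_fin.
apply: le_trans (expR_ge1Dx _).
have -> : 3 / 64 * (eps / CL) = 3 / 8 * lam * eps.
  by rewrite lamE; field; rewrite gt_eqF.
have -> : c2 * (eps ^+ 2 / 16) = lam * eps / 8 + 10 / 16 * lam ^+ 2 * eps ^+ 2.
  by rewrite /c2; field; rewrite gt_eqF.
rewrite /c3 /c4 /c5 /c0.
have -> : 2 * lam ^+ 2 * K * Mc = 2 * lam ^+ 2 * eps by rewrite -KMc; ring.
have eps1 : eps <= 1.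
  rewrite leNgt; apply/negP => /ln_gt0; rewrite /L in L6; lra.
have k1 : lam * H >= lam * eps by rewrite ler_wpM2l// ltW.
have k2 : lam ^+ 2 * (72 + 4 * A) * H <= lam ^+ 2 * (72 + 4 * A) * (2 * eps).
  by rewrite ler_wpM2l// mulr_ge0//; lra.
have k3 : 10 / 16 * lam ^+ 2 * eps ^+ 2 <= 10 / 16 * lam ^+ 2 * eps.
  rewrite ler_wpM2l//; first by rewrite mulr_ge0.
  by rewrite expr2 ler_piMr// ltW.
have k4 : lam ^+ 2 * eps * (8 * A + 155) <= lam ^+ 2 * eps * (3 * CL).
  by rewrite ler_wpM2l// mulr_ge0// ltW.
have k5 : lam ^+ 2 * eps * (3 * CL) = 3 / 8 * lam * eps.
  rewrite (_ : lam ^+ 2 * eps * (3 * CL) = 3 * lam * eps * (lam * CL)); last by ring.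
  by rewrite lamCL; field.
have k6 : 0 <= lam ^+ 2 * eps by rewrite mulr_ge0.
clear - k1 k2 k3 k4 k5 k6; lra.
Qed.
End bracket_mgf.

(** * Integrals over product measures *)

Section integral_bounds.
Context d (Z : measurableType d) (R : realType).

Lemma ge0_markov (P : {measure set Z -> \bar R}) (f : Z -> \bar R) (t : R) : 0 < t ->
  measurable_fun setT f -> (forall z, 0 <= f z)%E ->
  (P [set z | t%:E <= f z] <= t^-1%:E * \int[P]_z f z)%E.
Proof.
move=> t0 mf f0.
rewrite -(@lee_pmul2l _ t%:E) ?lte_fin//.
rewrite muleA -EFinM mulfV ?gt_eqF// mul1e.
have := @le_integral_comp_abse _ _ _ P _ measurableT f t id (@measurable_id _ _ _)
  (fun r h => h) (fun x y _ _ h => h) mf t0.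
rewrite setTI /= (_ : [set x | _] = [set z | (t%:E <= f z)%E]); last first.
  by apply/seteqP; split => z /=; rewrite gee0_abs.
by move=> /le_trans; apply; under eq_integral do rewrite gee0_abs//.
Qed.
Lemma measure_bigsetU_le (P : {measure set Z -> \bar R}) (I : Type) (r : seq I)
    (F : I -> set Z) : (forall i, measurable (F i)) ->
  (P (\big[setU/set0]_(i <- r) F i) <= \sum_(i <- r) P (F i))%E.
Proof.
move=> mF; elim: r => [|i r IH]; first by rewrite !big_nil measure0.
rewrite !big_cons; apply: (@le_trans _ _ (P (F i) + P (\big[setU/set0]_(j <- r) F j))%E).
  by apply: measureU2 => //; exact: bigsetU_measurable.
by rewrite leeD2l.
Qed.

Lemma integral_probability_cst (P : probability Z R) (c : R) :
  (\int[P]_z c%:E = c%:E)%E.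
Proof.
rewrite (@integral_cst _ _ _ P setT measurableT c%:E) -[RHS]mule1.
congr (_ * _)%E; exact: probability_setT.
Qed.
End integral_bounds.

Section tuple_measure_integral.
Context d (Z : measurableType d) (R : realType) (P : probability Z R).

Lemma measurable_tuple_prod n (h : Z -> R) : measurable_fun setT h ->
  measurable_fun setT (fun z : n.-tuple Z => \prod_(i < n) h (tnth z i)).
Proof.
move=> mh.
by apply: measurable_prod => i _; apply: measurableT_comp => //; exact: measurable_tnth.
Qed.

Lemma integral_tuple_measure_prod n (h : Z -> R) (c : R) :
  measurable_fun setT h -> (forall z, 0 <= h z) ->
  (\int[P]_z (h z)%:E = c%:E)%E ->
  (\int[tuple_measure P n]_z (\prod_(i < n) h (tnth z i))%:E = (c ^+ n)%:E)%E.
Proof.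
move=> mh h0 hc; have mprod m := @measurable_tuple_prod m _ mh.
elim: n => [|n IH].
  rewrite /= integral_dirac//; last first.
    exact: measurableT_comp (mprod 0).
  by rewrite diracT mul1e big_ord0.
rewrite [tuple_measure _ _]/= /product_step.
rewrite ge0_integral_pushforward//; last 2 first.
- exact: measurableT_comp (mprod n.+1).
- by move=> z _; rewrite lee_fin prodr_ge0.
rewrite preimage_setT.
pose f := (fun xz : Z * n.-tuple Z => (h xz.1)%:E * (\prod_(i < n) h (tnth xz.2 i))%:E)%E.
transitivity (\int[(P \x tuple_measure P n)%E]_xz f xz)%E.
  apply: eq_integral => -[x z] _.
  rewrite /f /= big_ord_recl tnth0 EFinM; congr (_ * (_)%:E)%E.
  by apply: eq_bigr => i _; rewrite tnthS.
have mf : measurable_fun setT f.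
  apply: emeasurable_funM; apply/measurable_EFinP.
  - by apply: measurableT_comp => //; exact: measurable_fst.
  - by apply: (measurableT_comp (mprod n)); exact: measurable_snd.
have f0 xz : (0 <= f xz)%E by rewrite mule_ge0 ?lee_fin ?prodr_ge0.
rewrite (fubini_tonelli1 f)//.
under eq_integral => x _.
  rewrite /fubini_F /f /= ge0_integralZl_EFin//; last 2 first.
  - by move=> z _; rewrite lee_fin prodr_ge0.
  - exact: measurableT_comp (mprod n).
  rewrite IH; over.
rewrite /= ge0_integralZr ?hc -?EFinM ?exprSr 1?mulrC//.
- exact/measurable_EFinP.
- by move=> z _; rewrite lee_fin.
- rewrite lee_fin exprn_ge0// -lee_fin -hc integral_ge0// => z _; by rewrite lee_fin.
Qed.

Lemma tuple_measure_setT n : tuple_measure P n setT = 1%E.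
Proof.
have h1 : (\int[P]_z (cst 1 z : R)%:E = 1%:E)%E.
  by rewrite (@integral_cst _ _ _ P setT measurableT 1%E) mul1e; exact: probability_setT.
have := @integral_tuple_measure_prod n (cst 1) 1 _ (fun=> ler01) h1.
rewrite expr1n => /(_ (measurable_cst _)) <-.
under eq_integral do rewrite big1//.
by rewrite (@integral_cst _ _ _ _ setT measurableT 1%E) mul1e.
Qed.

Lemma tuple_chernoff n (h : Z -> R) (c t : R) : 0 < t ->
  measurable_fun setT h -> (forall z, 0 <= h z) ->
  (\int[P]_z (h z)%:E <= c%:E)%E ->
  (tuple_measure P n [set z | (t <= \prod_(i < n) h (tnth z i))%R] <= (t^-1 * c ^+ n)%:E)%E.
Proof.
move=> t0 mh h0 hc.
have h0' : (0 <= \int[P]_z (h z)%:E)%E by apply: integral_ge0 => z _; rewrite lee_fin.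
have hfin : (\int[P]_z (h z)%:E)%E \is a fin_num.
  by rewrite ge0_fin_numE// (le_lt_trans hc)// ltry.
have := @integral_tuple_measure_prod n h (fine (\int[P]_z (h z)%:E)%E) mh h0.
rewrite fineK// => /(_ erefl) hn.
have := @ge0_markov _ _ _ (tuple_measure P n) (fun z => (\prod_(i < n) h (tnth z i))%:E) t t0.
rewrite hn => /(_ _ _)/le_trans; apply.
- exact: measurableT_comp (measurable_tuple_prod mh).
- by move=> z; rewrite lee_fin prodr_ge0.
- rewrite -EFinM lee_fin ler_wpM2l ?invr_ge0 ?(ltW t0)//.
  by rewrite lerXn2r ?nnegrE -?lee_fin ?fineK// (le_trans h0').
Qed.

(** The indicator turns an integral over [B] into a section integral over the whole space, to which
    Tonelli's theorem applies. *)
Lemma integral_section_fubini_G d1 (Y : measurableType d1) dT (T : measurableType dT)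
    (Q : probability T R) (B : set T) (G : T * Y -> R) (z : Y) :
  (\int[Q]_(x in B) (G (x, z))%:E =
   fubini_G Q (fun xz => (\1_B xz.1 * G xz)%:E) z)%E.
Proof.
rewrite [LHS]integral_mkcond /fubini_G; apply: eq_integral => x _.
by rewrite /patch /= indicE; case: ifP => _; rewrite ?mul1r ?mul0r.
Qed.

Lemma measurable_indic_mul d1 (Y : measurableType d1) dT (T : measurableType dT)
    (B : set T) (G : T * Y -> R) : measurable B -> measurable_fun setT G ->
  measurable_fun setT (fun xz : T * Y => (\1_B xz.1 * G xz)%:E).
Proof.
move=> mB mG; apply/measurable_EFinP/measurable_funM => //.
by apply: measurableT_comp => //; exact: measurable_fst.
Qed.

Lemma measurable_integral_section d1 (Y : measurableType d1) dT (T : measurableType dT)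
    (Q : probability T R) (B : set T) (G : T * Y -> R) :
  measurable B -> measurable_fun setT G -> (forall x, 0 <= G x) ->
  measurable_fun setT (fun z => \int[Q]_(x in B) (G (x, z))%:E)%E.
Proof.
move=> mB mG G0; under eq_fun do rewrite integral_section_fubini_G.
apply: measurable_fun_fubini_tonelli_G; first exact: measurable_indic_mul.
by move=> xz; rewrite lee_fin mulr_ge0.
Qed.

Lemma tuple_measure_markov_fubini n dT (T : measurableType dT) (Q : probability T R)
    (B : set T) (G : T * n.-tuple Z -> R) (t : R) : 0 < t -> measurable B ->
  measurable_fun setT G -> (forall x, 0 <= G x) ->
  (forall x, B x -> (\int[tuple_measure P n]_z (G (x, z))%:E <= 1)%E) ->
  (tuple_measure P n [set z | t%:E <= \int[Q]_(x in B) (G (x, z))%:E] <= t^-1%:E * Q B)%E.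
Proof.
move=> t0 mB mG G0 G1.
pose g := (fun xz : T * n.-tuple Z => (\1_B xz.1 * G xz)%:E)%E.
have mg : measurable_fun setT g by exact: measurable_indic_mul.
have g0 x : (0 <= g x)%E by rewrite lee_fin mulr_ge0.
have -> : [set z | (t%:E <= \int[Q]_(x in B) (G (x, z))%:E)%E] =
    [set z | (t%:E <= fubini_G Q g z)%E].
  by apply/seteqP; split => z /=; rewrite integral_section_fubini_G.
have := @ge0_markov _ _ _ (tuple_measure P n) (fubini_G Q g) t t0.
move=> /(_ _ _)/le_trans; apply.
- exact: measurable_fun_fubini_tonelli_G.
- by move=> z; apply: integral_ge0.
rewrite lee_wpmul2l ?lee_fin ?invr_ge0 ?(ltW t0)//.
rewrite -(fubini_tonelli2 g)// (fubini_tonelli1 g)//.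
have -> : Q B = (\int[Q]_x (\1_B x)%:E)%E by rewrite integral_indic// setIT.
apply: ge0_le_integral => //.
- by move=> x _; apply: integral_ge0.
- exact: measurable_fun_fubini_tonelli_F.
- exact/measurable_EFinP.
move=> x _; rewrite /fubini_F /g /= indicE.
case: (boolP (x \in B)) => xB.
  by under eq_integral do rewrite mul1r; apply: G1; rewrite inE in xB.
by under eq_integral do rewrite mul0r; rewrite integral0.
Qed.

End tuple_measure_integral.

(** * Parameter sets and measurability of the densities *)

Section parameter_space.
Context {R : realType} {d : measure_display} {Z : measurableType d}.
Context (mu : {measure set Z -> \bar R}).
Context {dT : measure_display} (T : measurableType dT) (M : model mu T).

Definition row_coord k (t : T) : 'rV[R]_(dim M k) := \row_i tnth (coord M k t) i.

Lemma euclid_dist_continuous n (x : n.-tuple R) :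
  continuous (fun y : 'rV[R]_n => Num.sqrt (\sum_i (tnth x i - y ord0 i) ^+ 2)).
Proof.
move=> y.
apply: (@continuous_comp _ _ _ (fun y : 'rV[R]_n => \sum_i (tnth x i - y ord0 i) ^+ 2)
  (@Num.sqrt R)); last exact: sqrt_continuous.
rewrite (_ : (fun y : 'rV[R]_n => _) =
    \sum_i (fun y : 'rV[R]_n => (tnth x i - y ord0 i) ^+ 2)); last first.
  by apply/funext => z; rewrite fct_sumE.
elim/big_ind : _ => [|f g cf cg|i _].
- exact: cst_continuous.
- exact: continuousD.
- have c : {for y, continuous (fun y : 'rV[R]_n => tnth x i - y ord0 i)}.
    by apply: continuousB; [exact: cst_continuous|exact: coord_continuous].
  rewrite (_ : (fun _ => _) = (fun y : 'rV[R]_n => tnth x i - y ord0 i) *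
    (fun y : 'rV[R]_n => tnth x i - y ord0 i)); first exact: continuousM.
  by apply/funext => z; rewrite expr2.
Qed.

Lemma dist_row k t t' : dist M k t t' =
  Num.sqrt (\sum_i (tnth (coord M k t) i - row_coord k t' ord0 i) ^+ 2).
Proof.
by rewrite /dist /euclid_dist; congr Num.sqrt; apply: eq_bigr => i _; rewrite mxE.
Qed.

Lemma distxx k t : dist M k t t = 0.
Proof.
rewrite /dist /euclid_dist big1 ?sqrtr0// => i _.
by rewrite subrr expr0n.
Qed.

Lemma dist_ball_nbhs k t t' (h : R) : dist M k t t' < h ->
  exists2 U, nbhs (row_coord k t') U &
    forall t'', U (row_coord k t'') -> dist M k t t'' < h.
Proof.
rewrite dist_row => th.
have H := @cvgr_lt _ _ _ _ _ _ (@euclid_dist_continuous _ (coord M k t) (row_coord k t')) _ th.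
exists [set y : 'rV[R]_(dim M k) |
  Num.sqrt (\sum_i (tnth (coord M k t) i - y ord0 i) ^+ 2) < h]; first exact: H.
by move=> t'' /=; rewrite dist_row.
Qed.

(** Compactness as an induction principle. If [A] failed for the whole of [Theta M k], the sets of
    rows outside of which [A] holds would form a proper filter; it contains the image of
    [Theta M k], and the local hypothesis at a cluster point is contradictory. *)
Lemma Theta_compact_ind k (A : set T -> Prop) : (1 <= k)%N ->
  A set0 -> (forall B C, A C -> B `<=` C -> A B) ->
  (forall B C, A B -> A C -> A (B `|` C)) ->
  (forall t, Theta M k t -> exists2 U, nbhs (row_coord k t) U &
     A [set t' | Theta M k t' /\ U (row_coord k t')]) ->
  A (Theta M k).
Proof.
move=> k1 A0 Amono AU Aloc; apply: contrapT => nA.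
pose F : set_system 'rV[R]_(dim M k) :=
  [set V | A [set t | Theta M k t /\ ~ V (row_coord k t)]].
have FF : ProperFilter F.
  split; last split.
  - rewrite /F /= => AT; apply: nA; apply: (Amono _ _ AT) => t Tt.
    exact: (conj Tt (fun h => h)).
  - by rewrite /F /=; apply: (Amono _ _ A0) => t [_]; apply.
  - rewrite /F /= => V W AV AW; apply: (Amono _ _ (AU _ _ AV AW)) => t [Tt] /= nVW.
    have [Vt|nVt] := pselect (V (row_coord k t)); last by left.
    by right; split => // Wt; exact: nVW.
  - rewrite /F /= => V W VW AV; apply: (Amono _ _ AV) => t [Tt nW]; split=> //.
    by move=> Vt; apply: nW; exact: VW.
have [|x [[t Tt <-] clx]] := @Theta_compact _ _ _ mu _ _ M k k1 F FF.
  rewrite /F /=; apply: (Amono _ _ A0) => t [Tt] /= []; by exists t.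
have [U Ut AUt] := Aloc t Tt.
have /clx/(_ Ut) [y []] : F (~` U).
  rewrite /F /=; apply: (Amono _ _ AUt) => t' [Tt'] /= /contrapT; by split.
by [].
Qed.

(** Rational vectors need not be coordinates of parameters. The sequence therefore enumerates pairs
    of a rational vector and a precision, and picks a parameter that close to the vector whenever
    there is one; a given [t] is then within twice the precision of the parameter picked. *)
Lemma Theta_separable k : exists D : nat -> T, forall t U, Theta M k t ->
  nbhs (row_coord k t) U -> exists i, Theta M k (D i) /\ U (row_coord k (D i)).
Proof.
pose I := ('rV[rat]_(dim M k) * nat)%type.
pose near_ (q : I) (t : T) := Theta M k t /\
  forall i, `|row_coord k t ord0 i - ratr (q.1 ord0 i)| < q.2.+1%:R^-1.
exists (fun n => if unpickle n is Some q then xget point (near_ q) else point) => t U Tt.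
move=> /nbhs_ballP[e /= e0 eU].
pose m := Num.truncn (2 / e).
have m0 : 0 < m.+1%:R^-1 :> R by rewrite invr_gt0.
have me : 2 * m.+1%:R^-1 < e.
  by rewrite ltr_pdivrMr// mulrC -ltr_pdivrMr// Num.Theory.truncnS_gt.
have qP i : exists q, `|row_coord k t ord0 i - ratr q| < m.+1%:R^-1.
  have [|q] := @rat_in_itvoo R (row_coord k t ord0 i) (row_coord k t ord0 i + m.+1%:R^-1).
    by rewrite ltrDl.
  rewrite in_itv/= => /andP[q1 q2]; exists q.
  move: q1 q2 m0.
  rewrite ltr_norml; set x := row_coord _ _ _ _; set y := ratr q; set c := _^-1.
  by move=> *; apply/andP; split; lra.
pose q : I := (\row_i xget 0 [set q | `|row_coord k t ord0 i - ratr q| < m.+1%:R^-1], m).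
have nq : near_ q t.
  split=> // i; rewrite /q /= mxE.
  by case: xgetP => [x _ //|nex]; have [x /nex] := qP i.
exists (pickle q); rewrite pickleK.
case: xgetP => [s _ [Ts sq]|/(_ t)//]; split=> //.
apply: eU; split=> // i j; rewrite /ball/= (ord1 i).
have [_ /(_ j) tq] := nq; have {}sq := sq j.
rewrite (le_lt_trans (ler_distD (ratr (q.1 ord0 j)) _ _))//.
apply: lt_trans me; rewrite mulr_natl mulr2n ltrD//.
by rewrite distrC.
Qed.

End parameter_space.

Section rays.
Context d (X : measurableType d) (R : realType).

Lemma measurable_fun_gt (f : X -> R) :
  (forall a, measurable [set x | a < f x]) -> measurable_fun setT f.
Proof.
move=> mf mD; apply: (measurability _ (RGenOInfty.measurableE R)) => //.
move=> _ [_ [a ->] <-]; rewrite setTI (_ : _ @^-1` _ = [set x | a < f x])//.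
by apply/seteqP; split => x /=; rewrite in_itv/= andbT.
Qed.

Lemma measurable_fun_lt (f : X -> R) :
  (forall a, measurable [set x | f x < a]) -> measurable_fun setT f.
Proof.
move=> mf mD; apply: (measurability _ (RGenInftyO.measurableE R)) => //.
move=> _ [_ [a ->] <-]; rewrite setTI (_ : _ @^-1` _ = [set x | f x < a])//.
Qed.
Lemma measurable_gt (f : X -> R) a : measurable_fun setT f -> measurable [set x | a < f x].
Proof.
move=> mf; rewrite (_ : [set _ | _] = f @^-1` `]a, +oo[%classic).
  by rewrite -[X in measurable X]setTI; exact: mf.
by apply/seteqP; split => x /=; rewrite in_itv/= andbT.
Qed.

Lemma measurable_lt (f : X -> R) a : measurable_fun setT f -> measurable [set x | f x < a].
Proof.
move=> mf; rewrite (_ : [set _ | _] = f @^-1` `]-oo, a[%classic).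
  by rewrite -[X in measurable X]setTI; exact: mf.
by apply/seteqP; split => x /=; rewrite in_itv/=.
Qed.

Lemma measurable_ge (f : X -> R) a : measurable_fun setT f -> measurable [set x | a <= f x].
Proof.
move=> mf; rewrite (_ : [set _ | _] = ~` [set x | f x < a]).
  exact/measurableC/measurable_lt.
by apply/seteqP; split => x /=; [move=> h; apply/negP; rewrite -leNgt|move/negP; rewrite -leNgt].
Qed.

End rays.

Section densities.
Context {R : realType} {d : measure_display} {Z : measurableType d}.
Context (mu : {measure set Z -> \bar R}).
Context {dT : measure_display} (T : measurableType dT) (M : model mu T).

Lemma dist_sym k t t' : dist M k t t' = dist M k t' t.
Proof.
rewrite /dist /euclid_dist; congr Num.sqrt; apply: eq_bigr => i _.
by rewrite -sqrrN opprB.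
Qed.

Lemma dens_gt_near k t z (a : R) : (1 <= k)%N -> Theta M k t -> a < dens M t z ->
  exists2 h : R, 0 < h & forall t', Theta M k t' -> dist M k t t' < h -> a < dens M t' z.
Proof.
move=> k1 Tt; have [a0 _|a0 at_] := leP a 0.
  by exists 1 => // t' Tt' _; exact: le_lt_trans (dens_gt0 z Tt').
have e0 : 0 < ln (dens M t z) - ln a by rewrite subr_gt0 ltr_ln ?posrE// (lt_trans a0).
have [h h0 hh] := loglik_continuous z k1 Tt e0.
exists h => // t' Tt' Ut'; have := hh _ Tt' Ut'.
rewrite ltr_norml => /andP[+ _]; rewrite opprB ltrD2r ltr_ln ?posrE//.
exact: dens_gt0 Tt'.
Qed.

Lemma dens_lt_near k t z (a : R) : (1 <= k)%N -> Theta M k t -> dens M t z < a ->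
  exists2 h : R, 0 < h & forall t', Theta M k t' -> dist M k t t' < h -> dens M t' z < a.
Proof.
move=> k1 Tt ta; have a0 : 0 < a := lt_trans (dens_gt0 z Tt) ta.
have e0 : 0 < ln a - ln (dens M t z).
  by rewrite subr_gt0 ltr_ln ?posrE//; exact: dens_gt0 Tt.
have [h h0 hh] := loglik_continuous z k1 Tt e0.
exists h => // t' Tt' Ut'; have := hh _ Tt' Ut'.
rewrite ltr_norml => /andP[_]; rewrite ltrD2r ltr_ln ?posrE//.
exact: dens_gt0 Tt'.
Qed.

Lemma Theta_compact_dist_ind k (A : set T -> Prop) : (1 <= k)%N ->
  A set0 -> (forall B C, A C -> B `<=` C -> A B) ->
  (forall B C, A B -> A C -> A (B `|` C)) ->
  (forall t, Theta M k t -> exists2 h : R, 0 < h &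
     A [set t' | Theta M k t' /\ dist M k t t' < h]) ->
  A (Theta M k).
Proof.
move=> k1 A0 Amono AU Aloc; apply: Theta_compact_ind => // t Tt.
have [h h0 Ah] := Aloc t Tt.
have [|U Ut Uh] := @dist_ball_nbhs _ _ _ _ _ _ M k t t h; first by rewrite distxx.
by exists U => //; apply: (Amono _ _ Ah) => t' [Tt' /Uh].
Qed.

Lemma Theta_dense_near k : exists D : nat -> T, forall t t' (h h' : R), Theta M k t' ->
  dist M k t t' < h -> 0 < h' ->
  exists i, [/\ Theta M k (D i), dist M k t (D i) < h & dist M k t' (D i) < h'].
Proof.
have [D hD] := Theta_separable M k; exists D => t t' h h' Tt' tt' h'0.
have [U Ut Uh] := dist_ball_nbhs tt'.
have [|V Vt Vh] := @dist_ball_nbhs _ _ _ _ _ _ M k t' t' h'; first by rewrite distxx.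
have [i [Di [Ui Vi]]] := hD t' (U `&` V) Tt' (filterI Ut Vt).
by exists i; split => //; [exact: Uh|exact: Vh].
Qed.

Lemma dens_bounded k z : (1 <= k)%N ->
  exists2 C, 0 < C & forall t, Theta M k t -> dens M t z <= C.
Proof.
move=> k1; apply: (@Theta_compact_dist_ind k
  (fun A => exists2 C : R, 0 < C & forall t, A t -> dens M t z <= C)) => //.
- by exists 1.
- by move=> B C [c c0 hc] BC; exists c => // t /BC; exact: hc.
- move=> B C [b b0 hb] [c c0 hc]; exists (Num.max b c); first by rewrite lt_max b0.
  by move=> t [/hb|/hc] h; rewrite le_max h ?orbT.
- move=> t Tt; have ta : dens M t z < dens M t z + 1 by rewrite ltrDl.
  have [h h0 hh] := dens_lt_near k1 Tt ta.
  exists h => //; exists (dens M t z + 1).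
    by rewrite addr_gt0//; exact: dens_gt0 Tt.
  by move=> t' [Tt' Ut']; rewrite ltW// hh.
Qed.

Lemma measurable_dist_lt k t (h : R) :
  measurable [set t' | Theta M k t' /\ dist M k t t' < h].
Proof.
have mc : measurable_fun (Theta M k) (fun t' => dist M k t t').
  have ms : measurable_fun setT (@Num.sqrt R).
    by apply: continuous_measurable_fun; exact: sqrt_continuous.
  rewrite /dist /euclid_dist; apply: (measurableT_comp ms).
  apply: measurable_sum => i; apply: measurable_funX; apply: measurable_funB => //.
  by apply: measurableT_comp (measurable_tnth i) _; exact: coord_measurable.
have := mc (Theta_measurable M k) `]-oo, h[%classic (measurable_itv _).
by congr measurable; apply/seteqP; split => x /=; rewrite in_itv.
Qed.

Lemma dens_lower_bounded k z : (1 <= k)%N ->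
  exists2 c, 0 < c & forall t, Theta M k t -> c <= dens M t z.
Proof.
move=> k1; apply: (@Theta_compact_dist_ind k
  (fun A => exists2 c : R, 0 < c & forall t, A t -> c <= dens M t z)) => //.
- by exists 1.
- by move=> B C [c c0 hc] BC; exists c => // t /BC; exact: hc.
- move=> B C [b b0 hb] [c c0 hc]; exists (Num.min b c); first by rewrite lt_min b0.
  by move=> t [/hb|/hc] h; rewrite ge_min h ?orbT.
- move=> t Tt; have t0 := dens_gt0 z Tt.
  have ta : dens M t z / 2 < dens M t z by lra.
  have [h h0 hh] := dens_gt_near k1 Tt ta.
  exists h => //; exists (dens M t z / 2); first by rewrite divr_gt0.
  by move=> t' [Tt' Ut']; rewrite ltW// hh.
Qed.

(* The value 1 off [Theta k] only keeps the function positive. *)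
Definition ext_dens k (x : T * Z) : R :=
  if x.1 \in Theta M k then dens M x.1 x.2 else 1.

Lemma ext_dens_gt0 k x : 0 < ext_dens k x.
Proof.
rewrite /ext_dens; case: ifPn => // /[!inE] h; exact: dens_gt0 h.
Qed.

Lemma ext_densE k t z : Theta M k t -> ext_dens k (t, z) = dens M t z.
Proof. by move=> Tt; rewrite /ext_dens mem_set. Qed.

(* A value exceeds [a] iff for some [m] it exceeds [a + 1/(m+1)] at all points
   of a countable dense set within [1/(m+1)]. *)
Lemma measurable_ext_dens k : (1 <= k)%N -> measurable_fun setT (ext_dens k).
Proof.
move=> k1; apply: measurable_fun_gt => a.
have [D hD] := Theta_dense_near k.
pose E m i : set (T * Z) := [set x | Theta M k (D i) ->
  Theta M k x.1 -> dist M k (D i) x.1 < m.+1%:R^-1 -> a + m.+1%:R^-1 < dens M (D i) x.2].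
have mE m i : measurable (E m i).
  have [TD|nTD] := pselect (Theta M k (D i)); last first.
    by rewrite (_ : E m i = setT)//; apply/seteqP; split => // x _ /nTD.
  have -> : E m i = (~` [set t' | Theta M k t' /\ dist M k (D i) t' < m.+1%:R^-1] `*` setT) `|`
      (setT `*` [set z | a + m.+1%:R^-1 < dens M (D i) z]).
    apply/seteqP; split => [x Ex|x [[/= h _]|[_ /= h]]].
    - have [[h1 h2]|h] := pselect (Theta M k x.1 /\ dist M k (D i) x.1 < m.+1%:R^-1).
        by right; split=> //; exact: Ex.
      by left; split.
    - by move=> _ h1 h2; exfalso; apply: h.
    - by [].
  apply: measurableU; apply: measurableX => //.
  - by apply: measurableC; exact: measurable_dist_lt.
  - by apply: measurable_gt; exact: dens_measurable TD.
have -> : [set x | a < ext_dens k x] =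
    (Theta M k `*` setT `&` \bigcup_m \bigcap_i E m i) `|`
    (~` Theta M k `*` [set z | a < 1]).
  apply/seteqP; split => [[t z] /= | [t z] [[[/= Tt _] [m _ hm]]|[/= nTt a1]]].
  - have [Tt|nTt] := pselect (Theta M k t); last first.
      by rewrite /ext_dens /= memNset// => a1; right; split.
    rewrite ext_densE// => ta; left; split=> //.
    pose a' := (a + dens M t z) / 2.
    have a't : a' < dens M t z by rewrite /a'; lra.
    have aa' : 0 < a' - a by rewrite /a'; lra.
    have [h h0 hh] := dens_gt_near k1 Tt a't.
    pose m := Num.truncn (Num.max h^-1 (a' - a)^-1).
    have mb : Num.max h^-1 (a' - a)^-1 < m.+1%:R by exact: Num.Theory.truncnS_gt.
    have mh : m.+1%:R^-1 < h.
      by rewrite invf_plt ?posrE// (le_lt_trans _ mb)// le_max lexx.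
    have ma : m.+1%:R^-1 < a' - a.
      by rewrite invf_plt ?posrE// (le_lt_trans _ mb)// le_max lexx orbT.
    exists m => // i _ /= Di _ Dit.
    have : a' < dens M (D i) z by apply: hh => //; rewrite dist_sym (lt_trans Dit).
    by apply: lt_trans; rewrite -ltrBrDl.
  - rewrite ext_densE// ltNge; apply/negP => ta.
    have m0 : 0 < m.+1%:R^-1 :> R by rewrite invr_gt0.
    have ta' : dens M t z < a + m.+1%:R^-1 by rewrite (le_lt_trans ta)// ltrDl.
    have [h h0 hh] := dens_lt_near k1 Tt ta'.
    have [|i [Di Dit Dit']] := hD t t m.+1%:R^-1 h Tt _ h0; first by rewrite distxx.
    have := hm i I Di Tt; rewrite dist_sym => /(_ Dit) /=.
    by rewrite ltNge ltW// hh.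
  - by rewrite /ext_dens /= memNset.
apply: measurableU.
  apply: measurableI; first by apply: measurableX => //; exact: Theta_measurable.
  by apply: bigcup_measurable => m _; apply: bigcap_measurable => // i _.
apply: measurableX; first exact: measurableC (Theta_measurable M k).
have [a1|a1] := boolP (a < 1).
  by rewrite (_ : [set _ | _] = setT)//; apply/seteqP; split.
by rewrite (_ : [set _ | _] = set0)//; apply/seteqP; split => z //= h; rewrite h in a1.
Qed.

Section envelopes.
Variables (k : nat) (t : T) (h : R).
Hypotheses (k1 : (1 <= k)%N) (Tt : Theta M k t) (h0 : 0 < h).

Let S z := [set dens M t' z | t' in [set t' | Theta M k t' /\ dist M k t t' < h]].

Let S_t z : S z (dens M t z).
Proof. by exists t => //=; rewrite distxx. Qed.

Let S_sup z : has_sup (S z).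
Proof.
split; first by exists (dens M t z).
have [C _ hC] := dens_bounded z k1.
by exists C => _ [t' [Tt' _] <-]; exact: hC.
Qed.

Let S_inf z : has_inf (S z).
Proof.
split; first by exists (dens M t z).
by exists 0 => _ [t' [Tt' _] <-]; rewrite ltW//; exact: dens_gt0 Tt'.
Qed.

Lemma upper_env_ge t' z : Theta M k t' -> dist M k t t' < h ->
  dens M t' z <= upper_env M k t h z.
Proof. by move=> Tt' tt'; apply: ub_le_sup; [exact: (S_sup z).2|by exists t']. Qed.

Lemma lower_env_le t' z : Theta M k t' -> dist M k t t' < h ->
  lower_env M k t h z <= dens M t' z.
Proof. by move=> Tt' tt'; apply: ge_inf; [exact: (S_inf z).2|by exists t']. Qed.

Lemma lower_env_gt0 z : 0 < lower_env M k t h z.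
Proof.
have [c c0 hc] := dens_lower_bounded z k1.
apply: (lt_le_trans c0); apply: lb_le_inf; first exact: (S_inf z).1.
by move=> _ [t' [Tt' _] <-]; exact: hc.
Qed.

Lemma upper_env_gt_exists a z : a < upper_env M k t h z ->
  exists t', [/\ Theta M k t', dist M k t t' < h & a < dens M t' z].
Proof.
by move=> /(sup_gt (S_sup z).1) [_ [t' [Tt' tt'] <-] at']; exists t'.
Qed.

Lemma lower_env_lt_exists a z : lower_env M k t h z < a ->
  exists t', [/\ Theta M k t', dist M k t t' < h & dens M t' z < a].
Proof.
by move=> /(inf_lt (S_inf z).1) [_ [t' [Tt' tt'] <-] at']; exists t'.
Qed.

(** The supremum is over an uncountable ball, but by continuity in the parameter a strict inequality
    at one point of the ball persists nearby, hence at a point of a countable dense set. The lower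
    envelope is treated in the same way. *)
Lemma measurable_upper_env : measurable_fun setT (upper_env M k t h).
Proof.
apply: measurable_fun_gt => a; have [D hD] := Theta_dense_near k.
have -> : [set z | a < upper_env M k t h z] =
    \bigcup_(i in [set i | Theta M k (D i) /\ dist M k t (D i) < h])
      [set z | a < dens M (D i) z].
  apply/seteqP; split => z /=.
    move=> /upper_env_gt_exists[t' [Tt' tt' at']].
    have [h' h'0 hh'] := dens_gt_near k1 Tt' at'.
    have [i [Di Di1 Di2]] := hD _ _ _ _ Tt' tt' h'0.
    by exists i => //=; exact: hh'.
  by move=> [i [Di tDi] /= aDi]; exact: lt_le_trans aDi (upper_env_ge _ Di tDi).
by apply: bigcup_measurable => i [Di _]; apply: measurable_gt; exact: dens_measurable Di.
Qed.

Lemma measurable_lower_env : measurable_fun setT (lower_env M k t h).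
Proof.
apply: measurable_fun_lt => a; have [D hD] := Theta_dense_near k.
have -> : [set z | lower_env M k t h z < a] =
    \bigcup_(i in [set i | Theta M k (D i) /\ dist M k t (D i) < h])
      [set z | dens M (D i) z < a].
  apply/seteqP; split => z /=.
    move=> /lower_env_lt_exists[t' [Tt' tt' at']].
    have [h' h'0 hh'] := dens_lt_near k1 Tt' at'.
    have [i [Di Di1 Di2]] := hD _ _ _ _ Tt' tt' h'0.
    by exists i => //=; exact: hh'.
  by move=> [i [Di tDi] /= aDi]; exact: le_lt_trans (lower_env_le _ Di tDi) aDi.
by apply: bigcup_measurable => i [Di _]; apply: measurable_lt; exact: dens_measurable Di.
Qed.

End envelopes.

End densities.

(** * Likelihood ratios and Kullback-Leibler divergence *)

Section law_density.
Context {R : realType} {d : measure_display} {Z : measurableType d}.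
Context (mu : {measure set Z -> \bar R}).
Import HBNNSimple.

(** As [mu] is an arbitrary measure, the density is given by the identity on sets rather than as a
    Radon-Nikodym derivative. The identity extends to simple functions and then, by monotone
    convergence, to [f]. *)
Lemma integral_density (P : {measure set Z -> \bar R}) (g : Z -> R) (f : Z -> \bar R) :
  measurable_fun setT g -> (forall z, 0 <= g z) ->
  (forall A, measurable A -> P A = \int[mu]_(z in A) (g z)%:E)%E ->
  measurable_fun setT f -> (forall z, 0 <= f z)%E ->
  (\int[P]_z f z = \int[mu]_z (f z * (g z)%:E))%E.
Proof.
move=> mg g0 PE mf f0.
pose h := nnsfun_approx measurableT mf.
have mgE : measurable_fun setT (EFin \o g) by exact/measurable_EFinP.
have mh n : measurable_fun setT (EFin \o h n).
  exact/measurable_EFinP/measurable_funP.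
have fE z : f z = limn (EFin \o h ^~ z).
  by apply/esym/cvg_lim => //; exact: cvg_nnsfun_approx.
have -> : (\int[P]_z f z = limn (fun n => \int[P]_z (EFin \o h n) z))%E.
  under eq_integral do rewrite fE.
  rewrite monotone_convergence//.
  - by move=> n z _; rewrite lee_fin.
  - by move=> z _ a b ab; rewrite lee_fin; exact/lefP/nd_nnsfun_approx.
have -> : (\int[mu]_z (f z * (g z)%:E) =
    limn (fun n => \int[mu]_z ((EFin \o h n) z * (g z)%:E)))%E.
  have fgE z : (f z * (g z)%:E = limn (fun n => (EFin \o h n) z * (g z)%:E))%E.
    apply/esym/cvg_lim => //; apply: cvgeZr => //; exact: cvg_nnsfun_approx.
  under eq_integral do rewrite fgE.
  rewrite monotone_convergence//.
  - by move=> n; exact: emeasurable_funM.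
  - by move=> n z _; rewrite mule_ge0 ?lee_fin.
  - by move=> z _ a b ab; rewrite lee_wpmul2r ?lee_fin//; exact/lefP/nd_nnsfun_approx.
congr (limn _); apply/funext => n.
have hE z : ((EFin \o h n) z = \sum_(y \in range (h n)) (y * \1_(h n @^-1` [set y]) z)%:E)%E.
  by rewrite /= fimfunE -fsumEFin.
under eq_integral do rewrite hE.
rewrite ge0_integral_fsum//; last 2 first.
- by move=> y; exact/measurable_EFinP/measurable_funM.
- by move=> y z _; exact: nnfun_muleindic_ge0.
transitivity (\int[mu]_z (\sum_(y \in range (h n)) (y * \1_(h n @^-1` [set y]) z)%:E * (g z)%:E))%E; last first.
  apply: eq_integral => z _; rewrite hE ge0_mule_fsuml// => y.
  exact: nnfun_muleindic_ge0.
rewrite ge0_integral_fsum//; last 2 first.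
- by move=> y; apply: emeasurable_funM => //; exact/measurable_EFinP/measurable_funM.
- by move=> y z _; rewrite mule_ge0 ?lee_fin// -lee_fin; exact: nnfun_muleindic_ge0.
apply: eq_fsbigr => y /[!inE] -[z0 _ <-].
set B := h n @^-1` _.
have mB : measurable B by exact: measurable_sfunP.
under eq_integral do rewrite EFinM.
rewrite ge0_integralZl_EFin//; last exact/measurable_EFinP.
under [RHS]eq_integral do rewrite EFinM -muleA.
rewrite ge0_integralZl_EFin//; last 2 first.
- by move=> z _; rewrite mule_ge0 ?lee_fin.
- by apply: emeasurable_funM => //; exact/measurable_EFinP.
congr (_ * _)%E; rewrite integral_indic// setIT PE// integral_mkcond.
apply: eq_integral => z _; rewrite patchE indicE; case: ifP => _; rewrite ?mul1e ?mul0e//.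
Qed.

End law_density.

Section kullback.
Context {R : realType} {d : measure_display} {Z : measurableType d}.
Context (mu : {measure set Z -> \bar R}).
Context {dT : measure_display} (T : measurableType dT) (M : model mu T).

Local Notation Ps := (law_star M).
Local Notation fs := (dens_star M).

Lemma Theta_theta_star : Theta M (kstar M) (theta_star M).
Proof. by case: (theta_starP M). Qed.

Lemma kstar_gt0 : (1 <= kstar M)%N.
Proof.
by rewrite lt0n; apply/eqP => h; have := Theta_theta_star; rewrite h Theta0.
Qed.

Lemma Theta_le j k t : (1 <= j)%N -> (j <= k)%N -> Theta M j t -> Theta M k t.
Proof.
move=> j1; elim: k => [|k IH]; first by rewrite leqn0 => /eqP ->.
rewrite leq_eqVlt => /predU1P[->//|jk] /(IH jk).
exact: (Theta_nested (leq_trans j1 jk)).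
Qed.

Lemma dens_star_gt0 z : 0 < fs z.
Proof. exact: dens_gt0 Theta_theta_star. Qed.

Lemma measurable_dens_star : measurable_fun setT fs.
Proof. exact: dens_measurable Theta_theta_star. Qed.

Lemma measurable_divf (f g : Z -> R) : measurable_fun setT f -> measurable_fun setT g ->
  (forall z, 0 < g z) -> measurable_fun setT (fun z => f z / g z).
Proof.
move=> mf mg g0; apply: measurable_funM => //.
rewrite (_ : (fun _ => _) = (fun z => expR (- ln (g z)))).
  apply: measurableT_comp => //; apply: measurableT_comp => //.
  by apply: measurableT_comp => //; exact: measurable_ln.
by apply/funext => z; rewrite expRN lnK ?posrE.
Qed.

Lemma integral_law_star_ratio (f : Z -> R) : measurable_fun setT f -> (forall z, 0 <= f z) ->
  (\int[Ps]_z (f z / fs z)%:E = \int[mu]_z (f z)%:E)%E.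
Proof.
move=> mf f0.
rewrite (@integral_density _ _ _ mu Ps fs) //.
- by apply: eq_integral => z _; rewrite -EFinM divfK// gt_eqF// dens_star_gt0.
- exact: measurable_dens_star.
- by move=> z; rewrite ltW// dens_star_gt0.
- by move=> A mA; exact: law_dens Theta_theta_star mA.
- by apply/measurable_EFinP/measurable_divf => //; [exact: measurable_dens_star|exact: dens_star_gt0].
- by move=> z; rewrite lee_fin divr_ge0// ltW// dens_star_gt0.
Qed.

(** The sign is opposite to that of the integrands of [KL] and [q], so that [expR (llr t z)] is the
    likelihood ratio. *)
Definition llr (t : T) (z : Z) : R := loglik M t z - loglik_star M z.

Lemma measurable_loglik k t : Theta M k t -> measurable_fun setT (loglik M t).
Proof. by move=> Tt; apply: measurableT_comp => //; exact: dens_measurable Tt. Qed.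

Lemma measurable_llr k t : Theta M k t -> measurable_fun setT (llr t).
Proof.
move=> Tt; apply: measurable_funB; first exact: measurable_loglik Tt.
exact: measurable_loglik Theta_theta_star.
Qed.

Lemma expR_llr k t z : Theta M k t -> expR (llr t z) = dens M t z / fs z.
Proof.
move=> Tt; rewrite /llr expRB !lnK ?posrE//; first exact: dens_star_gt0.
exact: dens_gt0 Tt.
Qed.

Lemma integral_expR_llr k t : Theta M k t -> (\int[Ps]_z (expR (llr t z))%:E = 1)%E.
Proof.
move=> Tt; under eq_integral do rewrite (expR_llr _ Tt).
rewrite integral_law_star_ratio.
- by rewrite -(law_dens Tt)// probability_setT.
- exact: dens_measurable Tt.
- by move=> z; rewrite ltW//; exact: dens_gt0 Tt.
Qed.

(** Densities are positive everywhere, so [fs / dens M t] is a density of the true law with respect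
    to [law M t]. The infinite branch in the definition of [KL] is therefore never taken on the
    parameter sets. *)
Lemma law_star_dominates k t : Theta M k t -> Ps `<< law M t.
Proof.
move=> Tt; apply/null_content_dominatesP => A mA tA0.
have mf := dens_measurable Tt; have f0 := fun z => dens_gt0 z Tt.
have mfs : measurable_fun setT (fun z => (fs z / dens M t z)%:E).
  by apply/measurable_EFinP/measurable_divf => //; exact: measurable_dens_star.
have : (\int[law M t]_(z in A) (fs z / dens M t z)%:E = 0)%E.
  by rewrite null_set_integral//; exact: measurable_funS mfs.
rewrite integral_mkcond (@integral_density _ _ _ mu _ (dens M t))//.
- move=> <-; rewrite (law_dens Theta_theta_star mA) [LHS]integral_mkcond.
  apply: eq_integral => z _; rewrite !patchE; case: ifP => _; last by rewrite mul0e.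
  by rewrite -EFinM divfK// gt_eqF.
- by move=> z; rewrite ltW.
- by move=> B mB; exact: law_dens Tt mB.
- by apply/(measurable_restrictT _ _).1 => //; exact: measurable_funS mfs.
- by move=> z; apply: erestrict_ge0 => y; rewrite lee_fin divr_ge0 ?ltW ?dens_star_gt0.
Qed.

(** The extra term [expR a - 1] has mean zero. To cancel it without integrability of [a], the
    identity [kl_fun a + m + 1 = expR a + p] between nonnegative functions is integrated, [p] and
    [m] being the positive and negative parts of [- a]; the mean of [m] is finite because
    [m <= expR a]. *)
Lemma KL_E k t : Theta M k t -> KL M t = (\int[Ps]_z (kl_fun (llr t z))%:E)%E.
Proof.
move=> Tt; rewrite /KL asboolT; last exact: law_star_dominates Tt.
have ma := measurable_llr Tt.
have mea : measurable_fun setT (fun z => expR (llr t z)) by exact: measurableT_comp.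
pose p z := Num.max (- llr t z) 0; pose m z := Num.max (llr t z) 0.
have p0 z : 0 <= p z by rewrite le_max lexx orbT.
have m0 z : 0 <= m z by rewrite le_max lexx orbT.
have mp : measurable_fun setT p by apply: measurable_maxr => //; exact: measurableT_comp.
have mm : measurable_fun setT m by exact: measurable_maxr.
have mk : measurable_fun setT (fun z => kl_fun (llr t z)).
  by apply: measurable_funB => //; exact: measurable_funB.
rewrite integralE.
under eq_integral => z _.
  rewrite (_ : _^\+%E z = (p z)%:E); last first.
    by rewrite funeposE EFin_max /llr opprB. over.
under [X in (_ - X)%E]eq_integral => z _.
  rewrite (_ : _^\-%E z = (m z)%:E); last first.
    by rewrite funenegE EFin_max /llr -EFinN opprB. over.
have mfin : (\int[Ps]_z (m z)%:E)%E \is a fin_num.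
  rewrite ge0_fin_numE; last by apply: integral_ge0 => z _; rewrite lee_fin.
  apply: (@le_lt_trans _ _ 1%E); last exact: ltry.
  rewrite -(integral_expR_llr Tt); apply: ge0_le_integral => //.
  - by move=> z _; rewrite lee_fin.
  - exact/measurable_EFinP.
  - exact/measurable_EFinP.
  - move=> z _; rewrite lee_fin ge_max expR_ge0 andbT.
    by have := expR_ge1Dx (llr t z); lra.
have cst1 : (\int[Ps]_z (1 : R)%:E = 1)%E.
  by rewrite (@integral_cst _ _ _ Ps setT measurableT 1%E) mul1e; exact: probability_setT.
have : (\int[Ps]_z (1 * kl_fun (llr t z) + (1 * m z + 1))%:E =
   \int[Ps]_z (1 * expR (llr t z) + p z)%:E)%E.
  apply: eq_integral => z _; congr (_%:E); rewrite /kl_fun /p /m.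
  by case: leP => h1; case: leP => h2; lra.
have mm1 : measurable_fun setT (fun z => 1 * m z + 1).
  by apply: measurable_funD => //; exact: measurable_funM.
have m10 z : 0 <= 1 * m z + 1 by rewrite mul1r addr_ge0.
rewrite !ge0_integral_affine//; do ?[by move=> z; exact: kl_fun_ge0|by move=> z; exact: expR_ge0].
rewrite cst1 (integral_expR_llr Tt) !mul1e => h.
have -> : (\int[Ps]_z (p z)%:E = \int[Ps]_z (kl_fun (llr t z))%:E + \int[Ps]_z (m z)%:E)%E.
  rewrite -[LHS](@addeK _ 1%E)// [X in (X - _)%E]addeC -h addeA addeK//.
by rewrite addeK.
Qed.

End kullback.

(** * Parameters far from the truth *)

Section likelihood_ratio_far.
Context {R : realType} {d : measure_display} {Z : measurableType d}.
Context (mu : {measure set Z -> \bar R}).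
Context {dT : measure_display} (T : measurableType dT) (M : model mu T).

Local Notation Ps := (law_star M).
Local Notation fs := (dens_star M).

Lemma KL_ge0 k t : Theta M k t -> (0 <= KL M t)%E.
Proof.
by move=> Tt; rewrite (KL_E Tt); apply: integral_ge0 => z _; rewrite lee_fin kl_fun_ge0.
Qed.

Lemma KL_theta_star : KL M (theta_star M) = 0%E.
Proof.
rewrite (KL_E (Theta_theta_star M)) -[RHS](@integral0 _ _ _ Ps setT).
apply: eq_integral => z _; congr (_%:E).
by rewrite /llr /loglik_star subrr /kl_fun expR0 !subrr.
Qed.

Lemma KL_inf0 k : (kstar M <= k)%N -> KL_inf M k = 0%E.
Proof.
move=> k0; apply/eqP; rewrite eq_le; apply/andP; split.
  rewrite -KL_theta_star; apply: ereal_inf_lbound; exists (theta_star M) => //.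
  exact: Theta_le (kstar_gt0 M) k0 (Theta_theta_star M).
by apply: le_ereal_inf_tmp => _ [t Tt <-]; exact: KL_ge0 Tt.
Qed.

Lemma V_star_l (f : Z -> R) : measurable_fun setT f -> (forall z, 0 < f z) ->
  V mu fs f = (\int[Ps]_z ((ln (f z) - ln (fs z)) ^+ 2)%:E)%E.
Proof.
move=> mf f0; have mfs := measurable_dens_star M; have fs0 := dens_star_gt0 M.
rewrite (@integral_density _ _ _ mu Ps fs) //.
- rewrite /V /dint; apply: eq_integral => z _.
  by rewrite /elog !lne_EFin// -EFinB -EFin_expe muleC -sqrrN opprB.
- by move=> z; rewrite ltW.
- by move=> A mA; exact: law_dens (Theta_theta_star M) mA.
- apply/measurable_EFinP/measurable_funX; apply: measurable_funB;
  by apply: measurableT_comp => //; exact: measurable_ln.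
- by move=> z; rewrite lee_fin sqr_ge0.
Qed.

Lemma V_star_r (f : Z -> R) : measurable_fun setT f -> (forall z, 0 < f z) ->
  V mu f fs = (\int[Ps]_z (f z / fs z * (ln (f z) - ln (fs z)) ^+ 2)%:E)%E.
Proof.
move=> mf f0; have mfs := measurable_dens_star M; have fs0 := dens_star_gt0 M.
have mq : measurable_fun setT (fun z => (ln (f z) - ln (fs z)) ^+ 2).
  by apply/measurable_funX; apply: measurable_funB; apply: measurableT_comp => //; exact: measurable_ln.
under eq_integral do rewrite mulrAC.
rewrite integral_law_star_ratio; last 2 first.
- exact: measurable_funM.
- by move=> z; rewrite mulr_ge0 ?sqr_ge0 ?ltW.
by apply: eq_integral => z _; rewrite /elog !lne_EFin.
Qed.

Lemma V_ge0 (f g : Z -> R) : (forall z, 0 <= f z) -> (0 <= V mu f g)%E.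
Proof.
move=> f0; apply: integral_ge0 => z _; rewrite mule_ge0 ?lee_fin//.
exact: sqre_ge0.
Qed.

Lemma adde4_lty (a b c e : \bar R) : (0 <= a -> 0 <= b -> 0 <= c -> 0 <= e ->
  a + b + c + e < +oo -> [/\ a < +oo, b < +oo & c < +oo])%E.
Proof. by move: a b c e => [a||] [b||] [c||] [e||] //; rewrite !ltry. Qed.

(** An integrable majorant for dominated convergence in the parameter. On the ball, [llr] lies
    between the log-ratios [bl] and [bu] of the envelopes, which have finite second moments; and
    [u / fs <= expR 1 + u / fs * bu ^+ 2], whose last term integrates to [V mu u fs]. *)
Lemma A2_dominated k t : condA2 M -> (1 <= k)%N -> Theta M k t ->
  exists2 eta : R, 0 < eta & exists g : Z -> R,
    [/\ Ps.-integrable setT (EFin \o g),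
        forall z, 0 <= g z,
        forall z t', Theta M k t' -> dist M k t t' < eta ->
          `|llr M t' z| + expR (llr M t' z) <= g z &
        forall z, upper_env M k t eta z / fs z <= g z].
Proof.
move=> A2 k1 Tt; have [eta eta0 Veta] := A2 k t k1 Tt.
exists eta => //.
set u := upper_env M k t eta in Veta *; set l := lower_env M k t eta in Veta *.
have mu_ : measurable_fun setT u by exact: measurable_upper_env.
have ml : measurable_fun setT l by exact: measurable_lower_env.
have mfs := measurable_dens_star M; have fs0 := dens_star_gt0 M.
have l0 z : 0 < l z by exact: lower_env_gt0.
have u0 z : 0 < u z.
  by apply: (lt_le_trans (dens_gt0 z Tt)); apply: upper_env_ge; rewrite ?distxx.
have mln (f : Z -> R) : measurable_fun setT f -> measurable_fun setT (fun z => ln (f z) - ln (fs z)).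
  by move=> mf; apply: measurable_funB; apply: measurableT_comp => //; exact: measurable_ln.
pose bu z := ln (u z) - ln (fs z); pose bl z := ln (l z) - ln (fs z).
have mbu : measurable_fun setT bu by exact: mln.
have mbl : measurable_fun setT bl by exact: mln.
have uE z : u z / fs z = expR (bu z) by rewrite /bu expRB !lnK ?posrE.
pose g z := expR 1 + 2 + bl z ^+ 2 + bu z ^+ 2 + u z / fs z * bu z ^+ 2.
have ug z : u z / fs z <= expR 1 + u z / fs z * bu z ^+ 2.
  have q0 : 0 <= u z / fs z by rewrite divr_ge0 ?ltW.
  have b0 := sqr_ge0 (bu z).
  have [b1|b1] := leP (bu z) 1.
    apply: (@le_trans _ _ (expR 1)); first by rewrite uE ler_expR.
    by rewrite lerDl mulr_ge0.
  rewrite -[leLHS]add0r lerD ?expR_ge0// ler_peMr//.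
  by rewrite expr2; nra.
have q0 z : 0 <= u z / fs z * bu z ^+ 2.
  by rewrite mulr_ge0 ?sqr_ge0// divr_ge0 ?ltW.
have absq (x : R) : `|x| <= 1 + x ^+ 2.
  by rewrite -[x ^+ 2]real_normK ?num_real//; have := sqr_ge0 (`|x| - 1 / 2); nra.
have e10 := expR_ge0 (1 : R).
have g0 z : 0 <= g z by rewrite /g !addr_ge0 ?sqr_ge0.
have mquf : measurable_fun setT (fun z => u z / fs z * bu z ^+ 2).
  by apply: measurable_funM; [exact: measurable_divf|exact: measurable_funX].
have mg : measurable_fun setT g.
  apply: measurable_funD => //; apply: measurable_funD; last exact: measurable_funX.
  by apply: measurable_funD => //; exact: measurable_funX.
exists g; split=> //.
- apply/integrableP; split; first exact/measurable_EFinP.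
  have Vufs0 : (0 <= V mu u fs)%E by apply: V_ge0 => z; rewrite ltW.
  have Vut0 : (0 <= V mu u (dens M t))%E by apply: V_ge0 => z; rewrite ltW.
  have Vfsu0 : (0 <= V mu fs u)%E by apply: V_ge0 => z; rewrite ltW.
  have Vfsl0 : (0 <= V mu fs l)%E by apply: V_ge0 => z; rewrite ltW.
  have [Vu' Vl Vu] := adde4_lty Vufs0 Vfsl0 Vfsu0 Vut0 Veta.
  under eq_integral do rewrite gee0_abs ?lee_fin//.
  rewrite V_star_l// in Vl; rewrite V_star_l// in Vu; rewrite V_star_r// in Vu'.
  have -> : (\int[Ps]_z ((EFin \o g) z) = \int[Ps]_z (1 * bl z ^+ 2 +
      (1 * bu z ^+ 2 + (1 * (u z / fs z * bu z ^+ 2) + (expR 1 + 2))))%:E)%E.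
    by apply: eq_integral => z _; congr (_%:E); rewrite /g; ring.
  have mX (f : Z -> R) : measurable_fun setT f -> measurable_fun setT (fun z => f z ^+ 2).
    by move=> mf; exact: measurable_funX.
  have cst0 : 0 <= expR 1 + 2 :> R by rewrite addr_ge0.
  have c1 z : 0 <= 1 * (u z / fs z * bu z ^+ 2) + (expR 1 + 2) by rewrite mul1r addr_ge0.
  have c2 z : 0 <= 1 * bu z ^+ 2 + (1 * (u z / fs z * bu z ^+ 2) + (expR 1 + 2)).
    by rewrite addr_ge0// mul1r sqr_ge0.
  have m1 : measurable_fun setT (fun z => 1 * (u z / fs z * bu z ^+ 2) + (expR 1 + 2)).
    by apply: measurable_funD => //; exact: measurable_funM.
  have m2 : measurable_fun setT (fun z => 1 * bu z ^+ 2 + (1 * (u z / fs z * bu z ^+ 2) + (expR 1 + 2))).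
    by apply: measurable_funD => //; apply: measurable_funM => //; exact: mX.
  rewrite !ge0_integral_affine//; do ?[exact: mX|by move=> z; exact: sqr_ge0].
  rewrite !mul1e integral_probability_cst.
  exact: lte_add_pinfty Vl (lte_add_pinfty Vu (lte_add_pinfty Vu' (ltry _))).
- move=> z t' Tt' tt'.
  have h1 : dens M t' z <= u z by exact: upper_env_ge.
  have h2 : l z <= dens M t' z by exact: lower_env_le.
  have d0 := dens_gt0 z Tt'.
  have h3 : llr M t' z <= bu z by rewrite /llr /bu lerD2r ler_ln ?posrE.
  have h4 : bl z <= llr M t' z by rewrite /llr /bu lerD2r ler_ln ?posrE.
  have h5 : expR (llr M t' z) <= u z / fs z by rewrite uE ler_expR.
  have h6 : `|llr M t' z| <= `|bl z| + `|bu z|.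
    rewrite ler_norml; have := ler_norm (bu z); have := normr_ge0 (bu z).
    have := ler_norm (- bl z); have := normr_ge0 (bl z); rewrite normrN.
    by move=> *; apply/andP; split; lra.
  have := absq (bl z); have := absq (bu z); have := ug z; rewrite /g; lra.
- by move=> z; have := ug z; have := sqr_ge0 (bl z); have := sqr_ge0 (bu z); rewrite /g; lra.
Qed.

Lemma llr_cvg k t (tm : nat -> T) z : (1 <= k)%N -> Theta M k t ->
  (forall m, Theta M k (tm m)) ->
  (forall h : R, 0 < h -> \forall m \near \oo, dist M k t (tm m) < h) ->
  llr M (tm m) z @[m --> \oo] --> llr M t z.
Proof.
move=> k1 Tt Ttm cv; apply/cvgrPdist_lt => e e0.
have [h h0 hh] := loglik_continuous z k1 Tt e0.
near=> m; rewrite /llr opprB addrA subrK distrC; apply: hh => //.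
by near: m; exact: cv.
Unshelve. all: by end_near. Qed.

Lemma continuous_kl_fun : continuous (@kl_fun R).
Proof.
move=> x; rewrite /kl_fun.
apply: cvgB; last exact: cvg_id.
apply: cvgB; last exact: cvg_cst.
exact: continuous_expR.
Qed.

Lemma near_invSn (h : R) : 0 < h -> \forall m \near \oo, m.+1%:R^-1 < h.
Proof.
move=> h0; exists (Num.truncn h^-1) => // m /= hm.
rewrite invf_plt ?posrE//; apply: (lt_le_trans (Num.Theory.truncnS_gt _)).
by rewrite ler_nat ltnS.
Qed.

(** Dominated convergence of [kl_fun (llr M t' z)] along a sequence of counterexamples tending to
    [t]. It lets the covering of the far set ignore a neighbourhood of every zero of the
    divergence. *)
Lemma KL_small_near k t (c : R) : condA2 M -> (1 <= k)%N -> Theta M k t ->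
  KL M t = 0%E -> 0 < c ->
  exists2 h : R, 0 < h &
    forall t', Theta M k t' -> dist M k t t' < h -> (KL M t' <= c%:E)%E.
Proof.
move=> A2 k1 Tt KL0 c0; apply: contrapT => nex.
have [eta eta0 [g [ig g0 gdom _]]] := A2_dominated A2 k1 Tt.
have tmP m : exists t', [/\ Theta M k t', dist M k t t' < eta * m.+1%:R^-1 & (c%:E < KL M t')%E].
  apply: contrapT => nt; apply: nex; exists (eta * m.+1%:R^-1); first by rewrite mulr_gt0.
  move=> t' Tt' tt'; rewrite leNgt; apply/negP => ct'; apply: nt; by exists t'.
have [tm {}tmP] := choice tmP.
have tmT m : Theta M k (tm m) by have [] := tmP m.
have tmd m : dist M k t (tm m) < eta.
  have [_ + _] := tmP m; move=> /lt_le_trans; apply.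
  by rewrite ler_piMr ?(ltW eta0)// invf_le1// ler1n.
have cv z : llr M (tm m) z @[m --> \oo] --> llr M t z.
  apply: llr_cvg k1 Tt tmT _ => h h0.
  have := @near_invSn (h / eta); rewrite divr_gt0// => /(_ isT).
  apply: filterS => m mh; have [_ + _] := tmP m; move=> /lt_trans; apply.
  by rewrite mulrC -ltr_pdivlMr.
have mkl t' : Theta M k t' -> measurable_fun setT (fun z => (kl_fun (llr M t' z))%:E).
  move=> Tt'; have mll := measurable_llr Tt'.
  by apply/measurable_EFinP/measurable_funB => //; apply: measurable_funB => //; exact: measurableT_comp.
have ff : {ae Ps, forall z, setT z ->
    (fun m => (kl_fun (llr M (tm m) z))%:E) @ \oo --> (kl_fun (llr M t z))%:E}.
  apply: aeW => z _; apply: cvg_EFin; first exact: nearW.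
  exact: (cvg_comp _ _ (cv z) (@continuous_kl_fun _)).
have fg : {ae Ps, forall z m, setT z -> `|(kl_fun (llr M (tm m) z))%:E| <= (EFin \o g) z}%E.
  apply: aeW => z m _; rewrite /= lee_fin ger0_norm ?kl_fun_ge0//.
  apply: le_trans (gdom z _ (tmT m) (tmd m)); rewrite /kl_fun.
  by have := ler_norm (- llr M (tm m) z); rewrite normrN; lra.
have [_ _] := dominated_convergence measurableT (fun m => mkl _ (tmT m)) (mkl _ Tt) ff ig fg.
rewrite -(KL_E Tt) KL0 => cvK.
have : (c%:E <= limn (fun m => \int[Ps]_z (kl_fun (llr M (tm m) z))%:E))%E.
  apply: lime_ge; first by apply/cvg_ex; exists 0%E.
  by apply: nearW => m; rewrite -(KL_E (tmT m)) ltW//; have [] := tmP m.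
by rewrite (cvg_lim _ cvK)// lee_fin leNgt c0.
Qed.

(** The integral of [(expR (llr / 2) - 1) ^+ 2] is two minus twice the affinity. If the affinity
    were at least 1, the log-ratio would vanish almost everywhere, and so would the divergence. *)
Lemma hellinger_affinity_lt1 k t : Theta M k t -> (0 < KL M t)%E ->
  (\int[Ps]_z (expR (llr M t z / 2))%:E < 1)%E.
Proof.
move=> Tt; apply: contraTT; rewrite -!leNgt => I1.
have ma := measurable_llr Tt.
have me : measurable_fun setT (fun z => expR (llr M t z / 2)).
  by apply: measurableT_comp => //; exact: measurable_funM.
have me' : measurable_fun setT (fun z => expR (llr M t z)) by exact: measurableT_comp.
pose h z := (expR (llr M t z / 2) - 1) ^+ 2.
have mh : measurable_fun setT h by apply: measurable_funX; exact: measurable_funB.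
have h0 z : 0 <= h z by exact: sqr_ge0.
have : (\int[Ps]_z (2 * expR (llr M t z / 2) + h z)%:E =
    \int[Ps]_z (1 * expR (llr M t z) + 1)%:E)%E.
  apply: eq_integral => z _; congr (_%:E).
  by rewrite /h [expR (llr M t z)]expR_half2; ring.
rewrite !ge0_integral_affine//; do ?[by move=> z; exact: expR_ge0].
rewrite (integral_expR_llr Tt) integral_probability_cst mul1e => hE.
have hint0 : (\int[Ps]_z (h z)%:E = 0)%E.
  apply/eqP; rewrite eq_le integral_ge0 ?andbT; last by move=> z _; rewrite lee_fin.
  have : (2%:E * 1 + \int[Ps]_z (h z)%:E <= 2%:E)%E.
    apply: (@le_trans _ _ (1 + 1)%E); last by rewrite -EFinD lee_fin; lra.
    by rewrite -hE leeD2r// lee_wpmul2l// lee_fin.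
  rewrite mule1; case: (\int[Ps]_z (h z)%:E)%E => [r| |]//.
  by rewrite -EFinD !lee_fin; lra.
have /ae_eq_integral_abs : (\int[Ps]_z `|(h z)%:E| = 0)%E.
  by rewrite -hint0; apply: eq_integral => z _; rewrite gee0_abs// lee_fin.
move=> /(_ measurableT); have mhE : measurable_fun setT (EFin \o h) by exact/measurable_EFinP.
move=> /(_ mhE) hae.
rewrite (KL_E Tt).
suff -> : (\int[Ps]_z (kl_fun (llr M t z))%:E = \int[Ps]_z (cst 0 z))%E by rewrite integral0.
apply: ge0_ae_eq_integral => //.
- by apply/measurable_EFinP/measurable_funB => //; exact: measurable_funB.
- by move=> z _; rewrite lee_fin kl_fun_ge0.
apply: filterS hae => z /(_ I) /= []; rewrite /h => /eqP; rewrite sqrf_eq0 subr_eq0 => /eqP e1 _.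
have : llr M t z / 2 = 0 by apply: expR_inj; rewrite e1 expR0.
move=> /eqP; rewrite mulf_eq0 invr_eq0 pnatr_eq0 orbF => /eqP ->.
by rewrite /kl_fun expR0 !subrr.
Qed.

(** As the radius shrinks, the upper envelope tends pointwise to the density at [t]. The affinities
    converge by domination, since a square root is at most one plus its argument, and the limit is
    less than 1. *)
Lemma upper_env_affinity_near k t : condA2 M -> (1 <= k)%N -> Theta M k t ->
  (0 < KL M t)%E ->
  exists2 h : R, 0 < h &
    (\int[Ps]_z (expR ((ln (upper_env M k t h z) - ln (fs z)) / 2))%:E < 1)%E.
Proof.
move=> A2 k1 Tt KL0.
have [eta eta0 [g [ig g0 _ gdom]]] := A2_dominated A2 k1 Tt.
have fs0 := dens_star_gt0 M.
pose r m := eta * m.+1%:R^-1.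
have r0 m : 0 < r m by rewrite mulr_gt0.
have reta m : r m <= eta by rewrite ler_piMr ?(ltW eta0)// invf_le1// ler1n.
pose v m := upper_env M k t (r m).
have tv m z : dens M t z <= v m z by apply: upper_env_ge; rewrite ?distxx.
have v0 m z : 0 < v m z by exact: lt_le_trans (dens_gt0 z Tt) (tv m z).
have vu m z : v m z <= upper_env M k t eta z.
  rewrite leNgt; apply/negP => /(upper_env_gt_exists k1 Tt (r0 m))[t' [Tt' tt']].
  rewrite ltNge => /negP; apply; apply: upper_env_ge => //.
  exact: lt_le_trans tt' (reta m).
have mb m : measurable_fun setT (fun z => ln (v m z) - ln (fs z)).
  apply: measurable_funB; apply: measurableT_comp => //; first exact: measurable_upper_env.
  exact: measurable_dens_star.
have cv z : ln (v m z) @[m --> \oo] --> ln (dens M t z).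
  apply/cvgrPdist_le => e e0.
  have [h h0 hh] := loglik_continuous z k1 Tt e0.
  have := @near_invSn (h / eta); rewrite divr_gt0// => /(_ isT).
  apply: filterS => m mh.
  have rh : r m < h by rewrite /r mulrC -ltr_pdivlMr.
  have l1 : ln (dens M t z) <= ln (v m z).
    by rewrite ler_ln ?posrE//; exact: dens_gt0 Tt.
  rewrite ler0_norm ?subr_le0// opprB lerBlDr.
  rewrite -ler_expR expRD lnK ?posrE// leNgt; apply/negP.
  move=> /(upper_env_gt_exists k1 Tt (r0 m))[t' [Tt' tt']].
  rewrite -expRD -[X in _ < X]lnK ?posrE ?(dens_gt0 z Tt')// ltr_expR => h1.
  have := hh _ Tt' (lt_trans tt' rh); rewrite ltr_norml => /andP[_]; lra.
pose F m z := (expR ((ln (v m z) - ln (fs z)) / 2))%:E.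
have mF m : measurable_fun setT (F m).
  by apply/measurable_EFinP; apply: measurableT_comp => //; exact: measurable_funM.
have mf : measurable_fun setT (fun z => (expR (llr M t z / 2))%:E).
  apply/measurable_EFinP; apply: measurableT_comp => //; apply: measurable_funM => //.
  exact: measurable_llr Tt.
have ff : {ae Ps, forall z, setT z -> F ^~ z @ \oo --> (expR (llr M t z / 2))%:E}.
  apply: aeW => z _; apply: cvg_EFin; first exact: nearW.
  apply: (@cvg_comp _ _ _ (fun m => (ln (v m z) - ln (fs z)) / 2) expR); last exact: continuous_expR.
  by apply: cvgMl; apply: cvgB => //; exact: cvg_cst.
have ig1 : Ps.-integrable setT (EFin \o (fun z => 1 + g z)).
  have -> : EFin \o (fun z => 1 + g z) = (cst 1%:E \+ (EFin \o g))%E by [].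
  by apply: integrableD => //; exact: finite_measure_integrable_cst.
have fg : {ae Ps, forall z m, setT z -> `|F m z| <= (EFin \o (fun y => (1 + g y)%R)) z}%E.
  apply: aeW => z m _; rewrite /= lee_fin ger0_norm ?expR_ge0//.
  have h1 : expR (ln (v m z) - ln (fs z)) <= g z.
    rewrite expRB !lnK ?posrE//; apply: le_trans (gdom z).
    by rewrite ler_pM2r ?invr_gt0.
  apply: (@le_trans _ _ (1 + expR (ln (v m z) - ln (fs z)))); last by rewrite lerD2l.
  rewrite [in leRHS]expR_half2; set x := expR _.
  by have := sqr_ge0 (x - 1 / 2); nra.
have [_ _] := dominated_convergence measurableT mF mf ff ig1 fg.
move=> cvI; apply: contrapT => nex.
have : (1 <= limn (fun m => \int[Ps]_z F m z))%E.
  apply: lime_ge; first by apply/cvg_ex; eexists; exact: cvI.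
  apply: nearW => m; rewrite leNgt; apply/negP => Fm; apply: nex.
  by exists (r m).
by rewrite (cvg_lim _ cvI)// leNgt (hellinger_affinity_lt1 Tt KL0).
Qed.

Lemma expR_loglik_ratio n t (z : n.-tuple Z) :
  expR (loglik_n M t z - loglik_star_n M z) = \prod_(i < n) expR (llr M t (tnth z i)).
Proof.
by rewrite -expR_sum /loglik_n /loglik_star_n -sumrB.
Qed.

Lemma likelihood_ratio_far_event k (c : R) : condA2 M -> (1 <= k)%N -> 0 < c ->
  exists rho C : R, [/\ 0 < rho < 1, 0 <= C & forall n, exists E : set (n.-tuple Z),
    [/\ measurable E, (law_star_n M E <= (C * rho ^+ n)%:E)%E &
      forall t, Theta M k t -> (c%:E < KL M t)%E -> forall z, ~ E z ->
        expR (loglik_n M t z - loglik_star_n M z) <= rho ^+ n]].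
Proof.
move=> A2 k1 c0.
pose A (B : set T) := exists rho C : R,
  [/\ 0 < rho < 1, 0 <= C & forall n, exists E : set (n.-tuple Z),
    [/\ measurable E, (law_star_n M E <= (C * rho ^+ n)%:E)%E &
      forall t, B t -> (c%:E < KL M t)%E -> forall z, ~ E z ->
        expR (loglik_n M t z - loglik_star_n M z) <= rho ^+ n]].
apply: (@Theta_compact_dist_ind _ _ _ _ _ _ M k A) => //.
- exists (1 / 2), 0; split=> //; first by apply/andP; split; lra.
  by move=> n; exists set0; split=> //; rewrite /law_star_n measure0 lee_fin mul0r.
- move=> B B' [rho [C [rho01 C0 hB']]] BB'; exists rho, C; split=> // n.
  have [E [mE PE hE]] := hB' n; exists E; split=> // t /BB'; exact: hE.
- move=> B B' [r1 [C1 [/andP[r10 r11] C10 h1]]] [r2 [C2 [/andP[r20 r21] C20 h2]]].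
  exists (Num.max r1 r2), (C1 + C2); split.
  + by rewrite lt_max r10/= gt_max r11.
  + exact: addr_ge0.
  move=> n; have [E1 [mE1 PE1 hE1]] := h1 n; have [E2 [mE2 PE2 hE2]] := h2 n.
  have le1 : r1 ^+ n <= Num.max r1 r2 ^+ n.
    by rewrite lerXn2r ?nnegrE ?le_max ?lexx ?(ltW r10)// ltW.
  have le2 : r2 ^+ n <= Num.max r1 r2 ^+ n.
    by rewrite lerXn2r ?nnegrE ?le_max ?lexx ?orbT ?(ltW r20)// ltW.
  exists (E1 `|` E2); split.
  + exact: measurableU.
  + apply: (le_trans (measureU2 (tuple_measure Ps n) mE1 mE2)).
    rewrite mulrDl EFinD; apply: leeD.
      by apply: (le_trans PE1); rewrite lee_fin ler_wpM2l.
    by apply: (le_trans PE2); rewrite lee_fin ler_wpM2l.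
  + move=> t [Bt|Bt] KLt z nE.
      by apply: le_trans le1; apply: hE1 => // E1z; apply: nE; left.
    by apply: le_trans le2; apply: hE2 => // E2z; apply: nE; right.
(* Around a zero of [KL] the ball is taken inside [{KL <= c}]: no parameter of it is concerned, and
   the empty event suffices. *)
- move=> t Tt; have [KL0|KL0] := eqVneq (KL M t) 0%E.
    have [h h0 hh] := KL_small_near A2 k1 Tt KL0 c0.
    exists h => //; exists (1 / 2), 0; split=> //; first by apply/andP; split; lra.
    move=> n; exists set0; split=> //; first by rewrite /law_star_n measure0 lee_fin mul0r.
    by move=> t' [Tt' tt']; rewrite ltNge hh.
  have KLp : (0 < KL M t)%E by rewrite lt0e KL0 (KL_ge0 Tt).
  have [h h0] := upper_env_affinity_near A2 k1 Tt KLp.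
  set u := upper_env M k t h.
  pose b z := (ln (u z) - ln (fs z)) / 2.
  rewrite -/(b _) => Ib; exists h => //.
  have mu_ : measurable_fun setT u by exact: measurable_upper_env.
  have mb : measurable_fun setT b.
    apply: measurable_funM => //; apply: measurable_funB; apply: measurableT_comp => //.
    exact: measurable_dens_star.
  have fs0 := dens_star_gt0 M.
  have u0 z : 0 < u z.
    by apply: (lt_le_trans (dens_gt0 z Tt)); apply: upper_env_ge; rewrite ?distxx.
  have I0 : (0 <= \int[Ps]_z (expR (b z))%:E)%E.
    by apply: integral_ge0 => z _; rewrite lee_fin expR_ge0.
  have Ifin : (\int[Ps]_z (expR (b z))%:E)%E \is a fin_num.
    by rewrite ge0_fin_numE// (lt_trans Ib)// ltry.
  set I := (\int[Ps]_z (expR (b z))%:E)%E in Ib I0 Ifin.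
  pose r0 := fine I; have IE : I = r0%:E by rewrite fineK.
  have r01 : r0 < 1 by rewrite -lte_fin -IE.
  have r00 : 0 <= r0 by rewrite -lee_fin -IE.
  (* Between the affinity and 1, with [r0 <= rho ^+ 2]: Markov's inequality at level [rho ^+ n] for
     the product of the square roots then gives [r0 ^+ n / rho ^+ n <= rho ^+ n]. Squaring the
     product bounds the likelihood ratio itself. *)
  pose rho := (1 + r0) / 2.
  have rho0 : 0 < rho by rewrite /rho; lra.
  have rho1 : rho < 1 by rewrite /rho; lra.
  have rr : r0 <= rho ^+ 2 by rewrite /rho; have := sqr_ge0 (1 - r0); nra.
  exists rho, 1; split=> //; first by rewrite rho0.
  move=> n; exists [set z : n.-tuple Z | rho ^+ n <= \prod_(i < n) expR (b (tnth z i))].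
  have me : measurable_fun setT (fun z => expR (b z)) by exact: measurableT_comp.
  have rn0 : 0 < rho ^+ n by rewrite exprn_gt0.
  split.
  + exact: measurable_ge (measurable_tuple_prod me).
  + have := @tuple_chernoff _ _ _ Ps n (fun z => expR (b z)) r0 _ rn0 me (fun z => expR_ge0 _).
    rewrite -/I IE => /(_ (lexx _))/le_trans; apply.
    rewrite lee_fin mul1r mulrC ler_pdivrMr//.
    by rewrite -exprMn -expr2 lerXn2r ?nnegrE// exprn_ge0// ltW.
  + move=> t' [Tt' tt'] _ z /= /negP; rewrite -ltNge => hz.
    rewrite expR_loglik_ratio.
    apply: (@le_trans _ _ ((\prod_(i < n) expR (b (tnth z i))) ^+ 2)).
      rewrite -prodrXl; apply: ler_prod => i _; rewrite expR_ge0/=.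
      rewrite /b -expR_half2 ler_expR /llr lerD2r ler_ln ?posrE ?(dens_gt0 _ Tt')//.
      exact: upper_env_ge.
    apply: (@le_trans _ _ ((rho ^+ n) ^+ 2)).
      by rewrite lerXn2r ?nnegrE ?(ltW rn0)// ?(ltW hz)// prodr_ge0// => i _; exact: expR_ge0.
    by rewrite expr2 ler_piMl ?(ltW rn0)// exprn_ile1 ?ltW.
Qed.

End likelihood_ratio_far.

(** * Entropy brackets *)

(** No measurability is required, since the integral of a nonnegative function is a supremum over
    the simple functions below it. The bracket conditions can thus be used without discussing the
    measurability of extended logarithms. *)
Lemma ge0_le_integral_setT d (Z : measurableType d) (R : realType)
    (m : {measure set Z -> \bar R}) (f g : Z -> \bar R) :
  (forall z, 0 <= f z)%E -> (forall z, f z <= g z)%E ->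
  (\int[m]_z f z <= \int[m]_z g z)%E.
Proof.
move=> f0 fg; rewrite !ge0_integralTE//; last first.
  by move=> z; exact: le_trans (f0 z) (fg z).
apply: ereal_sup_le => _ [h hf <-]; exists h => // z.
exact: le_trans (hf z) (fg z).
Qed.

Section brackets.
Context {R : realType} {d : measure_display} {Z : measurableType d}.
Context (mu : {measure set Z -> \bar R}).
Context {dT : measure_display} (T : measurableType dT) (M : model mu T).

Local Notation Ps := (law_star M).
Local Notation fs := (dens_star M).

(** A single parameter [t] in the bracket, with divergence and [q] under control, governs the moment
    generating function of the upper end. The event depends on [u] only, hence serves every other
    parameter of the bracket. *)
Lemma bracket_chernoff k t (alpha Mc eps : R) (l u : Z -> R) n :
  Theta M k t -> is_bracket M (eps / 4) l u -> bracket l u (dens M t) ->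
  0 < alpha -> 1 <= Mc -> 0 < eps -> 6 <= - ln eps ->
  (eps%:E <= KL M t <= (2 * eps)%:E)%E -> (q M t alpha <= Mc%:E)%E ->
  let CL := (C1 alpha Mc + 2) * ln eps ^+ 2 in
  exists E : set (n.-tuple Z), [/\ measurable E,
    (law_star_n M E <= (expR (- (n%:R * eps / (32 * CL))))%:E)%E &
    forall t', Theta M k t' -> bracket l u (dens M t') -> forall z, ~ E z ->
      expR (loglik_n M t' z - loglik_star_n M z) <= expR (- (n%:R * eps / 8))].
Proof.
move=> Tt [[lu [l0 il] [u0_ iu]] [iul iulsq _ _]] tlu al0 Mc1 e0 L6 /andP[KL1 KL2] qM CL.
have f0 z := dens_gt0 z Tt.
have fs0 := dens_star_gt0 M; have mfs := measurable_dens_star M.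
have u0 z : 0 < u z by case/andP: (tlu z) => _; exact: lt_le_trans.
have lf z : l z <= dens M t z by case/andP: (tlu z).
have fu z : dens M t z <= u z by case/andP: (tlu z).
have mu_ : measurable_fun setT u by apply/measurable_EFinP; case/integrableP: iu.
have ml : measurable_fun setT l by apply/measurable_EFinP; case/integrableP: il.
have mf := dens_measurable Tt.
pose b z := ln (u z) - ln (fs z).
have mb : measurable_fun setT b.
  by apply: measurable_funB; apply: measurableT_comp.
have ma := measurable_llr Tt.
have ab z : llr M t z <= b z by rewrite /llr /b lerD2r ler_ln ?posrE.
have bE z : expR (b z) = u z / fs z by rewrite /b expRB !lnK ?posrE.
pose H := fine (KL M t).
have KLfin : KL M t \is a fin_num.
  by rewrite ge0_fin_numE ?(KL_ge0 Tt)// (le_lt_trans KL2)// ltry.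
have He : eps <= H <= 2 * eps.
  by rewrite /H -!lee_fin fineK// KL1.
have Eg : (\int[Ps]_z (kl_fun (llr M t z))%:E = H%:E)%E by rewrite -(KL_E Tt) fineK.
have Eh : (\int[Ps]_z (llr M t z ^+ 2 * expR (- alpha * llr M t z))%:E <= Mc%:E)%E.
  apply: le_trans qM; rewrite /q.
  have -> : (\int[Ps]_z (llr M t z ^+ 2 * expR (- alpha * llr M t z))%:E =
     \int[Ps]_z ((loglik_star M z - loglik M t z) ^+ 2 *
                     expR (alpha * (loglik_star M z - loglik M t z)))%:E)%E.
    apply: eq_integral => z _; congr (_%:E).
    by rewrite /llr -sqrrN opprB; congr (_ * expR _); ring.
  by rewrite leeDl// V_ge0// => z; rewrite ltW.
have Ew : (\int[Ps]_z ((b z - llr M t z) ^+ 2)%:E <= (eps ^+ 2 / 16)%:E)%E.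
  rewrite (_ : eps ^+ 2 / 16 = (eps / 4) ^+ 2); last by field.
  apply: le_trans iulsq; apply: ge0_le_integral_setT => z.
    by rewrite lee_fin sqr_ge0.
  rewrite /elog [lne (u z)%:E]lne_EFin//.
  (* The lower end may vanish; its extended logarithm is then [-oo] and the integrand of the bracket
     condition is infinite, so the comparison is trivial there. *)
  have [lz0|lz0] := leP (l z) 0.
    rewrite (le0_lneNy (x := (l z)%:E)) ?lee_fin//.
    have -> : ((ln (u z))%:E - -oo = +oo)%E by [].
    by rewrite expe2 mulyy leey.
  rewrite lne_EFin// -EFinB -EFin_expe lee_fin lerXn2r ?nnegrE ?subr_ge0 ?ler_ln ?posrE//.
  rewrite /b /llr /loglik_star /loglik opprB addrA subrK lerD2l lerN2 ler_ln ?posrE//.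
have Ed : (\int[Ps]_z (expR (b z) - expR (llr M t z))%:E <= (eps / 4)%:E)%E.
  have -> : (\int[Ps]_z (expR (b z) - expR (llr M t z))%:E =
      \int[Ps]_z ((u z - dens M t z) / fs z)%:E)%E.
    by apply: eq_integral => z _; rewrite bE (expR_llr _ Tt) mulrBl.
  rewrite integral_law_star_ratio; last 2 first.
  - exact: measurable_funB.
  - by move=> z; rewrite subr_ge0.
  apply: le_trans iul; apply: ge0_le_integral_setT => z; rewrite lee_fin ?subr_ge0//.
  by rewrite lerD2l lerN2.
have := bracket_mgf ma mb ab al0 Mc1 e0 L6 He (integral_expR_llr Tt) Eg Eh Ew Ed erefl.
rewrite -/CL => mgf.
have C10 := C1_ge0 alpha Mc.
have CL0 : 0 < CL.
  rewrite /CL mulr_gt0// ?exprn_even_gt0//=; first lra.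
  by rewrite lt_eqF//; lra.
pose lam := (8 * CL)^-1.
have lam0 : 0 < lam by rewrite /lam invr_gt0 mulr_gt0.
(* The level costs [lam / 8 = 1 / (64 CL)] in the exponent per unit of [n eps]; subtracted from the
   [3 / (64 CL)] of [bracket_mgf], it leaves [1 / (32 CL)]. *)
pose thr := expR (- (lam * (n%:R * eps / 8))).
have me : measurable_fun setT (fun z => expR (lam * b z)).
  by apply: measurableT_comp => //; exact: measurable_funM.
exists [set z : n.-tuple Z | thr <= \prod_(i < n) expR (lam * b (tnth z i))]; split.
- exact: measurable_ge (measurable_tuple_prod me).
- have := @tuple_chernoff _ _ _ Ps n _ _ thr (expR_gt0 _) me (fun z => expR_ge0 _) mgf.
  move=> /le_trans; apply; rewrite lee_fin /thr -expRN opprK -expRM_natl -expRD ler_expR.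
  rewrite /lam le_eqVlt; apply/orP; left; apply/eqP; field.
  by rewrite gt_eqF.
- move=> t' Tt' tlu' z /= /negP; rewrite -ltNge -expR_sum ltr_expR -mulr_sumr -mulrN ltr_pM2l// => hz.
  rewrite ler_expR; apply: le_trans (ltW hz).
  rewrite /loglik_n /loglik_star_n -sumrB; apply: ler_sum => i _.
  rewrite /b lerD2r ler_ln ?posrE ?(dens_gt0 _ Tt')//.
  by case/andP: (tlu' (tnth z i)).
Qed.

(** The factor 2 gives a strict inequality above the infimum that defines the bracketing number,
    hence an actual finite family. *)
Lemma entropy_brackets (A : set T) (eps x : R) : 0 <= x -> (entropy M A eps <= x%:E)%E ->
  exists N, N%:R <= 2 * expR x /\ exists l u : 'I_N -> Z -> R,
    (forall i, is_bracket M eps (l i) (u i)) /\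
    (forall t, A t -> exists i, bracket (l i) (u i) (dens M t)).
Proof.
move=> x0; rewrite /entropy -lee_expeR.
rewrite lneK; last first.
  rewrite in_itv/= leey andbT; apply: le_ereal_inf_tmp => _ [N _ <-].
  by rewrite lee_fin.
move=> hN.
have : (bracketing_number M [set dens M t | t in A] eps < (2 * expR x)%:E)%E.
  apply: (le_lt_trans hN); rewrite lte_fin.
  by have := expR_gt0 x; lra.
move=> /ereal_inf_lt[_ [N [l [u [h1 h2]]] <-]]; rewrite lte_fin => hN'.
exists N; split; first exact: ltW.
exists l, u; split=> // t At; apply: h2; by exists t.
Qed.

(** A union bound over the brackets. A bracket without a parameter of [A] has nothing to certify it
    in [bracket_chernoff], and receives the empty event. *)
Lemma bracketed_chernoff k (A : set T) (alpha Mc eps x : R) n :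
  (forall t, A t -> [/\ Theta M k t, (eps%:E <= KL M t <= (2 * eps)%:E)%E &
    (q M t alpha <= Mc%:E)%E]) ->
  0 < alpha -> 1 <= Mc -> 0 < eps -> 6 <= - ln eps -> 0 <= x ->
  (entropy M A (eps / 4) <= x%:E)%E ->
  let CL := (C1 alpha Mc + 2) * ln eps ^+ 2 in
  exists E : set (n.-tuple Z), [/\ measurable E,
    (law_star_n M E <= (2 * expR (x - n%:R * eps / (32 * CL)))%:E)%E &
    forall t, A t -> forall z, ~ E z ->
      expR (loglik_n M t z - loglik_star_n M z) <= expR (- (n%:R * eps / 8))].
Proof.
move=> hA al0 Mc1 e0 L6 x0 /(entropy_brackets x0)[N [Nx [l [u [hlu cov]]]]] CL.
pose pr := expR (- (n%:R * eps / (32 * CL))).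
have Ei (i : 'I_N) : exists E : set (n.-tuple Z), [/\ measurable E,
    (law_star_n M E <= pr%:E)%E &
    forall t, A t -> bracket (l i) (u i) (dens M t) -> forall z, ~ E z ->
      expR (loglik_n M t z - loglik_star_n M z) <= expR (- (n%:R * eps / 8))].
  have [[t [At tlu]]|nt] := pselect (exists t, A t /\ bracket (l i) (u i) (dens M t)).
    have [Tt KLt qt] := hA t At.
    have [E [mE PE hE]] := bracket_chernoff n Tt (hlu i) tlu al0 Mc1 e0 L6 KLt qt.
    by exists E; split=> // t' At'; apply: hE; have [] := hA t' At'.
  exists set0; split=> //; first by rewrite /law_star_n measure0 lee_fin expR_ge0.
  by move=> t At tlu; exfalso; apply: nt; exists t.
have [E hE] := choice Ei.
have mE i : measurable (E i) by have [] := hE i.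
exists (\big[setU/set0]_(i < N) E i); split.
- exact: bigsetU_measurable.
- apply: (@le_trans _ _ (\sum_(i < N) law_star_n M (E i))%E).
    exact: (@measure_bigsetU_le _ _ _ (tuple_measure Ps n)).
  apply: (@le_trans _ _ (\sum_(i < N) pr%:E)%E).
    by apply: lee_sum => i _; have [] := hE i.
  have -> : 2 * expR (x - n%:R * eps / (32 * CL)) = 2 * expR x * pr.
    by rewrite expRD mulrA.
  by rewrite sumEFin lee_fin sumr_const card_ord -[leLHS]mulr_natl ler_wpM2r// expR_ge0.
- move=> t At z nE; have [i ti] := cov t At.
  have [_ _ h] := hE i; apply: h => // Eiz; apply: nE.
  by rewrite (bigD1 i)//=; left.
Qed.

End brackets.

(** * Elementary asymptotics in the logarithm of the sample size *)

Section asymptotics.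
Context {R : realType}.
Implicit Types a b c X : R.

Lemma near_ln_ge X : \forall n \near \oo, X <= ln (n%:R : R).
Proof.
exists (Num.truncn (expR X)).+1 => // n /= hn.
rewrite -ler_expR lnK ?posrE ?ltr0n; last exact: leq_trans hn.
by apply: le_trans (ltW (Num.Theory.truncnS_gt _)) _; rewrite ler_nat.
Qed.

Lemma near_ln_sqr_ge a b c : 0 < a ->
  \forall n \near \oo, b * ln (n%:R : R) + c <= a * ln (n%:R : R) ^+ 2.
Proof.
move=> a0; apply: filterS2 (near_ln_ge 1) (near_ln_ge ((`|b| + `|c|) / a)) => n.
move: (ln _) => x x1; rewrite ler_pdivrMr// => hx.
have h1 : b * x + c <= (`|b| + `|c|) * x.
  rewrite mulrDl lerD//; first by rewrite ler_wpM2r ?ler_norm//; lra.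
  by apply: le_trans (ler_norm _) _; rewrite ler_peMr.
by apply: (le_trans h1); rewrite expr2 mulrA ler_wpM2r//; lra.
Qed.

Lemma near_delta_n_le (delta1 c : R) : 0 <= delta1 -> 0 < c ->
  \forall n \near \oo, delta_n delta1 n <= c.
Proof.
move=> d0 c0; near=> n.
have n1 : (1 <= n)%N by near: n; exists 1%N.
have n0 : 0 < n%:R :> R by rewrite ltr0n.
have x1 : 1 <= ln (n%:R : R) by near: n; exact: near_ln_ge.
(* Here [256 = 4 ^ 4]: with [n = expR x], the bound [(x / 4) ^+ 4 <= expR x] supplies one more power
   of [x] than the cube in [delta_n]. *)
have xc : 256 * delta1 / c <= ln (n%:R : R) by near: n; exact: near_ln_ge.
rewrite /delta_n -mulrA mulrCA mulrC ler_pdivrMr//.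
have nE : n%:R = expR (ln (n%:R : R)) by rewrite lnK.
rewrite [in leRHS]nE; move: (ln _) x1 xc => x x1; rewrite ler_pdivrMr// => xc.
have e4 : (x / 4) ^+ 4 <= expR x.
  have -> : expR x = expR (x / 4) ^+ 4 by rewrite -expRM_natl; congr expR; field.
  rewrite lerXn2r ?nnegrE ?expR_ge0 ?divr_ge0//; [lra|].
  by have := expR_ge1Dx (x / 4); lra.
have x30 : 0 <= x ^+ 3 by rewrite exprn_ge0//; lra.
have : delta1 * x ^+ 3 <= c * (x / 4) ^+ 4.
  have -> : c * (x / 4) ^+ 4 = c / 256 * x * x ^+ 3 by field.
  rewrite ler_wpM2r//; lra.
by move=> /le_trans; apply; rewrite ler_wpM2l// ltW.
Unshelve. all: by end_near. Qed.

Lemma geometric_sum_le (y : R) J : 0 <= y <= 1 / 2 ->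
  \sum_(j < J) y ^+ j.+1 <= 2 * y.
Proof.
move=> /andP[y0 y2]; elim: J => [|J IH]; first by rewrite big_ord0; lra.
rewrite big_ord_recl /=.
under eq_bigr do rewrite /bump /= add1n exprS.
rewrite -mulr_sumr expr1; nra.
Qed.

End asymptotics.

(** * Shells of small divergence *)

Section likelihood_ratio_shells.
Context {R : realType} {d : measure_display} {Z : measurableType d}.
Context (mu : {measure set Z -> \bar R}).
Context {dT : measure_display} (T : measurableType dT) (M : model mu T).

Lemma likelihood_ratio_shells_event k (alpha Mc dbar delta0 delta1 s D : R) (F : nat -> set T) n0 :
  (kstar M < k)%N -> 0 < alpha -> 1 <= Mc -> 0 < dbar ->
  (ereal_sup [set q M t alpha | t in S_set M k dbar] <= Mc%:E)%E ->
  0 < delta0 -> 0 < s -> 0 < D ->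
  128 * (1 + s) * (C1 alpha Mc + 2) * D <= delta1 ->
  (forall n (j : nat), (n0 <= n)%N -> delta_n delta1 n < delta0 -> (1 <= j)%N ->
     j%:Z <= strict_floor (delta0 / delta_n delta1 n) ->
     (entropy M (F n `&` (S_set M k (2 * (j%:R + 1) * delta_n delta1 n) `\`
                          S_set M k (2 * j%:R * delta_n delta1 n)))
        (j%:R * delta_n delta1 n / 4)
      <= (s / (1 + s) * (n%:R * j%:R * delta_n delta1 n /
          (64 * (C1 alpha Mc + 2) * ln (j%:R * delta_n delta1 n) ^+ 2)))%:E)%E) ->
  exists2 c0 : R, 0 < c0 & \forall n \near \oo, exists E : set (n.-tuple Z),
    [/\ measurable E, (law_star_n M E <= (4 * expR (- (D / 2 * ln n%:R)))%:E)%E &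
      forall t, F n t -> Theta M k t -> ((delta_n delta1 n)%:E < KL M t <= c0%:E)%E ->
        forall z, ~ E z ->
        expR (loglik_n M t z - loglik_star_n M z) <= expR (- (delta1 * ln n%:R ^+ 3 / 8))].
Proof.
move=> kk al0 Mc1 db0 hq d0 s0 D0 hd1 hent.
have C10 := C1_ge0 alpha Mc; set C := C1 alpha Mc + 2 in hd1 hent *.
have C2 : 2 <= C by rewrite /C; lra.
have CE : C1 alpha Mc + 2 = C by [].
clearbody C.
have d10 : 0 < delta1 by apply: lt_le_trans hd1; rewrite !mulr_gt0//; lra.
have inf0 : KL_inf M k = 0%E by apply: KL_inf0; exact: ltnW.
(* The three bounds keep [j dn] below [delta0], where the entropy hypothesis is available; [2 j dn]
   at most [dbar / 2], where (A1) applies; and [- ln (j dn)] at least 6, as [bracket_mgf]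
   requires. *)
pose c0 := Num.min (Num.min (delta0 / 2) (dbar / 4)) (expR (- 6)).
have c00 : 0 < c0 by rewrite /c0 !lt_min expR_gt0 !divr_gt0.
have c0d : c0 < delta0.
  by apply: (@le_lt_trans _ _ (delta0 / 2)); [rewrite /c0 !ge_min lexx|lra].
have c0db : c0 <= dbar / 4 by rewrite /c0 !ge_min lexx orbT.
have c06 : c0 <= expR (- 6) by rewrite /c0 ge_min lexx orbT.
exists c0 => //; near=> n.
have n1 : (1 <= n)%N by near: n; exists 1%N.
have nn0 : (n0 <= n)%N by near: n; exists n0.
have npos : 0 < n%:R :> R by rewrite ltr0n.
have x1 : 1 <= ln (n%:R : R) by near: n; exact: near_ln_ge.
have xd : 1 / delta1 <= ln n%:R by near: n; exact: near_ln_ge.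
have xD : 1 / D <= ln n%:R by near: n; exact: near_ln_ge.
have dc : delta_n delta1 n <= c0 by near: n; apply: near_delta_n_le => //; exact: ltW.
set x : R := ln n%:R in x1 xd xD *.
set dn := delta_n delta1 n in dc *.
have x00 : 0 <= x := le_trans ler01 x1.
have ndn : n%:R * dn = delta1 * x ^+ 3.
  by rewrite /dn /delta_n -/x; field; rewrite gt_eqF.
have x3 : 1 <= delta1 * x ^+ 3.
  rewrite ler_pdivrMr// in xd.
  have : 1 <= x ^+ 2 by rewrite expr_ge1//; lra.
  rewrite exprS; nra.
have dn0 : 0 < dn by rewrite -(pmulr_rgt0 _ npos) ndn; lra.
pose y := expR (- (2 * D * x)).
have y0 : 0 <= y by exact: expR_ge0.
have y2 : y <= 1 / 2.
  rewrite ler_pdivrMr// in xD.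
  rewrite /y expRN mul1r lef_pV2 ?posrE ?expR_gt0//.
  by apply: le_trans (expR_ge1Dx _); lra.
(* [S_set] halves its radius and [KL_inf] is zero here, so the set is [{j dn < KL <= (j + 1) dn}];
   as [j >= 1], it lies in [{eps <= KL <= 2 eps}] for [eps = j dn]. *)
have shell (j : nat) : (1 <= j)%N -> j%:R * dn <= c0 ->
    exists E : set (n.-tuple Z), [/\ measurable E,
    (law_star_n M E <= (2 * y ^+ j)%:E)%E &
    forall t, (F n `&` (S_set M k (2 * (j%:R + 1) * dn) `\` S_set M k (2 * j%:R * dn))) t ->
      forall z, ~ E z ->
      expR (loglik_n M t z - loglik_star_n M z) <= expR (- (n%:R * (j%:R * dn) / 8))].
  move=> j1; set eps := j%:R * dn => jc.
  have j1R : 1 <= j%:R :> R by rewrite ler1n.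
  have eps0 : 0 < eps by rewrite /eps mulr_gt0// ltr0n.
  have L6 : 6 <= - ln eps.
    rewrite lerNr -ler_expR lnK ?posrE//.
    exact: le_trans jc c06.
  (* Because [n eps >= n dn = delta1 x^3 >= 1]. Hence [ln^2 eps <= x^2], which uses up two of the
     three logarithms in [dn]. *)
  have Lx : - ln eps <= x.
    rewrite lerNl /x -lnV ?posrE// ler_ln ?posrE ?invr_gt0//.
    rewrite -(ler_pM2l npos) mulfV ?gt_eqF// /eps mulrCA ndn.
    apply: (le_trans x3); exact: ler_peMl (le_trans ler01 x3) j1R.
  pose W := n%:R * eps / (64 * C * ln eps ^+ 2).
  have L20 : 0 < ln eps ^+ 2 by rewrite exprn_even_gt0//= lt_eqF//; clear - L6 M; lra.
  have W0 : 0 <= W.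
    apply: divr_ge0; first exact: mulr_ge0 (ltW npos) (ltW eps0).
    by apply: mulr_ge0 (ltW L20); clear - C2 M; lra.
  have sle : s / (1 + s) <= 1 by rewrite ler_pdivrMr; clear - s0 M; lra.
  have s1 : 0 <= s / (1 + s) by rewrite divr_ge0 ?addr_ge0 ?(ltW s0).
  have hentj : (entropy M (F n `&` (S_set M k (2 * (j%:R + 1) * dn) `\` S_set M k (2 * j%:R * dn)))
      (eps / 4) <= (s / (1 + s) * W)%:E)%E.
    rewrite /W /eps [n%:R * _]mulrA; apply: hent => //.
      by apply: le_lt_trans c0d.
    (* With [strict_floor] the condition on [j] is the strict inequality [j < delta0 / dn]. *)
    rewrite /strict_floor lerBrDr -ltzD1 ltrD2r Num.Theory.ceil_gt_int.
    rewrite ltr_pdivlMr//; exact: le_lt_trans c0d.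
  have hA t : (F n `&` (S_set M k (2 * (j%:R + 1) * dn) `\` S_set M k (2 * j%:R * dn))) t ->
      [/\ Theta M k t, (eps%:E <= KL M t <= (2 * eps)%:E)%E & (q M t alpha <= Mc%:E)%E].
    rewrite /S_set inf0 !add0e /= => -[_ [[Tt KL2] nKL]].
    have KLup : (KL M t <= (2 * eps)%:E)%E.
      apply: le_trans KL2 _; rewrite lee_fin /eps.
      have : dn <= j%:R * dn by rewrite ler_peMl// ltW.
      by clear - M; lra.
    split=> //.
    - rewrite KLup andbT leNgt; apply/negP => KLlt; apply: nKL; split=> //.
      apply: le_trans (ltW KLlt) _; rewrite lee_fin /eps; clear - M; lra.
    - apply: le_trans hq; apply: ereal_sup_ubound; exists t => //.
      rewrite /S_set inf0 add0e; split=> //.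
      by apply: le_trans KLup _; rewrite lee_fin; clear - jc c0db M; lra.
  have [E [mE PE hE]] := bracketed_chernoff n hA al0 Mc1 eps0 L6 (mulr_ge0 s1 W0) hentj.
  exists E; split=> //; apply: le_trans PE _; rewrite lee_fin ler_wpM2l//.
  rewrite /y -expRM_natl ler_expR.
  have -> : n%:R * eps / (32 * ((C1 alpha Mc + 2) * ln eps ^+ 2)) = 2 * W.
    have lne0 : ln eps != 0 by rewrite lt_eqF//; clear - L6 M; lra.
    have C0 : C != 0 by rewrite gt_eqF//; clear - C2 M; lra.
    by rewrite CE /W; field; rewrite lne0 C0.
  have h1 : s / (1 + s) * W <= W by rewrite ler_piMl.
  have h2 : j%:R * (2 * D * x) <= W.
    have C64 : 0 < 64 * C by clear - C2 M; lra.
    rewrite /W ler_pdivlMr; last exact: mulr_gt0.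
    have -> : n%:R * eps = j%:R * (delta1 * x ^+ 3) by rewrite /eps mulrCA ndn.
    have LLx : ln eps ^+ 2 <= x ^+ 2.
      by rewrite -[ln eps ^+ 2]sqrrN lerXn2r ?nnegrE//; clear - L6 M; lra.
    rewrite -[leLHS]mulrA; apply: ler_wpM2l; first by rewrite ler0n.
    have d1C : 128 * C * D <= delta1.
      apply: le_trans hd1; rewrite -[leLHS]mulr1.
      rewrite (_ : 128 * (1 + s) * C * D = 128 * C * D * (1 + s)); last by ring.
      apply: ler_wpM2l; last by rewrite lerDl ltW.
      by apply: mulr_ge0 (ltW D0); clear - C2 M; lra.
    apply: (@le_trans _ _ (2 * D * x * (64 * C * x ^+ 2))).
      apply: ler_wpM2l; last exact: ler_wpM2l (ltW C64) _ _ LLx.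
      by apply: mulr_ge0 x00; exact: mulr_ge0 (ltW D0).
    rewrite (_ : 2 * D * x * (64 * C * x ^+ 2) = 128 * C * D * x ^+ 3); last by ring.
    by rewrite ler_wpM2r// exprn_ge0.
  by rewrite mulrN; clear - h1 h2 M; lra.
pose J := Num.truncn (c0 / dn).
have shellJ (i : 'I_J) : exists E : set (n.-tuple Z), [/\ measurable E,
    (law_star_n M E <= (2 * y ^+ i.+1)%:E)%E &
    forall t, (F n `&` (S_set M k (2 * (i.+1%:R + 1) * dn) `\` S_set M k (2 * i.+1%:R * dn))) t ->
      forall z, ~ E z ->
      expR (loglik_n M t z - loglik_star_n M z) <= expR (- (n%:R * (i.+1%:R * dn) / 8))].
  apply: shell => //; rewrite -ler_pdivlMr// -truncn_ge_nat//.
  by rewrite divr_ge0// ltW.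
have [E hE] := choice shellJ.
exists (\big[setU/set0]_(i < J) E i); split.
- by apply: bigsetU_measurable => i _; have [] := hE i.
- apply: (@le_trans _ _ (\sum_(i < J) law_star_n M (E i))%E).
    by apply: (@measure_bigsetU_le _ _ _ (tuple_measure (law_star M) n)) => i; have [] := hE i.
  apply: (@le_trans _ _ (\sum_(i < J) (2 * y ^+ i.+1)%:E)%E).
    by apply: lee_sum => i _; have [] := hE i.
  rewrite sumEFin lee_fin -mulr_sumr.
  have := @geometric_sum_le _ y J; rewrite y0 y2 => /(_ isT) h.
  have yD : y <= expR (- (D / 2 * x)).
    rewrite /y ler_expR lerN2 ler_wpM2r//.
    by clear - D0 M; lra.
  by clear - h yD M; lra.
- move=> t Ft Tt /andP[KL1 KL2] z nE.
  have KLfin : KL M t \is a fin_num.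
    by rewrite ge0_fin_numE ?(KL_ge0 Tt)// (le_lt_trans KL2)// ltry.
  pose H := fine (KL M t).
  have H1 : dn < H by rewrite -lte_fin fineK.
  have H2 : H <= c0 by rewrite -lee_fin fineK.
  have exm : exists m : nat, H <= m%:R * dn.
    exists (Num.truncn (H / dn)).+1; rewrite -ler_pdivrMr//.
    exact: ltW (Num.Theory.truncnS_gt _).
  (* The least [m] with [KL <= m dn] is at least 2, as [KL > dn]. The parameter lies in the shell of
     index [m - 1], which is numbered [m - 2] among the ordinals. *)
  case: (ex_minnP exm) => m Hm mmin.
  have m2 : (1 < m)%N.
    by move: Hm; case: m {mmin} => [|[|m]]//; rewrite ?mul0r ?mul1r leNgt ?H1// (lt_trans dn0).
  have Hm1 : m.-1%:R * dn < H.
    by rewrite ltNge; apply/negP => /mmin; case: m m2 {Hm mmin} => //= m _; rewrite ltnn.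
  have mJ : (m.-2 < J)%N.
    rewrite /J Num.Theory.truncn_gt_nat.
    rewrite ler_pdivlMr//; apply: le_trans H2; apply: ltW.
    by case: m m2 Hm1 {Hm mmin} => [|[|m]].
  pose i := Ordinal mJ.
  have iE : i.+1 = m.-1 by rewrite /=; case: m m2 {Hm Hm1 mmin mJ i} => [|[|m]].
  have mE : m%:R = m.-1%:R + 1 :> R by rewrite natr1 prednK// ltnW.
  have [_ _ h] := hE i.
  apply: (@le_trans _ _ (expR (- (n%:R * (i.+1%:R * dn) / 8)))).
    apply: h.
      split=> //; rewrite /S_set inf0 !add0e; split.
        split=> //; rewrite -(fineK KLfin) lee_fin -/H iE -mE.
        by apply: (le_trans Hm); clear - M; lra.
      move=> [_]; rewrite -(fineK KLfin) lee_fin -/H iE => h'.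
      by move: Hm1; rewrite ltNge; apply/negP; rewrite negbK; apply: (le_trans h'); clear - M; lra.
    move=> Eiz; apply: nE.
    by rewrite (bigD1 i)//=; left.
  rewrite ler_expR lerN2 -/x -ndn ler_pM2r ?invr_gt0//.
  by rewrite ler_pM2l// ler_peMl ?(ltW dn0)// ler1n.
Unshelve. all: by end_near. Qed.

End likelihood_ratio_shells.

(** * Marginal likelihoods and posterior *)

Section bayes_factor.
Context {R : realType} {d : measure_display} {Z : measurableType d}.
Context (mu : {measure set Z -> \bar R}).
Context {dT : measure_display} (T : measurableType dT) (M : model mu T).
Context (Q : prior M).

Local Notation Ps := (law_star M).
Local Notation fs := (dens_star M).

Lemma prior_order_le1 k : (1 <= k)%N -> prior_order Q k <= 1.
Proof.
move=> k1; rewrite -lee_fin -(prior_order_sum1 Q).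
apply: (@le_trans _ _ (\sum_(1 <= j < k.+1) (prior_order Q j)%:E)%E).
  rewrite big_nat_recr//= leeDr// sume_ge0// => j _; rewrite lee_fin.
  exact: prior_order_ge0.
by apply: nneseries_lim_ge => j _ _; rewrite lee_fin prior_order_ge0.
Qed.

(** The likelihood ratio, extended off [Theta M k] to a positive function that is jointly measurable
    in the parameter and the sample, as Tonelli's theorem demands. *)
Definition ext_ratio k n (x : T * n.-tuple Z) : R :=
  \prod_(i < n) (ext_dens M k (x.1, tnth x.2 i) / fs (tnth x.2 i)).

Lemma ext_ratio_ge0 k n (x : T * n.-tuple Z) : 0 <= ext_ratio k x.
Proof.
by apply: prodr_ge0 => i _; rewrite divr_ge0 ?ltW ?ext_dens_gt0 ?dens_star_gt0.
Qed.

Lemma measurable_ext_ratio k n : (1 <= k)%N ->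
  measurable_fun setT (@ext_ratio k n).
Proof.
move=> k1; apply: measurable_prod => i _.
have mt : measurable_fun setT (fun x : T * n.-tuple Z => tnth x.2 i).
  by apply: (measurableT_comp (measurable_tnth i)); exact: measurable_snd.
apply: (@measurable_divf _ _ _ (fun x : T * n.-tuple Z => ext_dens M k (x.1, tnth x.2 i))
  (fun x => fs (tnth x.2 i))).
- apply: (measurableT_comp (measurable_ext_dens _ k1)).
  by apply: measurable_fun_pair => //; exact: measurable_fst.
- exact: (measurableT_comp (measurable_dens_star M)).
- by move=> x; exact: dens_star_gt0.
Qed.

Lemma ext_ratioE k n t (z : n.-tuple Z) : Theta M k t ->
  ext_ratio k (t, z) = expR (loglik_n M t z - loglik_star_n M z).
Proof.
move=> Tt; rewrite expR_loglik_ratio /ext_ratio; apply: eq_bigr => i _.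
by rewrite (expR_llr _ Tt) ext_densE.
Qed.

Lemma integral_ext_ratio k n t : Theta M k t ->
  (\int[tuple_measure Ps n]_z (ext_ratio k (t, z))%:E = 1)%E.
Proof.
move=> Tt; rewrite -[in RHS](expr1n R n).
rewrite -(@integral_tuple_measure_prod _ _ _ Ps n (fun z => expR (llr M t z)) 1).
- by apply: eq_integral => z _; rewrite ext_ratioE// expR_loglik_ratio.
- by apply: measurableT_comp => //; exact: measurable_llr Tt.
- by move=> z; exact: expR_ge0.
- exact: integral_expR_llr Tt.
Qed.

Lemma bayes_BE k n (z : n.-tuple Z) : bayes_B Q k z =
  ((prior_order Q k)%:E * \int[prior_param Q k]_(t in Theta M k) (ext_ratio k (t, z))%:E)%E.
Proof.
rewrite /bayes_B; congr (_ * _)%E; apply: eq_integral => t /[!inE] Tt.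
by rewrite ext_ratioE.
Qed.

Lemma measurable_bayes_B k n : (1 <= k)%N -> measurable_fun setT (bayes_B Q k : n.-tuple Z -> \bar R).
Proof.
move=> k1; rewrite (_ : bayes_B Q k = (fun z => (prior_order Q k)%:E *
    \int[prior_param Q k]_(t in Theta M k) (ext_ratio k (t, z))%:E)%E); last first.
  by apply/funext => z; exact: bayes_BE.
apply: measurable_funeM; apply: measurable_integral_section.
- exact: Theta_measurable.
- exact: measurable_ext_ratio.
- by move=> x; exact: ext_ratio_ge0.
Qed.

(** On [Theta M k], [KL] is a section integral of a jointly measurable nonnegative function, so its
    measurability in the parameter is part of Tonelli's theorem. *)
Lemma measurable_KL_le k (c : R) : (1 <= k)%N ->
  measurable [set t | Theta M k t /\ (KL M t <= c%:E)%E].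
Proof.
move=> k1.
pose g (x : T * Z) := (kl_fun (ln (ext_dens M k x) - ln (fs x.2)))%:E.
have mg : measurable_fun setT g.
  have ma : measurable_fun setT (fun x : T * Z => ln (ext_dens M k x) - ln (fs x.2)).
    apply: measurable_funB; apply: measurableT_comp => //.
      exact: measurable_ext_dens.
    by apply: (measurableT_comp (measurable_dens_star M)); exact: measurable_snd.
  apply/measurable_EFinP/measurable_funB => //; apply: measurable_funB => //.
  exact: measurableT_comp.
have g0 x : (0 <= g x)%E by rewrite lee_fin kl_fun_ge0.
have mF := @measurable_fun_fubini_tonelli_F _ _ _ _ _ Ps g mg g0.
rewrite (_ : [set t | _] = Theta M k `&` [set t | (fubini_F Ps g t <= c%:E)%E]).
  apply: emeasurable_fun_infty_c; first exact: Theta_measurable.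
  exact: measurable_funS mF.
have KLg t : Theta M k t -> KL M t = fubini_F Ps g t.
  move=> Tt; rewrite (KL_E Tt) /fubini_F; apply: eq_integral => z _.
  by rewrite /g /llr /loglik_star /loglik /= ext_densE.
by apply/seteqP; split => t /= [Tt h]; split => //; rewrite ?KLg// -?KLg.
Qed.

(** Each of the three parts is compared with [thr / 3]: the first two by Markov's inequality, the
    last one deterministically off [E], where it is at most [r] because the prior is a
    probability. *)
Lemma bayes_B_event k n (F : set T) (dn thr r : R) (E : set (n.-tuple Z)) :
  (1 <= k)%N -> measurable F -> F `<=` Theta M k -> 0 < thr -> r < thr / 3 -> 0 <= r ->
  measurable E ->
  (forall t, F t -> Theta M k t -> (dn%:E < KL M t)%E -> forall z, ~ E z ->
     expR (loglik_n M t z - loglik_star_n M z) <= r) ->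
  (law_star_n M [set z : n.-tuple Z | (thr%:E <= bayes_B Q k z)%E] <=
   (thr / 3)^-1%:E * (prior_param Q k (Theta M k `\` F) +
      prior_param Q k [set t | Theta M k t /\ (KL M t <= dn%:E)%E]) + law_star_n M E)%E.
Proof.
move=> k1 mF FT thr0 rthr r0 mE hE.
pose P := prior_param Q k; pose L := tuple_measure Ps n.
pose S := [set t | Theta M k t /\ (KL M t <= dn%:E)%E].
have mS : measurable S by exact: measurable_KL_le.
have mT : measurable (Theta M k) by exact: Theta_measurable.
pose A1 := Theta M k `\` F; pose A2 := F `&` S; pose A3 := F `\` S.
have mA1 : measurable A1 by exact: measurableD.
have mA2 : measurable A2 by exact: measurableI.
have mA3 : measurable A3 by exact: measurableD.
pose I A (z : n.-tuple Z) := (\int[P]_(t in A) (ext_ratio k (t, z))%:E)%E.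
have mI A : measurable A -> measurable_fun setT (I A).
  move=> mA; apply: measurable_integral_section => //; first exact: measurable_ext_ratio.
  by move=> x; exact: ext_ratio_ge0.
have I0 A (z : n.-tuple Z) : (0 <= I A z)%E by apply: integral_ge0 => t _; rewrite lee_fin ext_ratio_ge0.
have thr30 : 0 < thr / 3 by lra.
have mr (z : n.-tuple Z) : measurable_fun setT (fun t => (ext_ratio k (t, z))%:E).
  have mp : measurable_fun setT (fun t : T => (t, z)) by exact: measurable_fun_pair.
  exact/measurable_EFinP/(measurableT_comp (@measurable_ext_ratio k n k1) mp).
have Isplit (z : n.-tuple Z) : (bayes_B Q k z <= I A1 z + (I A2 z + I A3 z))%E.
  rewrite bayes_BE; apply: (@le_trans _ _ (I (Theta M k) z)).
    rewrite -[leRHS]mul1e; apply: lee_wpmul2r; first exact: I0.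
    by rewrite lee_fin prior_order_le1.
  have TE : Theta M k = A1 `|` (A2 `|` A3).
    apply/seteqP; split => [t Tt|t [[]//|[[/FT]//|[/FT]//]]].
    have [Ft|nFt] := pselect (F t); last by left.
    by right; have [St|nSt] := pselect (S t); [left|right].
  rewrite {1}/I TE ge0_integral_setU//; first rewrite ge0_integral_setU//.
  - exact: measurable_funS (mr z).
  - by move=> t _; rewrite lee_fin ext_ratio_ge0.
  - by apply/disj_setPS => t [[_ St] [_ nSt]].
  - exact: measurableU.
  - exact: measurable_funS (mr z).
  - by move=> t _; rewrite lee_fin ext_ratio_ge0.
  - by apply/disj_setPS => t [[_ nF] [[F1 _]|[F1 _]]].
pose B1 := [set z | ((thr / 3)%:E <= I A1 z)%E].
pose B2 := [set z | ((thr / 3)%:E <= I A2 z)%E].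
have mB A : measurable A -> measurable [set z | ((thr / 3)%:E <= I A z)%E].
  by move=> mA; rewrite -[X in measurable X]setTI; apply: emeasurable_fun_c_infty => //; exact: mI.
have mB1 : measurable B1 by exact: mB.
have mB2 : measurable B2 by exact: mB.
have sub : [set z : n.-tuple Z | (thr%:E <= bayes_B Q k z)%E] `<=` B1 `|` B2 `|` E.
  move=> z /= hz; apply: contrapT => nz.
  have n1 : (I A1 z < (thr / 3)%:E)%E.
    by rewrite ltNge; apply/negP => h; apply: nz; left; left.
  have n2 : (I A2 z < (thr / 3)%:E)%E.
    by rewrite ltNge; apply/negP => h; apply: nz; left; right.
  have nE : ~ E z by move=> Ez; apply: nz; right.
  have n3 : (I A3 z <= r%:E)%E.
    apply: (@le_trans _ _ (\int[P]_(t in A3) (cst r%:E t))%E).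
      apply: ge0_le_integral => //.
      - by move=> t _; rewrite lee_fin ext_ratio_ge0.
      - exact: measurable_funS (mr z).
      - move=> t [Ft nSt]; have Tt := FT t Ft.
        rewrite lee_fin ext_ratioE//; apply: hE => //.
        by rewrite ltNge; apply/negP => h; apply: nSt.
    rewrite integral_cst//; rewrite -[leRHS]mule1; apply: lee_wpmul2l; first by rewrite lee_fin.
    exact: probability_le1.
  have : (I A1 z + (I A2 z + I A3 z) < thr%:E)%E.
    rewrite (_ : thr = thr / 3 + (thr / 3 + thr / 3)); last by field.
    rewrite !EFinD; apply: lteD => //; apply: lteD => //.
    by apply: (le_lt_trans n3); rewrite lte_fin.
  by rewrite ltNge => /negP; apply; exact: le_trans hz (Isplit z).
have mB0 : measurable [set z : n.-tuple Z | (thr%:E <= bayes_B Q k z)%E].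
  by rewrite -[X in measurable X]setTI; apply: emeasurable_fun_c_infty => //; exact: measurable_bayes_B.
have mB12 : measurable (B1 `|` B2) by exact: measurableU.
apply: (@le_trans _ _ (L (B1 `|` B2 `|` E))).
  by apply: le_measure => //; rewrite inE//; exact: measurableU.
apply: (le_trans (measureU2 L mB12 mE)); apply: leeD => //.
apply: (le_trans (measureU2 L mB1 mB2)).
have c0 : (0 <= (thr / 3)^-1%:E :> \bar R)%E by rewrite lee_fin invr_ge0 ltW.
have mf A : measurable A -> A `<=` Theta M k -> (L [set z | ((thr / 3)%:E <= I A z)%E] <= (thr / 3)^-1%:E * P A)%E.
  move=> mA AT; apply: tuple_measure_markov_fubini => //; first exact: measurable_ext_ratio.
    by move=> x; exact: ext_ratio_ge0.
  by move=> t /AT Tt; rewrite integral_ext_ratio.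
rewrite ge0_muleDr//; apply: leeD.
  by apply: mf => // t [].
apply: (le_trans (mf _ mA2 _)); first by move=> t [/FT].
apply: lee_wpmul2l => //; apply: le_measure; rewrite ?inE//.
by move=> t [].
Qed.

End bayes_factor.

Section posterior.
Context {R : realType} {d : measure_display} {Z : measurableType d}.
Context (mu : {measure set Z -> \bar R}).
Context {dT : measure_display} (T : measurableType dT) (M : model mu T).
Context (Q : prior M).

Local Notation fs := (dens_star M).

Lemma nneseries_le_finite (a : nat -> \bar R) N : (forall k, (1 <= k)%N -> 0 <= a k)%E ->
  (forall k, (N < k)%N -> a k = 0%E) ->
  (\sum_(1 <= k <oo) a k <= \sum_(1 <= k < N.+1) a k)%E.
Proof.
move=> a0 aN; apply: lime_le.
  by apply: is_cvg_nneseries => k k1 _; exact: a0.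
exists N.+1 => // n /= Nn.
rewrite (big_cat_nat _ (n := N.+1))//= [X in (_ + X)%E](_ : _ = 0%E) ?adde0//.
rewrite big_nat_cond big1//.
by move=> k /andP[/andP[Nk _] _]; exact: aN.
Qed.

Lemma prior_order_kmax kmax j :
  prior_measure Q [set kt | (1 <= kt.1 <= kmax)%N /\ Theta M kt.1 kt.2] = 1%E ->
  (kmax < j)%N -> prior_order Q j = 0.
Proof.
move=> hk kj.
pose a k : \bar R := if (1 <= k <= kmax)%N then (prior_order Q k)%:E else 0%E.
have a0 k : (0 <= a k)%E by rewrite /a; case: ifP => // _; rewrite lee_fin prior_order_ge0.
have sa : (\sum_(1 <= k <oo) a k = 1)%E.
  rewrite -hk /prior_measure; apply: eq_eseriesr => k _.
  rewrite /a; case: ifP => kk.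
    rewrite (_ : [set t | _] = Theta M k).
      by rewrite prior_param_Theta ?mule1//; case/andP: kk.
    by apply/seteqP; split => t /= => [[]//|Tt]; rewrite kk.
  rewrite (_ : [set t | _] = set0) ?measure0 ?mule0//.
  by apply/seteqP; split => t //= [_ []]; rewrite kk.
have s1 : (1 <= \sum_(1 <= k < kmax.+1) (prior_order Q k)%:E :> \bar R)%E.
  rewrite -sa; apply: le_trans (@nneseries_le_finite a kmax _ _) _ => //.
    by move=> k kk; rewrite /a [(k <= _)%N]leqNgt kk andbF.
  rewrite le_eqVlt; apply/orP; left; apply/eqP; apply: eq_big_nat => k.
  by rewrite ltnS /a => ->.
have : (\sum_(1 <= k < j.+1) (prior_order Q k)%:E <= 1 :> \bar R)%E.
  rewrite -(prior_order_sum1 Q); apply: nneseries_lim_ge => k _ _.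
  by rewrite lee_fin prior_order_ge0.
rewrite (big_cat_nat _ (n := kmax.+1))//=; last exact: ltnW.
rewrite [X in (_ + X)%E]big_nat_recr//=.
have s2 : (0 <= \sum_(kmax.+1 <= k < j) (prior_order Q k)%:E :> \bar R)%E.
  by apply: sume_ge0 => k _; rewrite lee_fin prior_order_ge0.
rewrite sumEFin in s1 *; rewrite sumEFin in s2 *; rewrite -!EFinD !lee_fin in s1 s2 *.
by have := prior_order_ge0 Q j => h1 h2; apply/eqP; rewrite eq_le h1 andbT; lra.
Qed.

(** By compactness, the density at each observation is bounded above and away from zero over all of
    [Theta M k]. *)
Lemma bayes_B_bounds k n (z : n.-tuple Z) : (1 <= k)%N -> exists2 c : R, 0 < c &
  ((prior_order Q k * c)%:E <= bayes_B Q k z < +oo)%E.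
Proof.
move=> k1.
have [C C0] := choice (fun z => let: ex_intro2 C C0 h := dens_bounded M z k1 in
  ex_intro (fun C => 0 < C /\ forall t, Theta M k t -> dens M t z <= C) C (conj C0 h)).
have [c c0] := choice (fun z => let: ex_intro2 C C0 h := dens_lower_bounded M z k1 in
  ex_intro (fun C => 0 < C /\ forall t, Theta M k t -> C <= dens M t z) C (conj C0 h)).
have fs0 := dens_star_gt0 M.
have mr : measurable_fun setT (fun t => (ext_ratio M k (t, z))%:E).
  have mp : measurable_fun setT (fun t : T => (t, z)) by exact: measurable_fun_pair.
  exact/measurable_EFinP/(measurableT_comp (@measurable_ext_ratio _ _ _ _ _ _ M k n k1) mp).
have icst (r : R) : (\int[prior_param Q k]_(t in Theta M k) (cst r%:E t) = r%:E)%E.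
  rewrite integral_cst; last exact: Theta_measurable.
  by rewrite -[RHS]mule1; congr (_ * _)%E; exact: prior_param_Theta.
pose lo := \prod_(i < n) (c (tnth z i) / fs (tnth z i)).
pose up := \prod_(i < n) (C (tnth z i) / fs (tnth z i)).
exists lo; first by apply: prodr_gt0 => i _; rewrite divr_gt0//; have [] := c0 (tnth z i).
rewrite bayes_BE; apply/andP; split.
  rewrite EFinM lee_wpmul2l ?lee_fin ?prior_order_ge0//.
  rewrite -icst; apply: ge0_le_integral.
  - exact: Theta_measurable.
  - move=> t _; rewrite lee_fin; apply: prodr_ge0 => i _.
    by rewrite divr_ge0 ?ltW//; have [] := c0 (tnth z i).
  - exact: measurable_cst.
  - exact: measurable_funS mr.
  - move=> t Tt; rewrite lee_fin; apply: ler_prod => i _ /=.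
    have [h1 h2] := c0 (tnth z i).
    apply/andP; split; first by rewrite divr_ge0 ?ltW.
    by rewrite ext_densE// ler_pM2r ?invr_gt0//; exact: h2.
apply: (@le_lt_trans _ _ ((prior_order Q k)%:E * up%:E)%E); last by rewrite -EFinM ltry.
rewrite lee_wpmul2l ?lee_fin ?prior_order_ge0// -icst; apply: ge0_le_integral.
- exact: Theta_measurable.
- by move=> t _; rewrite lee_fin ext_ratio_ge0.
- exact: measurable_funS mr.
- exact: measurable_cst.
- move=> t Tt; rewrite lee_fin; apply: ler_prod => i _ /=.
  have [h1 h2] := C0 (tnth z i).
  apply/andP; split; first by rewrite divr_ge0 ?ltW ?ext_dens_gt0.
  by rewrite ext_densE// ler_pM2r ?invr_gt0//; exact: h2.
Qed.

Lemma order_weightE k n (z : n.-tuple Z) : (1 <= k)%N ->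
  order_weight Q k z = ((expR (loglik_star_n M z))%:E * bayes_B Q k z)%E.
Proof.
move=> k1; rewrite bayes_BE /order_weight muleCA; congr (_ * _)%E.
have mr : measurable_fun setT (fun t => (ext_ratio M k (t, z))%:E).
  have mp : measurable_fun setT (fun t : T => (t, z)) by exact: measurable_fun_pair.
  exact/measurable_EFinP/(measurableT_comp (@measurable_ext_ratio _ _ _ _ _ _ M k n k1) mp).
rewrite -ge0_integralZl_EFin ?expR_ge0//; last 3 first.
- exact: Theta_measurable.
- by move=> t _; rewrite lee_fin ext_ratio_ge0.
- exact: measurable_funS mr.
apply: eq_integral => t /[!inE] Tt.
by rewrite -EFinM ext_ratioE// -expRD addrC subrK.
Qed.

(** The normalizing sum is finite, having finitely many nonzero terms, and positive, some order
    having positive prior mass. Dividing by it and by the true likelihood therefore preserves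
    comparisons. *)
Lemma bayes_B_le_argmax kmax n (z : n.-tuple Z) j :
  prior_measure Q [set kt | (1 <= kt.1 <= kmax)%N /\ Theta M kt.1 kt.2] = 1%E ->
  (1 <= j)%N -> (forall k, (1 <= k)%N -> (posterior Q z k <= posterior Q z j)%E) ->
  forall k, (1 <= k)%N -> (bayes_B Q k z <= bayes_B Q j z)%E.
Proof.
move=> hk j1 hj k k1.
have e0 : (0 < (expR (loglik_star_n M z))%:E :> \bar R)%E by rewrite lte_fin expR_gt0.
pose w i := order_weight Q i z.
have w0 i : (1 <= i)%N -> (0 <= w i)%E.
  move=> i1; rewrite /w order_weightE//; have [c c0 /andP[h _]] := bayes_B_bounds z i1.
  apply: mule_ge0; first exact: ltW.
  by apply: le_trans h; rewrite lee_fin mulr_ge0 ?prior_order_ge0// ltW.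
pose S := (\sum_(1 <= i <oo) w i)%E.
have wmax i : (kmax < i)%N -> w i = 0%E.
  by move=> ki; rewrite /w /order_weight (prior_order_kmax hk ki) mul0e.
have Soo : (S < +oo)%E.
  apply: le_lt_trans (nneseries_le_finite w0 wmax) _.
  rewrite big_nat_cond; apply: lte_sum_pinfty => i /andP[/andP[i1 _] _].
  rewrite /w order_weightE//; have [c c0 /andP[_ h]] := bayes_B_bounds z i1.
  by apply: lte_mul_pinfty.
have [i [i1 pi0]] : exists i, (1 <= i)%N /\ 0 < prior_order Q i.
  apply: contrapT => np.
  have : (\sum_(1 <= i <oo) (prior_order Q i)%:E = 0 :> \bar R)%E.
    apply: eseries0 => i i1 _; congr (_%:E); apply/eqP.
    rewrite eq_le prior_order_ge0 andbT leNgt; apply/negP => h; apply: np; by exists i.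
  by rewrite prior_order_sum1 => /eqP; rewrite onee_eq0.
have S0 : (0 < S)%E.
  apply: (@lt_le_trans _ _ (w i)).
    rewrite /w order_weightE//; have [c c0 /andP[h _]] := bayes_B_bounds z i1.
    by rewrite mule_gt0//; apply: lt_le_trans h; rewrite lte_fin mulr_gt0.
  apply: (@le_trans _ _ (\sum_(1 <= l < i.+1) w l)%E).
    rewrite big_nat_recr//= leeDr// big_nat_cond sume_ge0// => l /andP[/andP[l1 _] _].
    exact: w0.
  by apply: nneseries_lim_ge => l l1 _; exact: w0.
have Sfin : S \is a fin_num by rewrite ge0_fin_numE// ltW.
have := hj k k1; rewrite /posterior -/S -/(w k) -/(w j).
rewrite -(fineK Sfin) inver.
have fS0 : 0 < fine S by rewrite fine_gt0// S0.
rewrite gt_eqF// lee_pmul2r ?lte_fin ?invr_gt0// /w !order_weightE// lee_pmul2l//.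
Qed.

End posterior.

(** * Probability that a larger order exceeds the threshold *)

Lemma powR_expR (R : realType) (a b : R) : 0 < a -> a `^ b = expR (b * ln a).
Proof. by move=> a0; rewrite /powR gt_eqF. Qed.

(** With [n = expR x >= x^2 / 4], the exponent [n ln rho] is at most a negative multiple of [x^2],
    which beats any affine function of [x]. *)
Lemma near_expn_ge (R : realType) (rho b c : R) : 0 < rho < 1 ->
  \forall n \near \oo, rho ^+ n <= expR (- (b * ln (n%:R : R) + c)).
Proof.
move=> /andP[r0 r1].
have lr : 0 < - ln rho by rewrite oppr_gt0 ln_lt0// r0.
near=> n.
have n1 : (1 <= n)%N by near: n; exists 1%N.
have h : b * ln (n%:R : R) + c <= - ln rho / 4 * ln (n%:R : R) ^+ 2.
  by near: n; apply: near_ln_sqr_ge; rewrite divr_gt0.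
have x0 : 0 <= ln (n%:R : R) by rewrite ln_ge0// ler1n.
have nE : n%:R = expR (ln (n%:R : R)) by rewrite lnK// posrE ltr0n.
have -> : rho ^+ n = expR (n%:R * ln rho) by rewrite expRM_natl lnK.
rewrite ler_expR lerNr -mulrN; apply: (le_trans h).
rewrite [in leRHS]nE; move: (ln n%:R) x0 => x x0.
have : x ^+ 2 / 4 <= expR x.
  rewrite expR_half2; have := expR_ge1Dx (x / 2) => h1.
  have : (x / 2) ^+ 2 <= expR (x / 2) ^+ 2 by rewrite lerXn2r ?nnegrE ?expR_ge0//; lra.
  by rewrite expr_div_n; lra.
nra.
Unshelve. all: by end_near. Qed.

Lemma ln_delta_n (R : realType) (delta1 : R) n : 0 < delta1 -> 0 < ln (n%:R : R) ->
  ln (delta_n delta1 n) = ln delta1 - ln n%:R + 3 * ln (ln n%:R).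
Proof.
move=> d0 x0; have npos : 0 < n%:R :> R.
  by rewrite ltNge; apply/negP => /ln0 h; rewrite h ltxx in x0.
have xi : 0 < n%:R^-1 :> R by rewrite invr_gt0.
have x3 : 0 < ln (n%:R : R) ^+ 3 by rewrite exprn_gt0.
rewrite /delta_n lnM ?posrE ?mulr_gt0// lnM ?posrE// lnV ?posrE// lnXn//.
by rewrite [in RHS]mulr_natl.
Qed.

Section order_event.
Context {R : realType} {d : measure_display} {Z : measurableType d}.
Context (mu : {measure set Z -> \bar R}).
Context {dT : measure_display} (T : measurableType dT) (M : model mu T).
Context (Q : prior M).

(** The constant of (O1) is common to all sequences, so a single value [e] is handled as the term of
    index 1 of [2 e / (n + 1)], which decreases to 0. *)
Lemma condO1_le kmax D1 : condO1 Q kmax D1 -> exists2 C2 : R, 0 < C2 &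
  forall (e : R) k, 0 < e -> (kstar M < k <= kmax)%N ->
    (prior_param Q k [set t | Theta M k t /\ (KL M t <= e%:E)%E] <= (C2 * e `^ (D1 k / 2))%:E)%E.
Proof.
move=> [_ [C2 C20 h]]; exists C2 => // e k e0 kk.
pose dl (n : nat) : R := 2 * e * n.+1%:R^-1.
have d1 : dl 1%N = e by rewrite /dl; field.
have e20 : 0 < 2 * e by rewrite mulr_gt0.
rewrite -[in leRHS]d1 -d1; apply: (h dl) => //.
  move=> m n; rewrite /dl; rewrite ler_pM2l// lef_pV2 ?posrE// ler_nat ltnS//.
rewrite (_ : 0 = 2 * e * 0); last by rewrite mulr0.
by apply: cvgMr; exact: cvg_harmonic.
Qed.

(** This is [(ln n)^(3 D1k / 2 + beta2) / n^((D1k - D2) / 2)], written as one exponential so that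
    comparisons become linear in [ln n] and [ln (ln n)]. *)
Definition rate (D1k D2 beta2 : R) (n : nat) : R :=
  expR ((3 * D1k / 2 + beta2) * ln (ln n%:R) - (D1k - D2) / 2 * ln n%:R).

Lemma bayes_B_ge_threshold_rate k kmax (alpha Mc D1 : nat -> R) (F : nat -> nat -> set T)
    (D2 beta1 beta2 delta0 delta1 s : R) n0 :
  (kstar M < k <= kmax)%N -> condA1 M alpha Mc -> condA2 M -> condO1 Q kmax D1 ->
  condO2 Q kmax D1 F -> 0 < beta1 -> 0 <= beta2 -> 0 < D2 -> D2 < D1 k ->
  0 < delta0 -> 0 < s ->
  128 * (1 + s) * (C1 (alpha k) (Mc k) + 2) * (D1 k - D2) <= delta1 ->
  (forall n (j : nat), (n0 <= n)%N -> delta_n delta1 n < delta0 -> (1 <= j)%N ->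
     j%:Z <= strict_floor (delta0 / delta_n delta1 n) ->
     (entropy M (F k n `&` (S_set M k (2 * (j%:R + 1) * delta_n delta1 n) `\`
                          S_set M k (2 * j%:R * delta_n delta1 n)))
        (j%:R * delta_n delta1 n / 4)
      <= (s / (1 + s) * (n%:R * j%:R * delta_n delta1 n /
          (64 * (C1 (alpha k) (Mc k) + 2) * ln (j%:R * delta_n delta1 n) ^+ 2)))%:E)%E) ->
  exists c : R, \forall n \near \oo,
    (law_star_n M [set z : n.-tuple Z |
       (((beta1 * ln n%:R `^ beta2 * n%:R `^ (D2 / 2))^-1)%:E <= bayes_B Q k z)%E]
     <= (c * rate (D1 k) D2 beta2 n)%:E)%E.
Proof.
move=> kk A1 A2 O1 [hFT [C3 C30 O2]] b10 b20 D20 D21 d00 s0 hd1 hent.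
have /andP[kk1 kk2] := kk.
have k1 : (1 <= k)%N by exact: leq_trans kk1.
have D0 : 0 < D1 k - D2 by rewrite subr_gt0.
have D10 : 0 < D1 k by exact: lt_trans D21.
have [al0 Mc1 [dbar db0 hq]] := A1 k k1.
have dbar_le : 0 < dbar <= dbar by rewrite db0 lexx.
have {}hq := hq dbar dbar_le.
have [c0 c00 hmid] := likelihood_ratio_shells_event kk1 al0 Mc1 db0 hq d00 s0 D0 hd1 hent.
have [rho [C [rho01 C0 hfar]]] := likelihood_ratio_far_event A2 k1 c00.
have [C2 C20 O1'] := condO1_le O1.
have C10 := C1_ge0 (alpha k) (Mc k).
have d10 : 0 < delta1.
  by apply: lt_le_trans hd1; apply: mulr_gt0 D0; apply: mulr_gt0; lra.
(* One term for each source of error: the complement of the sieve, the set of divergence at most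
   [delta_n], the event of the shells and the far event. *)
pose K := 3 * beta1 * C3 + 3 * beta1 * C2 * delta1 `^ (D1 k / 2) + 4 + C.
exists K; near=> n.
have n1 : (1 <= n)%N by near: n; exists 1%N.
have npos : 0 < n%:R :> R by rewrite ltr0n.
have x1 : 1 <= ln (n%:R : R) by near: n; exact: near_ln_ge.
have [E1 [mE1 PE1 hE1]] : exists E : set (n.-tuple Z),
    [/\ measurable E, (law_star_n M E <= (4 * expR (- ((D1 k - D2) / 2 * ln n%:R)))%:E)%E &
      forall t, F k n t -> Theta M k t -> ((delta_n delta1 n)%:E < KL M t <= c0%:E)%E ->
        forall z, ~ E z ->
        expR (loglik_n M t z - loglik_star_n M z) <= expR (- (delta1 * ln n%:R ^+ 3 / 8))].
  by near: n.
have hr1 : (beta2 + D2 / 2) * ln n%:R + (ln (3 * beta1) + 1) <= delta1 / 8 * ln n%:R ^+ 2.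
  by near: n; apply: near_ln_sqr_ge; rewrite divr_gt0.
have hr2 : rho ^+ n <= expR (- ((beta2 + D2 / 2) * ln (n%:R : R) + (ln (3 * beta1) + 1))).
  by near: n; exact: near_expn_ge.
have hr3 : rho ^+ n <= expR (- ((D1 k - D2) / 2 * ln (n%:R : R) + 0)).
  by near: n; exact: near_expn_ge.
have [E2 [mE2 PE2 hE2]] := hfar n.
have [mF FT] := hFT k n kk n1.
have {}O2 := O2 k n kk n1.
set x := ln n%:R in x1 PE1 hE1 hr1 hr2 hr3 *.
have x0 : 0 < x := lt_le_trans ltr01 x1.
set w := ln x.
have w0 : 0 <= w by exact: ln_ge0.
have wx : w <= x by rewrite ltW// ln_sublinear.
have dn0 : 0 < delta_n delta1 n.
  by rewrite /delta_n -/x; apply: mulr_gt0; rewrite ?mulr_gt0 ?invr_gt0 ?exprn_gt0.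
have {}O1' := O1' _ k dn0 kk.
set ithr := beta1 * x `^ beta2 * n%:R `^ (D2 / 2).
have ithrE : ithr = beta1 * expR (beta2 * w + D2 / 2 * x).
  by rewrite /ithr !powR_expR// -/x -/w expRD mulrA.
have ithr0 : 0 < ithr by rewrite ithrE mulr_gt0// expR_gt0.
have ithr_ub : 3 * ithr <= expR ((beta2 + D2 / 2) * x + ln (3 * beta1)).
  rewrite ithrE mulrA [in leRHS]addrC [in leRHS]expRD lnK ?posrE ?mulr_gt0//.
  rewrite ler_pM2l ?mulr_gt0// ler_expR mulrDl lerD2r.
  by rewrite ler_wpM2l.
(* A common bound for the likelihood ratios on the shells and on the far set. Replacing [x ^ beta2]
   by [n ^ beta2] places it below a third of the threshold, and the added 1 makes the inequality
   strict. *)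
pose r := expR (- ((beta2 + D2 / 2) * x + (ln (3 * beta1) + 1))).
have r0 : 0 < r := expR_gt0 _.
have rthr : r < ithr^-1 / 3.
  have i3 : 0 < ithr * 3 by rewrite mulr_gt0.
  rewrite -invfM -[r]invrK ltf_pV2 ?posrE ?invr_gt0 ?r0 ?i3//.
  rewrite mulrC; apply: (le_lt_trans ithr_ub).
  by rewrite /r -expRN opprK ltr_expR ltrD2l ltrDl.
have hE t : F k n t -> Theta M k t -> ((delta_n delta1 n)%:E < KL M t)%E ->
    forall z, ~ (E1 `|` E2) z -> expR (loglik_n M t z - loglik_star_n M z) <= r.
  move=> Ft Tt KLt z nE.
  have [KLc|KLc] := leP (KL M t) c0%:E.
    apply: (le_trans (hE1 t Ft Tt _ z _)); first by rewrite KLt KLc.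
      by move=> E1z; apply: nE; left.
    rewrite /r ler_expR lerN2; apply: (le_trans hr1).
    have : x ^+ 2 <= x ^+ 3 by rewrite [leRHS]exprS ler_peMl ?sqr_ge0.
    by move=> h; rewrite [leRHS]mulrAC ler_pM2l ?divr_gt0.
  apply: (le_trans (hE2 t Tt KLc z _)); last exact: hr2.
  by move=> E2z; apply: nE; right.
have ithrV0 : 0 < ithr^-1 by rewrite invr_gt0.
have := bayes_B_event Q k1 mF FT ithrV0 rthr (ltW r0) (measurableU _ _ mE1 mE2) hE.
move=> /le_trans; apply.
have PE : (law_star_n M (E1 `|` E2) <= (4 * expR (- ((D1 k - D2) / 2 * x)) + C * rho ^+ n)%:E)%E.
  apply: (le_trans (measureU2 (tuple_measure (law_star M) n) mE1 mE2)).
  by rewrite EFinD; exact: leeD.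
apply: (@le_trans _ _ ((ithr^-1 / 3)^-1%:E * ((C3 * n%:R `^ (- (D1 k / 2)))%:E +
    (C2 * delta_n delta1 n `^ (D1 k / 2))%:E) +
    (4 * expR (- ((D1 k - D2) / 2 * x)) + C * rho ^+ n)%:E)%E).
  apply: leeD => //; apply: lee_wpmul2l; last exact: leeD.
  by rewrite lee_fin invr_ge0 divr_ge0// ltW.
rewrite -[X in (_ * X + _)%E]EFinD -[X in (X + _)%E]EFinM -[leLHS]EFinD lee_fin.
have -> : (ithr^-1 / 3)^-1 = 3 * ithr by rewrite invfM !invrK mulrC.
pose RR := rate (D1 k) D2 beta2 n.
have RRE : RR = expR ((3 * D1 k / 2 + beta2) * w - (D1 k - D2) / 2 * x) by [].
have D15 : 0 <= 3 * D1 k / 2 by rewrite divr_ge0// mulr_ge0// ltW.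
have e1 : expR (- ((D1 k - D2) / 2 * x)) <= RR.
  by rewrite RRE ler_expR lerDr mulr_ge0// addr_ge0.
have e2 : C * rho ^+ n <= C * RR.
  by rewrite ler_wpM2l//; apply: (le_trans hr3); rewrite addr0.
have e3 : 3 * ithr * (C3 * n%:R `^ (- (D1 k / 2))) <= 3 * beta1 * C3 * RR.
  rewrite ithrE powR_expR// -/x.
  rewrite (_ : _ * _ = 3 * beta1 * C3 * (expR (beta2 * w + D2 / 2 * x) * expR (- (D1 k / 2) * x))); last by ring.
  rewrite ler_pM2l ?mulr_gt0// -expRD RRE ler_expR.
  have : 0 <= 3 * D1 k / 2 * w by rewrite mulr_ge0.
  by move=> h; clear - h M; lra.
(* The term that fixes the rate, here with equality: the cube of the logarithm in [delta_n] yields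
   the exponent [3 D1 / 2], the inverse threshold yields [beta2] and [D2 / 2]. *)
have e4 : 3 * ithr * (C2 * delta_n delta1 n `^ (D1 k / 2)) = 3 * beta1 * C2 * delta1 `^ (D1 k / 2) * RR.
  rewrite ithrE !powR_expR//.
  rewrite ln_delta_n// -/x -/w.
  rewrite (_ : _ * (_ * _) = 3 * beta1 * C2 * (expR (beta2 * w + D2 / 2 * x) *
    expR (D1 k / 2 * (ln delta1 - x + 3 * w)))); last by ring.
  rewrite -[RHS]mulrA; congr (_ * _); rewrite RRE -!expRD; congr expR.
  by field.
rewrite -/RR /K; clearbody RR ithr; clear - e1 e2 e3 e4 M.
move: (expR _) (C * _) (n%:R `^ _) (delta_n _ _ `^ _) (delta1 `^ _) e1 e2 e3 e4.
by move=> a1 a2 a3 a4 a5 e1 e2 e3 e4; lra.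
Unshelve. all: by end_near. Qed.

End order_event.

(** * Assembling the bound over the orders *)

Lemma powR_quotient_rate (R : realType) (D1k D2 beta2 : R) n : (0 < n)%N -> 0 < ln (n%:R : R) ->
  ln n%:R `^ (3 * D1k / 2 + beta2) / n%:R `^ ((D1k - D2) / 2) = rate D1k D2 beta2 n.
Proof.
by move=> n0 x0; rewrite /rate !powR_expR ?ltr0n// expRB.
Qed.

(** Some term is positive because [D2 / 2 * ln m] eventually dominates. The terms are also bounded,
    by [ln x < x], so that the real [sup] is a genuine least upper bound. *)
Lemma rate_max_gt0 (R : realType) (beta1 beta2 D2 : R) n0 : (2 <= n0)%N ->
  0 < beta1 -> 0 <= beta2 -> 0 < D2 -> 0 < rate_max beta1 beta2 D2 n0.
Proof.
move=> n02 b10 b20 D20.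
have lnE m : (2 <= m)%N -> ln (beta1 * ln m%:R `^ beta2 * m%:R `^ (D2 / 2)) =
    ln beta1 + beta2 * ln (ln m%:R) + D2 / 2 * ln m%:R.
  move=> m2; have m0 : 0 < m%:R :> R by rewrite ltr0n ltnW.
  have x0 : 0 < ln (m%:R : R) by rewrite ln_gt0// ltr1n.
  by rewrite !powR_expR// !lnM ?posrE ?mulr_gt0 ?expR_gt0// !expRK.
have [m [mn0 mpos]] : exists m, (n0 <= m)%N /\
    0 < m%:R^-1 * ln (beta1 * ln m%:R `^ beta2 * m%:R `^ (D2 / 2)).
  near \oo%classic => m; exists m.
  have mn0 : (n0 <= m)%N by near: m; exists n0.
  split=> //; have m2 : (2 <= m)%N by exact: leq_trans mn0.
  have m0 : 0 < m%:R :> R by rewrite ltr0n ltnW.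
  rewrite mulr_gt0 ?invr_gt0// lnE//.
  have x1 : 1 <= ln (m%:R : R) by near: m; exact: near_ln_ge.
  have x2 : (1 - ln beta1) / (D2 / 2) <= ln m%:R by near: m; exact: near_ln_ge.
  have D20' : 0 < D2 / 2 by lra.
  rewrite ler_pdivrMr// in x2.
  have : 0 <= beta2 * ln (ln m%:R) by rewrite mulr_ge0// ln_ge0.
  lra.
rewrite /rate_max mulr_gt0//; apply: (lt_le_trans mpos).
apply: ub_le_sup; last by exists m.
exists (`|ln beta1| + beta2 + D2 / 2) => _ [l /= ln0 <-].
have l2 : (2 <= l)%N by exact: leq_trans ln0.
have l1 : 1 <= l%:R :> R by rewrite ler1n ltnW.
have l0 : 0 < l%:R :> R by lra.
have x0 : 0 < ln (l%:R : R) by rewrite ln_gt0// ltr1n.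
rewrite lnE// mulrC ler_pdivrMr//.
have h1 : ln (ln (l%:R : R)) < ln l%:R := ln_sublinear x0.
have h2 : ln (l%:R : R) < l%:R := ln_sublinear l0.
rewrite !mulrDl !lerD//.
- by apply: le_trans (ler_norm _) _; rewrite ler_peMr.
- by rewrite ler_wpM2l//; lra.
- by rewrite ler_wpM2l//; lra.
Unshelve. all: by end_near. Qed.

Lemma max_over_ge (R : realType) k0 k1 (a : nat -> R) k : (k0 < k <= k1)%N -> a k <= max_over k0 k1 a.
Proof.
by move=> kk; apply: le_bigmax_seq => //; rewrite mem_index_iota ltnS.
Qed.

Lemma min_over_le (R : realType) k0 k1 (a : nat -> R) k : (k0 < k <= k1)%N -> min_over k0 k1 a <= a k.
Proof.
by move=> kk; apply: ge_bigmin_seq => //; rewrite mem_index_iota ltnS.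
Qed.

Theorem theorem2 (R : realType) (d : measure_display) (Z : measurableType d)
    (mu : {measure set Z -> \bar R}) (dT : measure_display)
    (T : measurableType dT) (M : model mu T) (Q : prior M) (kmax : nat)
    (alpha Mc : nat -> R) (D1 : nat -> R) (F : nat -> nat -> set T)
    (D2 beta1 beta2 : R) (n0 : nat) (s : R) (delta1 : nat -> R)
    (khat : forall n, n.-tuple Z -> nat)
    (kmax_gt : (kstar M < kmax)%N)
    (prior_kmax : prior_measure Q
       [set kt | (1 <= kt.1 <= kmax)%N /\ Theta M kt.1 kt.2] = 1%E)
    (A1 : condA1 M alpha Mc) (A2 : condA2 M)
    (O1 : condO1 Q kmax D1) (O2 : condO2 Q kmax D1 F)
    (O3 : condO3 Q D1 D2 beta1 beta2)
    (D2_lt : D2 < min_over (kstar M) kmax D1)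
    (n0P : is_n0 beta1 beta2 D2 n0)
    (s_gt0 : 0 < s)
    (delta1P : forall k, (kstar M < k <= kmax)%N ->
       admissible_delta1 s (C1 (alpha k) (Mc k)) (D1 k) D2 n0 (delta1 k))
    (entropy_bound : forall k n (j : nat),
       (kstar M < k <= kmax)%N -> (n0 <= n)%N ->
       let delta0 := rate_max beta1 beta2 D2 n0 in
       let dkn := delta_n (delta1 k) n in
       dkn < delta0 -> (1 <= j)%N -> j%:Z <= strict_floor (delta0 / dkn) ->
       (entropy M
          (F k n `&` (S_set M k (2 * (j%:R + 1) * dkn) `\` S_set M k (2 * j%:R * dkn)))
          (j%:R * dkn / 4)
        <= (s / (1 + s) * (n%:R * j%:R * dkn /
              (64 * (C1 (alpha k) (Mc k) + 2) * ln (j%:R * dkn) ^+ 2)))%:E)%E)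
    (khatP : is_order_estimator Q khat) :
  exists2 c3 : R, 0 < c3 & forall n, (n0 <= n)%N ->
    (law_star_n M [set z : n.-tuple Z | (kstar M < khat n z)%N]
     <= (c3 * (ln n%:R `^ (3 * max_over (kstar M) kmax D1 / 2 + beta2) /
               n%:R `^ min_over (kstar M) kmax
                         (fun k => (D1 k - D2) / 2)))%:E)%E.
Proof.
set m := kstar M in kmax_gt D2_lt delta1P entropy_bound *.
have [b10 b20 D20 [L L0 hO3]] := O3.
have m1k : (m < m.+1 <= kmax)%N by rewrite ltnSn.
(* For [n0 = 1] the last admissibility condition would bound [+oo], the extended inverse of
   [ln 1 ^+ 3 = 0], by a real number. From [n0 >= 2] follows [ln n > 0] for all [n] concerned. *)
have n02 : (2 <= n0)%N.
  have [n01 _ _] := n0P; rewrite ltn_neqAle n01 andbT; apply/eqP => n0E.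
  have [_ _] := delta1P _ m1k.
  by rewrite -n0E ln1 expr0n/= inve0 leye_eq.
have d00 := rate_max_gt0 n02 b10 b20 D20.
have D1k k : (m < k <= kmax)%N -> D2 < D1 k.
  by move=> kk; apply: lt_le_trans D2_lt _; exact: min_over_le.
pose K := (kmax - m)%N.
have kiP (i : 'I_K) : (m < m.+1 + i <= kmax)%N.
  by rewrite addSn ltnS leq_addr/= -ltn_subRL.
have Bl (i : 'I_K) : exists c : R, \forall n \near \oo,
    (law_star_n M [set z : n.-tuple Z |
       (((beta1 * ln n%:R `^ beta2 * n%:R `^ (D2 / 2))^-1)%:E <= bayes_B Q (m.+1 + i) z)%E]
     <= (c * rate (D1 (m.+1 + i)%N) D2 beta2 n)%:E)%E.
  have ki := kiP i; have [h1 _ _] := delta1P _ ki.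
  apply: (bayes_B_ge_threshold_rate (n0 := n0) ki A1 A2 O1 O2 b10 b20 D20 (D1k _ ki) d00 s_gt0 h1).
  by move=> n j nn0; exact: (entropy_bound _ n j ki nn0).
have [c hc] := choice Bl.
pose RATE n : R := ln n%:R `^ (3 * max_over m kmax D1 / 2 + beta2) /
   n%:R `^ min_over m kmax (fun k => (D1 k - D2) / 2).
(* With [ln n >= 1], both [ln n] and [ln (ln n)] are nonnegative, so the exponents may be replaced
   by their extreme values over the orders. *)
have RATE_ge k n : (m < k <= kmax)%N -> 1 <= ln (n%:R : R) -> rate (D1 k) D2 beta2 n <= RATE n.
  move=> kk x1; have n1 : (0 < n)%N.
    by rewrite lt0n; apply/eqP => n0'; move: x1; rewrite n0' ln0// ler10.
  rewrite /RATE !powR_expR ?ltr0n//; last lra.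
  rewrite -expRB ler_expR lerB//.
    apply: ler_wpM2r; first by rewrite ln_ge0.
    by have := max_over_ge D1 kk; lra.
  apply: ler_wpM2r; first lra.
  exact: (min_over_le (fun k => (D1 k - D2) / 2) kk).
pose C := L + \sum_(i < K) `|c i|.
have C0 : 0 < C by rewrite ltr_wpDr// sumr_ge0.
have large : \forall n \near \oo,
    (law_star_n M [set z : n.-tuple Z | (m < khat n z)%N] <= (C * RATE n)%:E)%E.
  have hc' : \forall n \near \oo, forall i : 'I_K,
    (law_star_n M [set z : n.-tuple Z |
       (((beta1 * ln n%:R `^ beta2 * n%:R `^ (D2 / 2))^-1)%:E <= bayes_B Q (m.+1 + i) z)%E]
     <= (c i * rate (D1 (m.+1 + i)%N) D2 beta2 n)%:E)%E.
    by apply: filter_forall => i; exact: hc.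
  near=> n.
  have n1 : (1 <= n)%N by near: n; exists 1%N.
  have x1 : 1 <= ln (n%:R : R) by near: n; exact: near_ln_ge.
  have x0 : 0 < ln (n%:R : R) by lra.
  have hcn : forall i : 'I_K, (law_star_n M [set z : n.-tuple Z |
       (((beta1 * ln n%:R `^ beta2 * n%:R `^ (D2 / 2))^-1)%:E <= bayes_B Q (m.+1 + i) z)%E]
     <= (c i * rate (D1 (m.+1 + i)%N) D2 beta2 n)%:E)%E.
    by near: n; exact: hc'.
  have {}hO3 := hO3 n n1.
  set thr := (beta1 * _ * _)^-1 in hO3 hcn.
  have thr0 : 0 < thr.
    by rewrite /thr invr_gt0 mulr_gt0 ?mulr_gt0// ?powR_gt0// ltr0n.
  have [mk hk] := khatP n n1.
  pose B0 := [set z : n.-tuple Z | (bayes_B Q m z < thr%:E)%E].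
  pose B (i : 'I_K) := [set z : n.-tuple Z | (thr%:E <= bayes_B Q (m.+1 + i) z)%E].
  have mB0 : measurable B0.
    rewrite -[X in measurable X]setTI; apply: emeasurable_fun_infty_o => //.
    exact: measurable_bayes_B (kstar_gt0 M).
  have mB i : measurable (B i).
    rewrite -[X in measurable X]setTI; apply: emeasurable_fun_c_infty => //.
    exact: measurable_bayes_B.
  have mA : measurable [set z : n.-tuple Z | (m < khat n z)%N].
    have := mk measurableT [set k | (m < k)%N] I; rewrite setTI; exact.
  pose P := tuple_measure (law_star M) n.
  have mU : measurable (\big[setU/set0]_(i < K) B i).
    by apply: bigsetU_measurable => i _; exact: mB.
  have sub : [set z : n.-tuple Z | (m < khat n z)%N] `<=` B0 `|` \big[setU/set0]_(i < K) B i.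
    move=> z /= mz; have [kz1 kz] := hk z.
    have hle := bayes_B_le_argmax prior_kmax kz1 kz (kstar_gt0 M).
    have [hlt|hge] := ltP (bayes_B Q m z) thr%:E; first by left.
    right; have [kk|kk] := leqP (khat n z) kmax.
      have iK : (khat n z - m.+1 < K)%N.
        by rewrite /K ltn_subLR// addSn ltnS subnKC// ltnW.
      rewrite (bigD1 (Ordinal iK))//=; left.
      have iE : (m.+1 + Ordinal iK)%N = khat n z by exact: subnKC.
      by rewrite /B iE; exact: le_trans hge hle.
    (* An order above [kmax] has zero prior mass and hence zero marginal likelihood, which cannot
       dominate that of the true order when the latter reaches [thr]. *)
    have : (thr%:E <= 0 :> \bar R)%E.
      apply: le_trans (le_trans hge hle) _.
      by rewrite /bayes_B (prior_order_kmax prior_kmax kk) mul0e.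
    by rewrite lee_fin leNgt thr0.
  apply: (@le_trans _ _ (P (B0 `|` \big[setU/set0]_(i < K) B i))).
    by apply: le_measure => //; rewrite inE//; exact: measurableU.
  apply: (le_trans (measureU2 P mB0 mU)).
  rewrite /C mulrDl EFinD; apply: leeD.
    apply: (le_trans hO3); rewrite lee_fin powR_quotient_rate//.
    by rewrite ler_wpM2l ?(ltW L0)//; exact: RATE_ge.
  apply: (le_trans (measure_bigsetU_le P _ mB)).
  rewrite mulr_suml -sumEFin; apply: lee_sum => i _.
  apply: (le_trans (hcn i)); rewrite lee_fin.
  apply: (@le_trans _ _ (`|c i| * rate (D1 (m.+1 + i)%N) D2 beta2 n)).
    by rewrite ler_wpM2r ?ler_norm// expR_ge0.
  by rewrite ler_wpM2l// RATE_ge.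
have [N _ hN] := large.
have RATE0 n : 0 <= RATE n by rewrite /RATE divr_ge0 ?powR_ge0.
have sum0 : 0 <= \sum_(n < N) (RATE n)^-1 by apply: sumr_ge0 => n _; rewrite invr_ge0.
(* For [n0 <= n < N] the probability is at most [1 = (RATE n)^-1 * RATE n]; here [RATE n] is
   positive because [n >= 2]. *)
exists (C + \sum_(n < N) (RATE n)^-1); first by rewrite ltr_wpDr.
move=> n nn0; rewrite -/(RATE n).
have [Nn|nN] := leqP N n.
  apply: (le_trans (hN n Nn)); rewrite lee_fin ler_wpM2r// lerDl//.
apply: (@le_trans _ _ 1%E).
  have n1 : (1 <= n)%N by apply: leq_trans nn0; exact: ltnW.
  have [mk _] := khatP n n1.
  rewrite -(tuple_measure_setT (law_star M) n); apply: le_measure => //; rewrite inE//.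
  have := mk measurableT [set k | (m < k)%N] I; rewrite setTI; exact.
have Rp : 0 < RATE n.
  have n2 : (2 <= n)%N by exact: leq_trans nn0.
  have x0 : 0 < ln (n%:R : R) by rewrite ln_gt0// ltr1n.
  have npos : 0 < n%:R :> R by rewrite ltr0n ltnW.
  exact: divr_gt0 (powR_gt0 _ x0) (powR_gt0 _ npos).
rewrite lee_fin -[leLHS](@mulVf _ (RATE n)) ?gt_eqF// ler_wpM2r//.
rewrite (bigD1 (Ordinal nN))//= addrCA lerDl addr_ge0 ?(ltW C0)//.
by apply: sumr_ge0 => i _; rewrite invr_ge0.
Unshelve. all: by end_near. Qed.
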